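(* Let $\rho\in(0,1)$, let $\{\eta_t;t\ge0\}$ be the lattice gas with interaction rate $r$ started from the product Bernoulli measure $\nu_\rho$, and let $f:\Omega\to\mathbb R$ be a local function. Set $\varphi_f(\beta)=\int f\,d\nu_\beta$ and assume $\varphi_f(\rho)=0$. There exists a finite constant $c=c(f,\rho)$ such that: (i) if $\varphi_f'(\rho)\ne0$, then $$\mathbb E_\rho\Big[\Big(\int_0^t\big\{f(\eta_s)-\varphi_f'(\rho)(\eta_s^\ell-\rho)\big\}ds\Big)^2\Big]\le c\Big(t\ell+\frac{t^2}{\ell^2}\Big)$$ for any $t\ge0$ and any $\ell\in\mathbb N$; (ii) if $\varphi_f'(\rho)=0$, then $$\mathbb E_\rho\Big[\Big(\int_0^t\Big\{f(\eta_s)-\frac{\varphi_f''(\rho)}2\Big((\eta_s^\ell-\rho)^2-\frac{\chi(\rho)}\ell\Big)\Big\}ds\Big)^2\Big]\le c\Big(t(\log\ell)^2+\frac{t^2}{\ell^3}\Big)$$ for any $t\ge0$ and any $\ell\in\mathbb N$.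
   Context: $\Omega=\{0,1\}^{\mathbb Z}$. A function $f:\Omega\to\mathbb R$ is local if it depends on finitely many coordinates. $\tau_x\eta(z)=\eta(z+x)$ and $\tau_xf(\eta)=f(\tau_x\eta)$. The rate $r:\Omega\to\mathbb R$ is a fixed local function such that (i) there is $\varepsilon_0>0$ with $\varepsilon_0\le r(\eta)\le\varepsilon_0^{-1}$ for all $\eta\in\Omega$; (ii) $r(\eta)=r(\xi)$ whenever $\eta(x)=\xi(x)$ for all $x\ne0,1$. Put $r_x=\tau_xr$; $\eta^{x,y}$ is $\eta$ with the values at $x$ and $y$ exchanged, and $\nabla_{x,y}f(\eta)=f(\eta^{x,y})-f(\eta)$. The lattice gas with interaction rate $r$ is the Markov process on $\Omega$ generated by $Lf=\sum_{x\in\mathbb Z}r_x\nabla_{x,x+1}f$ ($f$ local). $\nu_\rho$ is the product Bernoulli measure on $\Omega$ with density $\rho$; $\mathbb E_\rho$ is expectation for the process started from $\nu_\rho$. $\chi(\rho)=\rho(1-\rho)$. For $\eta\in\Omega$, $\ell\in\mathbb N=\{1,2,\dots\}$, $\eta^\ell=\ell^{-1}\sum_{x=1}^\ell\eta(x)$, and $\eta_s^\ell$ is this average for the configuration $\eta_s$. The constant $c$ may depend on the fixed rate $r$. *)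

(* Defs.v *)
From HB Require Import structures.
From mathcomp Require Import all_boot all_order all_algebra.
From mathcomp Require Import all_classical all_reals all_analysis.

Set Implicit Arguments.
Unset Strict Implicit.
Unset Printing Implicit Defensive.

Import Order.TTheory GRing.Theory Num.Theory.
Import numFieldNormedType.Exports.

Local Open Scope classical_set_scope.
Local Open Scope ring_scope.

(* Omega carries the product of the discrete topologies, and the sigma-algebra
   generated by the coordinates (which is its Borel sigma-algebra). *)
Definition Omega := int -> bool.

Definition coordinate_sets : set (set Omega) :=
  range (fun x : int => [set eta : Omega | eta x]).

HB.instance Definition _ := Pointed.on Omega.
HB.instance Definition _ :=
  Topological.copy Omega (prod_topology (fun _ : int => bool)).
HB.instance Definition _ :=
  Measurable.copy Omega (g_sigma_algebraType coordinate_sets).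

Definition shift (x : int) (eta : Omega) : Omega := fun z => eta (z + x).

Definition exchange (x y : int) (eta : Omega) : Omega :=
  fun z => if z == x then eta y else if z == y then eta x else eta z.

Section LatticeGas.
Context {R : realType}.
Implicit Types (f g r : Omega -> R) (nu : R -> probability Omega R).

Definition local f : Prop :=
  exists A : seq int,
    forall eta xi : Omega, {in A, eta =1 xi} -> f eta = f xi.

Record interaction_rate r : Prop := InteractionRate {
  rate_local : local r;
  rate_elliptic : exists2 e0 : R, 0 < e0 & forall eta, e0 <= r eta <= e0^-1;
  rate_bond : forall eta xi : Omega,
    (forall x : int, x != 0 -> x != 1 -> eta x = xi x) -> r eta = r xi
}.

Definition shift_fun (x : int) f : Omega -> R := fun eta => f (shift x eta).

Definition gradient (x y : int) f : Omega -> R :=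
  fun eta => f (exchange x y eta) - f eta.

(* For local f only finitely many terms of the sum are nonzero, so the
   finitely supported sum over all of int is the intended one. *)
Definition gasL r f : Omega -> R := fun eta =>
  \sum_(x \in [set: int]) shift_fun x r eta * gradient x (x + 1) f eta.

(* Markov semigroups on C(Omega); S t is only meaningful for t >= 0 and on
   continuous functions. *)
Record markov_semigroup (S : R -> (Omega -> R) -> (Omega -> R)) : Prop :=
  MarkovSemigroup {
  semigroup_cont : forall t f, 0 <= t -> continuous f -> continuous (S t f);
  semigroup_linear : forall t (a : R) f g,
    0 <= t -> continuous f -> continuous g ->
    S t (fun eta => a * f eta + g eta) = (fun eta => a * S t f eta + S t g eta);
  semigroup0 : forall f, continuous f -> S 0 f = f;
  semigroupD : forall s t f, 0 <= s -> 0 <= t -> continuous f ->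
    S (s + t) f = S s (S t f);
  semigroup1 : forall t, 0 <= t -> S t (fun=> 1) = (fun=> 1);
  semigroup_ge0 : forall t f, 0 <= t -> continuous f ->
    (forall eta, 0 <= f eta) -> forall eta, 0 <= S t f eta;
  semigroup_right_cont : forall t f, 0 <= t -> continuous f ->
    {uniform, S s f @[s --> t^'+] --> S t f}
}.

(* The graph of the infinitesimal generator of S. *)
Definition generator_graph (S : R -> (Omega -> R) -> (Omega -> R)) :
    set ({uniform Omega -> R} * {uniform Omega -> R}) :=
  [set fg | [/\ continuous (fg.1 : Omega -> R),
                continuous (fg.2 : Omega -> R) &
    {uniform, (fun eta => (S h fg.1 eta - fg.1 eta) / h) @[h --> 0^'+]
              --> fg.2}]].

Definition local_graph r : set ({uniform Omega -> R} * {uniform Omega -> R}) :=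
  [set fg | local fg.1 /\ fg.2 = gasL r fg.1].

(* S is the semigroup generated by L: the local functions are a core. *)
Definition gas_semigroup r (S : R -> (Omega -> R) -> (Omega -> R)) : Prop :=
  markov_semigroup S /\ generator_graph S = closure (local_graph r).

(* The sigma-algebra generated by the (eta_u), 0 <= u <= s. *)
Definition history d (T : measurableType d) (eta : R -> T -> Omega) (s : R) :
    set (set T) :=
  <<s \bigcup_(u in `[0, s]%classic)
        preimage_set_system setT (eta u) measurable >>.

Record lattice_gas r (nu0 : probability Omega R) d (T : measurableType d)
    (P : probability T R) (eta : R -> {RV P >-> Omega}) : Prop := LatticeGas {
  gas_init : forall B, measurable B -> distribution P (eta 0) B = nu0 B;
  gas_cadlag_right : forall (w : T) (t : R), 0 <= t ->
    eta s w @[s --> t^'+] --> (eta t w : Omega);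
  gas_cadlag_left : forall (w : T) (t : R), 0 < t ->
    exists xi : Omega, eta s w @[s --> t^'-] --> xi;
  gas_markov : exists2 S, gas_semigroup r S &
    forall (s t : R) f (A : set T), 0 <= s -> 0 <= t -> continuous f ->
      history eta s A ->
      (\int[P]_(w in A) (f (eta (s + t) w))%:E =
       \int[P]_(w in A) (S t f (eta s w))%:E)%E
}.

Definition bernoulli_product (b : R) (nub : probability Omega R) : Prop :=
  forall (A : seq int) (a : int -> bool), uniq A ->
    nub [set eta : Omega | {in A, eta =1 a}] =
    (\prod_(x <- A) (if a x then b else 1 - b))%:E.

Definition phi nu f : R -> R := fun b => \int[nu b]_eta f eta.

Definition chi (rho : R) : R := rho * (1 - rho).

Definition block_average (l : nat) (eta : Omega) : R :=
  l%:R^-1 * \sum_(1 <= x < l.+1) (eta x%:Z)%:R.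

End LatticeGas.

(* Main.v *)
Require Import Defs.
From HB Require Import structures.
From mathcomp Require Import all_boot all_order all_algebra.
From mathcomp Require Import all_classical all_reals all_analysis.
From mathcomp Require Import measurable_realfun ring lra zify.

Set Implicit Arguments.
Unset Strict Implicit.
Unset Printing Implicit Defensive.

Import Order.TTheory GRing.Theory Num.Theory.
Import numFieldNormedType.Exports.

Local Open Scope classical_set_scope.
Local Open Scope ring_scope.

(** Write bar x = eta x - rho. A local function is a linear combination of
    products of bar x over finite sets A, and such a product has nu_b-mean
    (b - rho)^|A|; hence phi' and phi''/2 at rho are the sums of the coefficients
    of degrees 1 and 2, and it suffices to treat one product at a time.

    If <V, h> <= 2 K sqrt (D h) for all local h, D being the Dirichlet form, then
    the second moment of the time integral of V over [0, t] is of order t K^2.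
    Indeed, by reversibility the correlations <V, S_s V> are nonnegative, so a
    Riemann sum u of s |-> S_s V satisfies D u <= <V, u> up to a small error; the
    bound on V then controls <V, u>, which is the sum of the correlations.

    Moving one factor bar x to a neighbouring site costs a gradient, which is odd
    under the exchange of the two sites and so is paid by one term of the
    Dirichlet form. Spreading the k factors of a product over k disjoint blocks
    of length m thus costs the energy of a unit flow: K of order sqrt m for
    k = 1, and O(1) per doubling of m for k >= 2, that is, log m in total. The
    resulting product of k block averages has variance of order m^(-k), which
    gives the terms in t^2. *)

(** * Bounded random variables *)

(** The exponents come from one count: moving a factor over a distance n past a spectator of second
    moment g costs K of order sqrt (n g). At scale m the distance is of order m and the other k - 1
    factors have second moment m^(1 - k), so K is of order m^(1 - k/2); k = 2 is the critical case.

    In (ii) the comparison is with the square of one block average, not with a product over two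
    blocks. As bar x ^ 2 = chi + (1 - 2 rho) bar x, the diagonal of the square yields chi / l and a
    linear remainder of variance of order l^(-3); the off-diagonal part has to reach the two-block
    product at bounded cost. Terms of degree one have coefficients of sum 0, so gathering them at a
    fixed site is also of bounded cost. At l = 1 the logarithm vanishes and stationarity alone is
    used.

    The semigroup is known only through its core of local functions, and S_s V need not be local.
    Symmetry and energy bounds are proved for local functions and carried over by approximating a
    function and its image under L simultaneously; discrete times with errors o(h) take the place of
    spectral calculus. *)

Lemma bounded_Rintegral_cvg d (T : measurableType d) (R : realType)
    (mu : {measure set T -> \bar R}) (D : set T) (X_ : nat -> T -> R)
    (X : T -> R) (M : R) :
  measurable D -> (mu D < +oo)%E -> (forall n, measurable_fun D (X_ n)) ->
  (forall n w, D w -> `|X_ n w| <= M) ->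
  (forall w, D w -> X_ n w @[n --> \oo] --> X w) ->
  [/\ measurable_fun D X, forall w, D w -> `|X w| <= M &
      \int[mu]_(w in D) X_ n w @[n --> \oo] --> \int[mu]_(w in D) X w].
Proof.
move=> mD muD mX XM Xl.
have mXl : measurable_fun D X by exact: measurable_fun_cvg Xl.
have XlM w : D w -> `|X w| <= M.
  move=> Dw; have /cvg_norm H := Xl w Dw.
  by apply: (closed_cvg _ (@closed_le R M) _ _ H) => //; apply: nearW => n /=; exact: XM.
split=> //.
have intM : mu.-integrable D (fun=> M%:E).
  by apply: measurable_bounded_integrable => //; exists `|M|; split;
     rewrite ?num_real// => x Mx w _; exact: ltW.
have intX (Y : T -> R) : measurable_fun D Y -> (forall w, D w -> `|Y w| <= M) ->
    mu.-integrable D (EFin \o Y).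
  move=> mY YM; apply: measurable_bounded_integrable => //.
  by exists M; split; rewrite ?num_real// => x Mx w Dw; exact: le_trans (YM w Dw) (ltW Mx).
have XlE w : D w -> (X_ n w)%:E @[n --> \oo] --> (X w)%:E.
  by move=> Dw; apply/fine_cvgP; split; [exact: nearW | exact: Xl].
have [_ _ cvX] := @dominated_convergence _ T R mu D mD
  (fun n => EFin \o X_ n) (EFin \o X) (fun=> M%:E)
  (fun n => iffRL (measurable_EFinP _ _) (mX n))
  (iffRL (measurable_EFinP _ _) mXl)
  (aeW _ XlE)
  intM (aeW _ (fun w n Dw => XM n w Dw)).
apply: fine_cvg; rewrite fineK//.
by apply: integrable_fin_num => //; exact: intX.
Qed.

Section BoundedMeasurable.
Context d (T : measurableType d) {R : realType}.
Implicit Types X Y : T -> R.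

(** Stable under sums, products and pointwise bounded limits, and integrable for every probability:
    one side condition serves all expectation identities. *)
Definition bm X := measurable_fun setT X /\ exists M : R, forall w, `|X w| <= M.

Lemma bm_cst (c : R) : bm (fun=> c).
Proof. by split; [exact: measurable_cst | exists `|c|]. Qed.

Lemma bmD X Y : bm X -> bm Y -> bm (fun w => X w + Y w).
Proof.
move=> [mX [M XM]] [mY [N YN]]; split; first exact: measurable_funD.
by exists (M + N) => w; rewrite (le_trans (ler_normD _ _))// lerD.
Qed.

Lemma bmM X Y : bm X -> bm Y -> bm (fun w => X w * Y w).
Proof.
move=> [mX [M XM]] [mY [N YN]]; split; first exact: measurable_funM.
by exists (M * N) => w; rewrite normrM ler_pM.
Qed.

Lemma bmZ c X : bm X -> bm (fun w => c * X w).
Proof. exact/bmM/bm_cst. Qed.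

Lemma bmN X : bm X -> bm (fun w => - X w).
Proof. by move=> bX; under eq_fun do rewrite -mulN1r; exact: bmZ. Qed.

Lemma bmB X Y : bm X -> bm Y -> bm (fun w => X w - Y w).
Proof. by move=> bX bY; apply: bmD => //; apply: bmN. Qed.

Lemma bmX X n : bm X -> bm (fun w => X w ^+ n).
Proof.
move=> bX; elim: n => [|n IH]; first exact: bm_cst.
by under eq_fun do rewrite exprS; exact: bmM.
Qed.

Lemma bm_sum I (s : seq I) (F : I -> T -> R) :
  (forall i, bm (F i)) -> bm (fun w => \sum_(i <- s) F i w).
Proof.
move=> bF; elim: s => [|i s IH].
  by under eq_fun do rewrite big_nil; exact: bm_cst.
by under eq_fun do rewrite big_cons; exact: bmD.
Qed.

Section Expectation.
Variable P : probability T R.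

Definition Ex X := \int[P]_w X w.

Lemma bm_integrable X (A : set T) : measurable A -> bm X ->
  P.-integrable A (EFin \o X).
Proof.
move=> mA [mX [M XM]]; apply: (@measurable_bounded_integrable _ _ _ P) => //.
- by rewrite (le_lt_trans (probability_le1 P mA))// ltry.
- exact: (measurable_funS _ _ mX).
- by exists M; split; rewrite ?num_real// => x Mx w _; exact: le_trans (XM w) (ltW Mx).
Qed.

Lemma ExE X : bm X -> (\int[P]_w (X w)%:E)%E = (Ex X)%:E.
Proof.
by move=> bX; rewrite /Ex /Rintegral fineK//; apply: integrable_fin_num => //;
  exact: bm_integrable.
Qed.

Lemma eq_Ex X Y : X =1 Y -> Ex X = Ex Y.
Proof. by move=> /funext ->. Qed.

Lemma Ex_cst (c : R) : Ex (fun=> c) = c.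
Proof. by rewrite /Ex Rintegral_cst// (_ : fine _ = 1) ?mulr1//= [X in fine X]probability_setT. Qed.

Lemma ExD X Y : bm X -> bm Y -> Ex (fun w => X w + Y w) = Ex X + Ex Y.
Proof. by move=> bX bY; apply: RintegralD => //; exact: bm_integrable. Qed.

Lemma ExZ c X : bm X -> Ex (fun w => c * X w) = c * Ex X.
Proof. by move=> bX; apply: RintegralZl => //; exact: bm_integrable. Qed.

Lemma ExN X : bm X -> Ex (fun w => - X w) = - Ex X.
Proof.
by move=> bX; rewrite -mulN1r -ExZ//; apply: eq_Ex => w; rewrite mulN1r.
Qed.

Lemma ExB X Y : bm X -> bm Y -> Ex (fun w => X w - Y w) = Ex X - Ex Y.
Proof. by move=> bX bY; rewrite ExD ?ExN//; exact: bmN. Qed.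

Lemma Ex_sum I (s : seq I) (F : I -> T -> R) : (forall i, bm (F i)) ->
  Ex (fun w => \sum_(i <- s) F i w) = \sum_(i <- s) Ex (F i).
Proof.
move=> bF; elim: s => [|i s IH].
  by rewrite big_nil -[RHS](Ex_cst 0); apply: eq_Ex => w; rewrite big_nil.
rewrite big_cons -IH -ExD//; last exact: bm_sum.
by apply: eq_Ex => w; rewrite big_cons.
Qed.

Lemma Ex_ge0 X : (forall w, 0 <= X w) -> 0 <= Ex X.
Proof. by move=> X0; apply: Rintegral_ge0. Qed.

Lemma le_Ex X Y : bm X -> bm Y -> (forall w, X w <= Y w) -> Ex X <= Ex Y.
Proof. by move=> bX bY XY; apply: le_Rintegral => //; exact: bm_integrable. Qed.

Lemma Ex_norm_le X M : bm X -> (forall w, `|X w| <= M) -> `|Ex X| <= M.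
Proof.
move=> bX XM; rewrite ler_norml -{1}(Ex_cst (- M)) -{2}(Ex_cst M).
by rewrite !le_Ex//; try exact: bm_cst; move=> w; have := XM w;
  rewrite ler_norml => /andP[].
Qed.

Lemma Ex_dct (X_ : nat -> T -> R) X M : (forall n, bm (X_ n)) ->
  (forall n w, `|X_ n w| <= M) -> (forall w, X_ n w @[n --> \oo] --> X w) ->
  bm X /\ Ex (X_ n) @[n --> \oo] --> Ex X.
Proof.
move=> bX XM Xl.
have PT : (P setT < +oo)%E by rewrite probability_setT ltry.
have mX n : measurable_fun setT (X_ n) by case: (bX n).
have [mXl XlM cvX] := bounded_Rintegral_cvg measurableT PT mX
  (fun n w _ => XM n w) (fun w _ => Xl w).
by split=> //; split=> //; exists M => w; exact: XlM.
Qed.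

End Expectation.
End BoundedMeasurable.

(** * Local and continuous functions *)

Definition update (x : int) (b : bool) (eta : Omega) : Omega :=
  fun z => if z == x then b else eta z.

Lemma update_id x eta : update x (eta x) eta = eta.
Proof. by apply/funext => z; rewrite /update; case: eqP => [->|]. Qed.

Lemma updateC x y a b eta : x != y ->
  update x a (update y b eta) = update y b (update x a eta).
Proof.
move=> xy; apply/funext => z; rewrite /update; case: eqP => [->|//].
by rewrite (negPf xy).
Qed.

Lemma update_update x a b eta : update x a (update x b eta) = update x a eta.
Proof. by apply/funext => z; rewrite /update; case: eqP. Qed.

Lemma exchange_update x y a b eta : x != y ->
  exchange x y (update x a (update y b eta)) = update x b (update y a eta).
Proof.
move=> xy; apply/funext => z; rewrite /exchange /update !eqxx.
rewrite [y == x]eq_sym (negPf xy).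
by case: (z == x) => //; case: (z == y).
Qed.

Lemma exchangeK x y : involutive (exchange x y).
Proof.
move=> eta; apply/funext => z; rewrite /exchange !eqxx.
have [->|zx] := eqVneq z x; first by case: ifP => [/eqP->|].
by have [->|//] := eqVneq z y.
Qed.

Section LocalFunctions.
Context {R : realType}.
Implicit Types f g : Omega -> R.

(** Pointwise invariance rather than a property of a measure; independence under Bernoulli products
    is derived from it in [Ex_site]. *)
Definition indep (x : int) f := forall b eta, f (update x b eta) = f eta.

Lemma local_cst (c : R) : local (fun=> c).
Proof. by exists [::]. Qed.

Lemma local_op2 (op : R -> R -> R) f g : local f -> local g ->
  local (fun eta => op (f eta) (g eta)).
Proof.
move=> [A fA] [B gB]; exists (A ++ B) => eta xi eq_AB.
by rewrite (fA eta xi) ?(gB eta xi)// => x xs; apply: eq_AB; rewrite mem_cat xs// orbT.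
Qed.

Lemma localD f g : local f -> local g -> local (fun eta => f eta + g eta).
Proof. exact: local_op2. Qed.

Lemma localM f g : local f -> local g -> local (fun eta => f eta * g eta).
Proof. exact: local_op2. Qed.

Lemma localB f g : local f -> local g -> local (fun eta => f eta - g eta).
Proof. exact: (local_op2 (fun a b => a - b)). Qed.

Lemma localN f : local f -> local (fun eta => - f eta).
Proof. by move=> [A fA]; exists A => eta xi /fA ->. Qed.

Lemma localZ c f : local f -> local (fun eta => c * f eta).
Proof. by move=> [A fA]; exists A => eta xi /fA ->. Qed.

Lemma localX n f : local f -> local (fun eta => f eta ^+ n).
Proof. by move=> [A fA]; exists A => eta xi /fA ->. Qed.

Lemma local_big (op : R -> R -> R) (e : R) I (s : seq I) (F : I -> Omega -> R) :
  (forall i, local (F i)) -> local (fun eta => \big[op/e]_(i <- s) F i eta).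
Proof.
move=> lF; elim: s => [|i s IH].
  by under eq_fun do rewrite big_nil; exact: local_cst.
by under eq_fun do rewrite big_cons; exact: local_op2.
Qed.

Lemma local_site (F : bool -> R) x : local (fun eta => F (eta x)).
Proof. by exists [:: x] => eta xi -> //; rewrite inE. Qed.

Lemma local_comp f (F : Omega -> Omega) : local f ->
  (forall x, exists s : seq int,
    forall eta xi : Omega, {in s, eta =1 xi} -> F eta x = F xi x) ->
  local (fun eta => f (F eta)).
Proof.
move=> [A fA] FA.
suff [B FB] : exists B : seq int,
    forall eta xi : Omega, {in B, eta =1 xi} -> {in A, F eta =1 F xi}.
  by exists B => eta xi /FB/fA.
elim: A {fA} => [|x A [B FB]]; first by exists [::].
have [s Fs] := FA x; exists (s ++ B) => eta xi eq_sB y.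
rewrite inE => /orP[/eqP->|yA].
  by apply: Fs => z zs; apply: eq_sB; rewrite mem_cat zs.
by apply: FB yA => z zs; apply: eq_sB; rewrite mem_cat zs orbT.
Qed.

Lemma local_update x b f : local f -> local (fun eta => f (update x b eta)).
Proof.
move=> lf; apply: local_comp lf _ => z; exists [:: z] => eta xi e.
by rewrite /update; case: ifP => // _; apply: e; rewrite inE.
Qed.

Lemma local_exchange x y f : local f -> local (fun eta => f (exchange x y eta)).
Proof.
move=> lf; apply: local_comp lf _ => z; exists [:: x; y; z] => eta xi e.
by rewrite /exchange !(e x, e y, e z)// !inE eqxx ?orbT.
Qed.

Lemma local_shift x f : local f -> local (shift_fun x f).
Proof.
move=> lf; apply: local_comp lf _ => z; exists [:: z + x] => eta xi e.
by rewrite /Defs.shift; apply: e; rewrite inE.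
Qed.

Lemma local_gradient x y f : local f -> local (gradient x y f).
Proof. by move=> lf; apply: localB => //; exact: local_exchange. Qed.

(** A local function is a finite decision tree that reads one site at each node; the induction runs
    over the sites it depends on. *)
Lemma local_ind (Q : (Omega -> R) -> Prop) :
  (forall c, Q (fun=> c)) ->
  (forall x f1 f0, Q f1 -> Q f0 ->
     Q (fun eta => if eta x then f1 eta else f0 eta)) ->
  forall f, local f -> Q f.
Proof.
move=> Qc Qif f [A]; elim: A f => [|x A IH] f fA.
  by rewrite (_ : f = fun=> f point)//; apply/funext => eta; exact: fA.
rewrite (_ : f = fun eta => if eta x then f (update x true eta)
                            else f (update x false eta)); last first.
  by apply/funext => eta; case: ifP => <-; rewrite update_id.
apply: Qif; apply: IH => eta xi eq_A; apply: fA => z;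
  by rewrite inE /update; case: eqP => //= _; exact: eq_A.
Qed.

Lemma measurable_site x : measurable [set eta : Omega | eta x].
Proof. by apply: sub_gen_smallest; exists x. Qed.

Lemma local_bm f : local f -> bm f.
Proof.
move: f; apply: local_ind => [c|x f1 f0 [m1 [M1 h1]] [m0 [M0 h0]]].
  exact: bm_cst.
split.
  apply: measurable_fun_ifT => //.
  apply: (@measurable_fun_bool _ _ _ _ true); rewrite setTI.
  by rewrite (_ : _ @^-1` _ = [set eta : Omega | eta x])//; exact: measurable_site.
exists (Num.max M1 M0) => eta; case: ifP => _.
  by rewrite (le_trans (h1 eta))// le_max lexx.
by rewrite (le_trans (h0 eta))// le_max lexx orbT.
Qed.

Lemma continuous_site x (eta : Omega) : \forall xi \near eta, (xi : Omega) x = eta x.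
Proof.
have := @proj_continuous int (fun=> bool) x eta.
by move=> /(_ [set b | b = eta x]); apply; exact: discrete_set1.
Qed.

Lemma local_continuous f : local f -> continuous f.
Proof.
move=> [A fA] eta; apply: cvg_near_cst.
suff : \forall xi \near eta, {in A, eta =1 (xi : Omega)}.
  by apply: filterS => xi /fA ->.
elim: A {fA} => [|x A IH]; first by apply: (@nearW _ (nbhs eta)).
near=> xi => z; rewrite inE => /orP[/eqP->|zA].
  by apply/esym; near: xi; exact: continuous_site.
by move: z zA; near: xi.
Unshelve. all: by end_near. Qed.

(** Functions precomposed with [truncate n] are local and keep their bounds, and they converge
    pointwise if the function is continuous. This is the passage from local to continuous
    functions. *)
Definition truncate (n : nat) (eta : Omega) : Omega :=
  fun z => (`|z| <= n)%N && eta z.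

Lemma local_truncate n f : local (fun eta => f (truncate n eta)).
Proof.
exists [seq i%:Z - n%:Z | i <- iota 0 (n + n).+1] => eta xi e.
congr (f _); apply/funext => z; rewrite /truncate.
case: leqP => //= zn; apply: e; apply/mapP; exists (absz (z + n%:Z)); last by lia.
by rewrite mem_iota; lia.
Qed.

Lemma truncate_cvg eta : truncate n eta @[n --> \oo] --> eta.
Proof.
apply/cvg_sup => x U [_ [[V oV <-] Vx] sVU]; apply: filterS sVU _.
by exists `|x|%N => // n /= xn; rewrite /truncate xn.
Qed.

Lemma compact_Omega : compact [set: Omega].
Proof.
rewrite (_ : setT = [set f : Omega | forall i, [set: bool] (f i)]).
  exact: (@tychonoff int (fun=> bool) (fun=> setT) (fun=> bool_compact)).
by apply/seteqP; split.
Qed.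

(** Compactness of Omega gives the bound. Measurability for the sigma-algebra of the coordinates
    comes from the pointwise limit of the local functions [f (truncate n eta)]. *)
Lemma continuous_bm f : continuous f -> bm f.
Proof.
move=> cf.
have [M fM] : exists M : R, forall eta, `|f eta| <= M.
  have /compact_bounded[M [_ fM]] := continuous_compact
    (continuous_subspaceT cf) compact_Omega.
  by exists (M + 1) => eta; apply: fM; rewrite ?ltrDl//; exists eta.
split; last by exists M.
apply: (@measurable_fun_cvg _ _ _ setT (fun n eta => f (truncate n eta))).
  by move=> n; case: (local_bm (local_truncate n f)).
by move=> eta _; apply: continuous_cvg; [exact: cf | exact: truncate_cvg].
Qed.

End LocalFunctions.

Section IndepFunctions.
Context {R : realType}.
Implicit Types f g : Omega -> R.

Lemma indep_op2 (op : R -> R -> R) x f g : indep x f -> indep x g ->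
  indep x (fun eta => op (f eta) (g eta)).
Proof. by move=> ff fg b eta; rewrite ff fg. Qed.

Lemma indepM x f g : indep x f -> indep x g -> indep x (fun eta => f eta * g eta).
Proof. exact: indep_op2. Qed.

Lemma indep_big (op : R -> R -> R) (e : R) (I : eqType) (s : seq I)
    (F : I -> Omega -> R) x : {in s, forall i, indep x (F i)} ->
  indep x (fun eta => \big[op/e]_(i <- s) F i eta).
Proof. by move=> fF b eta; apply: eq_big_seq => i /fF ->. Qed.

Lemma indep_site (F : bool -> R) x y : x != y -> indep x (fun eta => F (eta y)).
Proof. by move=> xy b eta; rewrite /update eq_sym (negPf xy). Qed.

Lemma indep_update_eq x b f : indep x (fun eta => f (update x b eta)).
Proof. by move=> c eta; rewrite update_update. Qed.

Lemma indep_update x y b f : indep x f -> indep x (fun eta => f (update y b eta)).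
Proof.
move=> ff c eta; have [->|xy] := eqVneq y x; first by rewrite update_update.
by rewrite updateC.
Qed.

Lemma indep_exchange x y f eta : x != y -> indep x f -> indep y f ->
  f (exchange x y eta) = f eta.
Proof.
move=> xy fx fy.
rewrite -{1}(update_id y eta) -{1}(update_id x (update y _ eta)).
by rewrite exchange_update// fx fy.
Qed.

End IndepFunctions.

(** * Bernoulli measures *)

Section BernoulliExpectation.
Context {R : realType} (b : R) (nub : probability Omega R).
Hypothesis hnub : bernoulli_product b nub.
Implicit Types f g : Omega -> R.

Local Notation E := (Ex nub).

Let cyl (A : seq int) (a : int -> bool) (eta : Omega) : R :=
  \prod_(x <- A) (eta x == a x)%:R.

Let local_cyl A a : local (cyl A a).
Proof. by apply: local_big => x; exact: (local_site (fun c => (c == a x)%:R)). Qed.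

Let cylE A a eta : cyl A a eta = \1_[set xi : Omega | {in A, xi =1 a}] eta.
Proof.
rewrite indicE /cyl; have -> : eta \in [set xi : Omega | {in A, xi =1 a}] =
    all (fun x => eta x == a x) A.
  apply/idP/allP => [|h].
    by rewrite inE => /= h x /h ->.
  by rewrite inE => x /h /eqP.
elim: A => [|x A IH]; first by rewrite big_nil.
by rewrite big_cons IH /=; case: eqP; rewrite ?mul1r ?mul0r.
Qed.

Let Ex_cyl (A : seq int) a : uniq A -> E (cyl A a) = \prod_(x <- A) (if a x then b else 1 - b).
Proof.
move=> uA; apply: EFin_inj; rewrite -ExE; last exact: local_bm.
rewrite -hnub//; under eq_integral do rewrite cylE.
rewrite integral_indic ?setIT//.
rewrite -[X in measurable X]setTI.
have [+ _] := local_bm (local_cyl A a).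
rewrite (_ : [set _ | _] = cyl A a @^-1` [set 1]); first exact.
by apply/seteqP; split => eta; rewrite /= cylE indicE ?inE => h;
  [rewrite mem_set | move: h; case: (boolP (_ \in _)); rewrite ?inE//= => _ /eqP;
   rewrite eq_sym oner_eq0].
Qed.

Let cyl_cons x A a eta : cyl (x :: A) a eta = (eta x == a x)%:R * cyl A a eta.
Proof. by rewrite /cyl big_cons. Qed.

Let cyl_ext (A : seq int) (a a' : int -> bool) eta : {in A, a =1 a'} -> cyl A a eta = cyl A a' eta.
Proof. by move=> h; apply: eq_big_seq => x /h ->. Qed.

Let site x (eta : Omega) : R := (eta x)%:R.

Let local_siteR x : local (site x).
Proof. exact: (local_site (fun c => c%:R)). Qed.

(** [bernoulli_product] speaks of cylinders only, so the independence of [x] and [g] is proved by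
    pinning sites: [B] holds the pinned ones, [A] those on which [g] may still depend. A site of [A]
    is pinned to each of its two values, and [g] with that value substituted depends on one site
    fewer; once [A] is empty, [g] is constant. *)
Let ExM_site_cyl (x : int) (B : seq int) g : x \notin B -> uniq B -> indep x g ->
  forall A : seq int, (forall eta xi : Omega, {in A, eta =1 xi} -> g eta = g xi) ->
  forall a, E (fun eta => site x eta * (cyl B a eta * g eta)) =
            b * E (fun eta => cyl B a eta * g eta).
Proof.
move=> + + + A; elim: A g B => [|y A IH] g B xB uB fg gA a.
  rewrite (_ : g = fun=> g point); last by apply/funext => eta; exact: gA.
  set c := g point.
  have bc := local_bm (local_cyl B a).
  have -> : E (fun eta => cyl B a eta * c) = c * E (cyl B a).
    by rewrite -ExZ//; apply: eq_Ex => eta; rewrite mulrC.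
  have -> : E (fun eta => site x eta * (cyl B a eta * c)) =
      c * E (cyl (x :: B) (update x true a)).
    rewrite -ExZ; last exact: local_bm.
    apply: eq_Ex => eta; rewrite cyl_cons /update eqxx /site eqb_id.
    rewrite (@cyl_ext _ _ a); first by ring.
    by move=> z zB; case: eqP => // zx; rewrite zx (negPf xB) in zB.
  rewrite !Ex_cyl//= ?xB// big_cons /update eqxx mulrCA; congr (_ * (_ * _)).
  by apply: eq_big_seq => z zB; case: eqP => // zx; rewrite zx (negPf xB) in zB.
have lg : local g by exists (y :: A).
have [yx|yx] := eqVneq y x.
  apply: IH => // eta xi h; rewrite -(fg true eta) -(fg true xi).
  by apply: gA => z; rewrite inE /update yx; case: eqP => //= _; exact: h.
have key B' a' : x \notin B' -> uniq B' -> y \in B' ->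
    E (fun eta => site x eta * (cyl B' a' eta * g eta)) =
    b * E (fun eta => cyl B' a' eta * g eta).
  move=> xB' uB' yB'; pose g' eta := g (update y (a' y) eta).
  have gg' eta : cyl B' a' eta * g eta = cyl B' a' eta * g' eta.
    rewrite /g'; have [<-|ne] := eqVneq (eta y) (a' y); first by rewrite update_id.
    by rewrite /cyl (big_rem y yB')/= (negPf ne) !mul0r.
  rewrite (eq_Ex _ gg').
  have -> : E (fun eta => site x eta * (cyl B' a' eta * g eta)) =
      E (fun eta => site x eta * (cyl B' a' eta * g' eta)).
    by apply: eq_Ex => eta; rewrite gg'.
  apply: IH => //; first exact: indep_update.
  move=> eta xi h; apply: gA => z; rewrite inE /update.
  by case: eqP => //= _; exact: h.
have [yB|yB] := boolP (y \in B); first exact: key.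
have split_y eta : cyl B a eta =
    cyl (y :: B) (update y true a) eta + cyl (y :: B) (update y false a) eta.
  rewrite !cyl_cons /update !eqxx !(@cyl_ext B _ a).
  - by case: (eta y); rewrite ?mul1r ?mul0r ?addr0 ?add0r.
  - by move=> z zB; case: eqP => // zx; rewrite zx (negPf yB) in zB.
  - by move=> z zB; case: eqP => // zx; rewrite zx (negPf yB) in zB.
have bb c : bm (fun eta => cyl (y :: B) (update y c a) eta * g eta).
  by apply: local_bm; apply: localM.
rewrite (eq_Ex _ (Y := fun eta : Omega =>
   site x eta * (cyl (y :: B) (update y true a) eta * g eta) +
   site x eta * (cyl (y :: B) (update y false a) eta * g eta))); last first.
  by move=> eta; rewrite split_y; ring.
rewrite ExD; last 2 first.
- by apply: bmM => //; exact: local_bm.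
- by apply: bmM => //; exact: local_bm.
rewrite !key ?inE ?eqxx//= ?yB//; try by rewrite negb_or xB eq_sym yx.
rewrite -mulrDr -ExD//; congr (_ * _); apply: eq_Ex => eta.
by rewrite split_y; ring.
Qed.

(** The case without pinned sites; later Bernoulli computations rest on it rather than on
    cylinders. *)
Lemma Ex_site x g : local g -> indep x g ->
  Ex nub (fun eta => (eta x)%:R * g eta) = b * Ex nub g.
Proof.
move=> [A gA] fg.
have := @ExM_site_cyl x [::] g isT isT fg A gA point.
rewrite (eq_Ex _ (Y := fun eta : Omega => (eta x)%:R * g eta)).
  by move=> ->; congr (_ * _); apply: eq_Ex => eta; rewrite /cyl big_nil mul1r.
by move=> eta; rewrite /cyl big_nil mul1r.
Qed.

Lemma Ex_cond x f : local f -> Ex nub f =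
  b * Ex nub (fun eta => f (update x true eta))
  + (1 - b) * Ex nub (fun eta => f (update x false eta)).
Proof.
move=> lf; have lu c : local (fun eta => f (update x c eta)) by exact: local_update.
have fu c : indep x (fun eta => f (update x c eta)) by exact: indep_update_eq.
have lx : local (fun eta => (eta x)%:R : R) by exact: local_siteR.
rewrite (eq_Ex _ (Y := fun eta : Omega => (eta x)%:R * f (update x true eta) +
  (f (update x false eta) - (eta x)%:R * f (update x false eta)))); last first.
  move=> eta; rewrite -{1}(update_id x eta).
  by case: (eta x); rewrite ?mul1r ?mul0r ?subrr ?addr0 ?add0r ?subr0.
rewrite ExD ?ExB ?Ex_site//; first by ring.
all: apply: local_bm; rewrite ?(localM, localB)//.
- exact: localM.
- exact: localM.
- by apply: localB => //; exact: localM.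
Qed.

(** Conditioning on both sites gives four terms, and the two mixed ones carry the same weight b (1 -
    b). *)
Lemma Ex_exchange x y f : x != y -> local f ->
  Ex nub (fun eta => f (exchange x y eta)) = Ex nub f.
Proof.
move=> xy lf.
pose F c c' := Ex nub (fun eta => f (update x c (update y c' eta))).
have lu (h : Omega -> R) z c : local h -> local (fun eta => h (update z c eta)).
  exact: local_update.
have EF h : local h -> Ex nub h =
    b * (b * Ex nub (fun eta => h (update x true (update y true eta)))
       + (1 - b) * Ex nub (fun eta => h (update x true (update y false eta))))
  + (1 - b) * (b * Ex nub (fun eta => h (update x false (update y true eta)))
       + (1 - b) * Ex nub (fun eta => h (update x false (update y false eta)))).
  by move=> lh; rewrite {1}(Ex_cond x lh) !(Ex_cond y (lu h x _ lh)).
have Fe c c' : Ex nub (fun eta => f (exchange x y (update x c (update y c' eta))))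
    = F c' c.
  by apply: eq_Ex => eta; rewrite exchange_update.
rewrite (EF _ (local_exchange x y lf)) (EF _ lf) !Fe -!/(F _ _).
by ring.
Qed.

End BernoulliExpectation.

(** * The Dirichlet form *)

Lemma ler_sum_subset (R : realType) (I : eqType) (s t : seq I) (F : I -> R) :
  uniq s -> uniq t -> {subset s <= t} -> (forall i, i \in t -> 0 <= F i) ->
  \sum_(i <- s) F i <= \sum_(i <- t) F i.
Proof.
move=> us ut st F0; rewrite [leRHS](bigID (mem s))/= -[X in X <= _]addr0 lerD//.
  rewrite -[leRHS]big_filter; rewrite le_eqVlt; apply/orP; left; apply/eqP; apply: perm_big.
  apply: uniq_perm => //; first exact: filter_uniq.
  by move=> i; rewrite mem_filter andb_idr//; exact: st.
by rewrite big_seq_cond; apply: sumr_ge0 => i /andP[/F0].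
Qed.

Section Dirichlet.
Context {R : realType}.
Variables (r : Omega -> R) (hr : interaction_rate r).
Variables (rho : R) (nub : probability Omega R).
Hypothesis hnub : bernoulli_product rho nub.
Implicit Types f g h : Omega -> R.

Local Notation E := (Ex nub).

Definition bar (x : int) (eta : Omega) : R := (eta x)%:R - rho.

Lemma local_bar x : local (bar x).
Proof. exact: (local_site (fun c => c%:R - rho)). Qed.

Lemma indep_bar x y : x != y -> indep x (bar y).
Proof. exact: (@indep_site _ (fun c => c%:R - rho)). Qed.

Lemma Ex_bar x g : local g -> indep x g -> E (fun eta => bar x eta * g eta) = 0.
Proof.
move=> lg xg; have bg := local_bm lg.
have bsg : bm (fun eta : Omega => (eta x)%:R * g eta).
  by apply: bmM => //; apply: local_bm; exact: (local_site (fun c => c%:R)).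
rewrite (eq_Ex _ (Y := fun eta : Omega => (eta x)%:R * g eta - rho * g eta)).
  by rewrite ExB ?ExZ ?(Ex_site hnub)// ?subrr//; exact: bmZ.
by move=> eta; rewrite mulrBl.
Qed.

(** As eta x is 0 or 1, bar x ^ 2 = chi rho + (1 - 2 rho) bar x, and the linear part has mean zero
    against [g]. *)
Lemma Ex_bar2 x g : local g -> indep x g ->
  E (fun eta => bar x eta ^+ 2 * g eta) = chi rho * E g.
Proof.
move=> lg xg; have lbg : local (fun eta => bar x eta * g eta).
  by apply: localM => //; exact: local_bar.
rewrite (eq_Ex _ (Y := fun eta : Omega =>
    chi rho * g eta + (1 - 2 * rho) * (bar x eta * g eta))).
  have [bg bbg] := (local_bm lg, local_bm lbg).
  by rewrite ExD ?ExZ ?Ex_bar// ?mulr0 ?addr0//; exact: bmZ.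
by move=> eta; rewrite /bar /chi; case: (eta x) => /=; ring.
Qed.

Let lr := rate_local hr.

(** Only bonds that touch the support of [h] contribute. Allowing every larger list lets several
    functions share one list of bonds. *)
Lemma gasL_seq h : local h -> exists s0 : seq int, forall s, uniq s ->
  {subset s0 <= s} -> gasL r h =
  fun eta => \sum_(x <- s) shift_fun x r eta * gradient x (x + 1) h eta.
Proof.
move=> [A hA]; exists (A ++ [seq x - 1 | x <- A]) => s us s0s.
apply/funext => eta; rewrite /gasL.
rewrite (fsbigE s)//; first by apply: eq_bigl => x; rewrite in_setT.
move=> x _ xs /=; rewrite /gradient (hA _ eta) ?subrr ?mulr0// => z zA.
rewrite /exchange; case: eqP => [zx|_].
  by rewrite -zx s0s ?mem_cat ?zA in xs.
case: eqP => // zx; case/negP: xs; apply: s0s.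
by rewrite mem_cat; apply/orP; right; apply/mapP; exists z => //; rewrite zx addrK.
Qed.

Lemma local_gasL h : local h -> local (gasL r h).
Proof.
move=> lh; have [s0 s0P] := gasL_seq lh.
rewrite (s0P (undup s0)) ?undup_uniq//; last by move=> x; rewrite mem_undup.
apply: local_big => x; apply: localM; first exact: local_shift.
exact: local_gradient.
Qed.

Let addr1_neq (x : int) : x != x + 1.
Proof. by apply/eqP; lia. Qed.

(** The rate ignores the two sites of its own bond; this is what makes the Bernoulli measures
    reversible. *)
Lemma rate_exchange x eta :
  shift_fun x r (exchange x (x + 1) eta) = shift_fun x r eta.
Proof.
apply: (rate_bond hr) => y y0 y1; rewrite /Defs.shift /exchange.
rewrite ifF; last by apply/eqP; move/eqP: y0; lia.
by rewrite ifF//; apply/eqP; move/eqP: y1; lia.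
Qed.

(** The measure and the rate are invariant under the exchange of x and x + 1, while the gradient of
    [f] changes sign. Averaging the integrand with its exchanged version turns [g] into minus half
    its gradient. *)
Lemma Ex_rate_gradient x f g : local f -> local g ->
  E (fun eta => g eta * (shift_fun x r eta * gradient x (x + 1) f eta)) =
  - 2^-1 * E (fun eta => shift_fun x r eta *
      (gradient x (x + 1) g eta * gradient x (x + 1) f eta)).
Proof.
move=> lf lg; have lrx := local_shift x lr.
pose F eta := g eta * (shift_fun x r eta * gradient x (x + 1) f eta).
have lF : local F by do 2 apply: localM => //; exact: local_gradient.
have lFe := local_exchange x (x + 1) lF.
rewrite (eq_Ex _ (X := fun eta => shift_fun x r eta *
    (gradient x (x + 1) g eta * gradient x (x + 1) f eta))
  (Y := fun eta => - (F eta + F (exchange x (x + 1) eta)))); last first.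
  move=> eta; rewrite /F rate_exchange /gradient exchangeK; ring.
have [bF bFe] := (local_bm lF, local_bm lFe).
rewrite ExN ?ExD ?(Ex_exchange hnub)//; last exact: bmD.
rewrite [LHS](_ : _ = E F)//; by field.
Qed.

Definition dirichlet h := - E (fun eta => h eta * gasL r h eta).

Lemma Ex_gasL_seq f g : local f -> local g -> exists s0 : seq int,
  forall s, uniq s -> {subset s0 <= s} ->
  E (fun eta => g eta * gasL r f eta) =
  - 2^-1 * \sum_(x <- s) E (fun eta => shift_fun x r eta *
      (gradient x (x + 1) g eta * gradient x (x + 1) f eta)).
Proof.
move=> lf lg; have [s0 s0P] := gasL_seq lf; exists s0 => s us s0s.
rewrite (s0P s)// mulr_sumr.
under eq_bigr do rewrite -Ex_rate_gradient//.
rewrite -Ex_sum; last first.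
  move=> x; apply: local_bm; apply: localM => //; apply: localM.
    exact: local_shift.
  exact: local_gradient.
by apply: eq_Ex => eta; rewrite mulr_sumr.
Qed.

Lemma gasL_sym f g : local f -> local g ->
  E (fun eta => g eta * gasL r f eta) = E (fun eta => gasL r g eta * f eta).
Proof.
move=> lf lg; have [s1 s1P] := Ex_gasL_seq lf lg.
have [s2 s2P] := Ex_gasL_seq lg lf.
rewrite (eq_Ex _ (X := fun eta => gasL r g eta * f eta)
  (Y := fun eta => f eta * gasL r g eta)); last by move=> eta; rewrite mulrC.
have us := undup_uniq (s1 ++ s2).
rewrite (s1P _ us) ?(s2P _ us); last 2 first.
- by move=> x xs; rewrite mem_undup mem_cat xs orbT.
- by move=> x xs; rewrite mem_undup mem_cat xs.
congr (_ * _); apply: eq_bigr => x _; apply: eq_Ex => eta.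
by congr (_ * _); rewrite mulrC.
Qed.

(** Integration by parts gives the Dirichlet form as half the sum of E (r_x (gradient h)^2) over the
    bonds, whence the factor 2. Ellipticity replaces the rate by e0, and bonds outside [s] only add
    nonnegative terms. *)
Lemma dirichlet_lb e0 : 0 < e0 -> (forall eta, e0 <= r eta) ->
  forall h s, local h -> uniq s ->
  \sum_(x <- s) E (fun eta => gradient x (x + 1) h eta ^+ 2) <=
    2 / e0 * dirichlet h.
Proof.
move=> e00 re0 h s lh us; have [s0 s0P] := Ex_gasL_seq lh lh.
have lg x := local_gradient x (x + 1) lh.
have us' := undup_uniq (s ++ s0).
rewrite /dirichlet (s0P _ us'); last first.
  by move=> x xs; rewrite mem_undup mem_cat xs orbT.
rewrite [leRHS](_ : _ = e0^-1 * \sum_(x <- undup (s ++ s0)) E (fun eta =>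
    shift_fun x r eta * (gradient x (x + 1) h eta * gradient x (x + 1) h eta)));
  last by field; rewrite lt0r_neq0.
rewrite mulrC ler_pdivlMr// mulrC mulr_sumr.
have le1 x : e0 * E (fun eta => gradient x (x + 1) h eta ^+ 2) <=
   E (fun eta => shift_fun x r eta *
     (gradient x (x + 1) h eta * gradient x (x + 1) h eta)).
  rewrite -ExZ; last by apply: local_bm; exact: localX.
  apply: le_Ex.
  - by apply: local_bm; apply: localZ; exact: localX.
  - by apply: local_bm; apply: localM; [exact: local_shift | exact: localM].
  by move=> eta; rewrite -expr2 ler_wpM2r ?sqr_ge0//; exact: re0.
apply: (@le_trans _ _ (\sum_(x <- s) E (fun eta => shift_fun x r eta *
     (gradient x (x + 1) h eta * gradient x (x + 1) h eta)))).
  by apply: ler_sum.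
apply: ler_sum_subset => // [x|x _].
  by rewrite mem_undup mem_cat => ->.
by apply: le_trans (le1 x); rewrite mulr_ge0 ?(ltW e00)// Ex_ge0// => eta; exact: sqr_ge0.
Qed.

End Dirichlet.

(** * Energy bounds *)

Section EnergyBound.
Context {R : realType}.
Variables (r : Omega -> R) (hr : interaction_rate r).
Variables (e0 : R) (e0_gt0 : 0 < e0) (re0 : forall eta, e0 <= r eta).
Variables (rho : R) (nub : probability Omega R).
Hypothesis hnub : bernoulli_product rho nub.
Implicit Types f g h V W G : Omega -> R.

Local Notation E := (Ex nub).
Local Notation D := (dirichlet r nub).
Local Notation bar := (bar rho).

(* Equivalent to [E (V h) <= 2 K sqrt (D h)] for all local [h], that is, to a
   bound on the H_{-1} norm of V; this form is additive in (V, K). *)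
Definition energy_bound V (K : R) :=
  [/\ local V, 0 <= K & forall h, local h -> forall a : R, 0 < a ->
    E (fun eta => V eta * h eta) <= K * (a + a^-1 * D h)].

Lemma dirichlet_ge0 h : local h -> 0 <= D h.
Proof.
move=> lh; have := dirichlet_lb hr hnub e0_gt0 re0 lh (isT : uniq [::]).
by rewrite big_nil pmulr_rge0// divr_gt0.
Qed.

Lemma dirichletN h : local h -> D (fun eta => - h eta) = D h.
Proof.
move=> lh; rewrite /dirichlet; congr (- _); apply: eq_Ex => eta.
suff -> : gasL r (fun eta => - h eta) eta = - gasL r h eta by rewrite mulrNN.
have [s0 s0P] := gasL_seq r lh; have [s1 s1P] := gasL_seq r (localN lh).
have us := undup_uniq (s0 ++ s1).
rewrite (s0P _ us) ?(s1P _ us)//; last 2 first.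
- by move=> x xs; rewrite mem_undup mem_cat xs ?orbT.
- by move=> x xs; rewrite mem_undup mem_cat xs ?orbT.
by rewrite -sumrN; apply: eq_bigr => x _; rewrite /gradient; ring.
Qed.

Lemma energy_bound0 : energy_bound (fun=> 0) 0.
Proof.
split=> //; first exact: local_cst.
move=> h lh a a0; rewrite mul0r (eq_Ex _ (Y := fun=> 0)) ?Ex_cst// => eta.
by rewrite mul0r.
Qed.

Lemma energy_bound_ext V W K : V =1 W -> energy_bound V K -> energy_bound W K.
Proof. by move=> /funext ->. Qed.

Lemma energy_boundD V W K L : energy_bound V K -> energy_bound W L ->
  energy_bound (fun eta => V eta + W eta) (K + L).
Proof.
move=> [lV K0 VK] [lW L0 WL]; split; [exact: localD|exact: addr_ge0|].
move=> h lh a a0.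
rewrite (eq_Ex _ (Y := fun eta => V eta * h eta + W eta * h eta)); last first.
  by move=> eta; rewrite mulrDl.
rewrite ExD; try by apply: local_bm; exact: localM.
by rewrite mulrDl lerD ?VK ?WL.
Qed.

Lemma energy_boundZ c V K : energy_bound V K ->
  energy_bound (fun eta => c * V eta) (`|c| * K).
Proof.
move=> [lV K0 VK]; split; [exact: localZ|exact: mulr_ge0|].
move=> h lh a a0; have bVh : bm (fun eta => V eta * h eta).
  by apply: local_bm; exact: localM.
rewrite (eq_Ex _ (Y := fun eta => c * (V eta * h eta))); last first.
  by move=> eta; rewrite mulrA.
rewrite ExZ//; case: (ger0P c) => c0; rewrite -mulrA.
  by rewrite ler_wpM2l ?VK.
have -> : c * E (fun eta => V eta * h eta) = - c * E (fun eta => V eta * - h eta).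
  rewrite mulNr -mulrN -ExN; last by apply: local_bm; apply: localM => //; exact: localN.
  by congr (_ * _); apply: eq_Ex => eta; rewrite mulrN opprK.
by rewrite ler_wpM2l ?oppr_ge0 ?(ltW c0)// -(dirichletN lh); apply: VK => //; exact: localN.
Qed.

Lemma energy_boundN V K : energy_bound V K -> energy_bound (fun eta => - V eta) K.
Proof.
move=> /(energy_boundZ (-1)); rewrite normrN1 mul1r.
by apply: energy_bound_ext => eta; rewrite mulN1r.
Qed.

Lemma energy_boundB V W K L : energy_bound V K -> energy_bound W L ->
  energy_bound (fun eta => V eta - W eta) (K + L).
Proof. by move=> VK /energy_boundN; exact: energy_boundD. Qed.

Lemma le_energy_bound V K L : energy_bound V K -> K <= L -> energy_bound V L.
Proof.
move=> [lV K0 VK] KL; split=> //; first exact: le_trans KL.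
move=> h lh a a0; apply: le_trans (VK h lh a a0) _; rewrite ler_wpM2r//.
by rewrite addr_ge0 ?mulr_ge0 ?invr_ge0 ?(ltW a0) ?dirichlet_ge0.
Qed.

Lemma energy_bound_sum (I : eqType) (s : seq I) (F : I -> Omega -> R) (K : I -> R) :
  {in s, forall i, energy_bound (F i) (K i)} ->
  energy_bound (fun eta => \sum_(i <- s) F i eta) (\sum_(i <- s) K i).
Proof.
elim: s => [|i s IH] FK.
  rewrite big_nil; apply: energy_bound_ext energy_bound0 => eta.
  by rewrite big_nil.
rewrite big_cons; apply: energy_bound_ext (energy_boundD (FK i _) (IH _)).
- by move=> eta; rewrite big_cons.
- by rewrite inE eqxx.
- by move=> j js; apply: FK; rewrite inE js orbT.
Qed.

(* The gradient bar x - bar (x+1) is odd under the exchange of x and x+1, so it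
   only sees the increments of h. *)
Lemma Ex_bond G x h (b : R) : local G -> indep x G -> indep (x + 1) G -> local h ->
  0 < b ->
  E (fun eta => G eta * (bar x eta - bar (x + 1) eta) * h eta) <=
  b / 4 * E (fun eta => G eta ^+ 2)
  + (4 * b)^-1 * E (fun eta => gradient x (x + 1) h eta ^+ 2).
Proof.
move=> lG Gx Gx1 lh b0; have xx1 : x != x + 1 by apply/eqP; lia.
pose F eta := G eta * (bar x eta - bar (x + 1) eta) * h eta.
have lF : local F.
  by do 2 apply: localM => //; apply: localB; exact: local_bar.
pose N eta := b / 4 * G eta ^+ 2 + (4 * b)^-1 * gradient x (x + 1) h eta ^+ 2.
have lg2 : local (fun eta => gradient x (x + 1) h eta ^+ 2).
  by apply: localX; exact: local_gradient.
have lG2 : local (fun eta => G eta ^+ 2) by exact: localX.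
have lN : local N by apply: localD; exact: localZ.
rewrite -!ExZ; try exact: local_bm.
rewrite -ExD; try by apply: local_bm; exact: localZ.
have -> : E F = E (fun eta => 2^-1 * (F eta + F (exchange x (x + 1) eta))).
  have [bF bF'] := (local_bm lF, local_bm (local_exchange x (x + 1) lF)).
  rewrite ExZ; last exact: bmD.
  by rewrite ExD// (Ex_exchange hnub)//; field.
apply: le_Ex; [|exact: local_bm|].
  by apply: local_bm; apply: localZ; apply: localD => //; exact: local_exchange.
move=> eta; rewrite /F /N (indep_exchange _ xx1)//.
have -> : bar x (exchange x (x + 1) eta) = bar (x + 1) eta.
  by rewrite /bar /exchange eqxx.
have -> : bar (x + 1) (exchange x (x + 1) eta) = bar x eta.
  by rewrite /bar /exchange eqxx eq_sym (negPf xx1).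
set d := bar x eta - bar (x + 1) eta.
have d1 : d ^+ 2 <= 1.
  by rewrite /d /bar; case: (eta x); case: (eta (x + 1)) => /=; lra.
rewrite [X in X <= _](_ : _ = - 2^-1 * (G eta * d * gradient x (x + 1) h eta));
  last by rewrite /gradient /d; ring.
set g := gradient _ _ _ _; set u := G eta.
apply: (@le_trans _ _ (b / 4 * (u ^+ 2 * d ^+ 2) + (4 * b)^-1 * g ^+ 2)).
  rewrite -subr_ge0 [X in 0 <= X](_ : _ = (4 * b)^-1 * (b * (u * d) + g) ^+ 2).
    by rewrite mulr_ge0 ?sqr_ge0// invr_ge0 mulr_ge0// (ltW b0).
  by field; rewrite lt0r_neq0.
rewrite lerD2r ler_wpM2l ?divr_ge0 ?(ltW b0)//.
by rewrite -[leRHS]mulr1 ler_wpM2l// sqr_ge0.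
Qed.

(** The difference is a sum over the n bonds of the path, each treated by [Ex_bond]. Path length
    times the second moment of the spectator [G] is the price, hence the condition n g <= e0 K^2. *)
Lemma energy_bound_move G (u : int) (n : nat) (g K : R) : local G ->
  (forall z, u <= z <= u + n%:Z -> indep z G) ->
  E (fun eta => G eta ^+ 2) <= g -> 0 < K -> n%:R * g <= e0 * K ^+ 2 ->
  energy_bound (fun eta => G eta * (bar u eta - bar (u + n%:Z) eta)) K.
Proof.
move=> lG Gz Gg K0 ng; split; last 2 first.
- exact: ltW.
- move=> h lh a a0.
  (* With this weight the gradient terms, at most 2 / e0 times the Dirichlet form in total,
     contribute at most K a^(-1) D h; the other terms add up to at most K a / 8. *)
  pose b := a / (2 * e0 * K).
  have b0 : 0 < b by rewrite divr_gt0// !mulr_gt0.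
  pose s := [seq u + i%:Z | i <- iota 0 n].
  have us : uniq s by rewrite map_inj_uniq ?iota_uniq// => i j; lia.
  have lF x : local (fun eta => G eta * (bar x eta - bar (x + 1) eta) * h eta).
    by do 2 apply: localM => //; apply: localB; exact: local_bar.
  rewrite (eq_Ex _ (Y := fun eta =>
    \sum_(x <- s) G eta * (bar x eta - bar (x + 1) eta) * h eta)); last first.
    move=> eta; rewrite -mulr_suml -mulr_sumr; congr (_ * _ * _).
    rewrite big_map -[n in iota 0 n]subn0 -/(index_iota 0 n).
    rewrite (eq_bigr (fun i => - (bar (u + i.+1%:Z) eta - bar (u + i%:Z) eta))).
      by rewrite sumrN (telescope_sumr (fun i : nat => bar (u + i%:Z) eta))// addr0 opprB.
    by move=> i _; rewrite [RHS]opprB -addn1 PoszD addrA.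
  rewrite Ex_sum; last by move=> x; exact: local_bm.
  apply: (@le_trans _ _ (\sum_(x <- s) (b / 4 * g +
     (4 * b)^-1 * E (fun eta => gradient x (x + 1) h eta ^+ 2)))).
    rewrite big_seq [leRHS]big_seq; apply: ler_sum => x /mapP[i].
    rewrite mem_iota => /= hi ->.
    apply: le_trans (Ex_bond lG _ _ lh b0) _; try by apply: Gz; lia.
    by rewrite lerD2r ler_wpM2l// divr_ge0// (ltW b0).
  rewrite big_split/= -!mulr_sumr.
  have := dirichlet_lb hr hnub e0_gt0 re0 lh us.
  set S := \sum_(x <- s) E _ => SD.
  rewrite big_const_seq count_predT iter_addr_0 size_map size_iota -[g *+ n]mulr_natr.
  have -> : b / 4 * (g * n%:R) = a / (8 * e0 * K) * (n%:R * g).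
    by rewrite /b; field; rewrite !lt0r_neq0.
  rewrite mulrDr; apply: lerD.
    rewrite (@le_trans _ _ (a / (8 * e0 * K) * (e0 * K ^+ 2)))//.
      by rewrite ler_wpM2l// divr_ge0 ?(ltW a0)// !mulr_ge0 ?ltW.
    rewrite [leLHS](_ : _ = K * a / 8); last by field; rewrite !lt0r_neq0.
    by have := mulr_gt0 K0 a0; lra.
  rewrite [leRHS](_ : _ = (4 * b)^-1 * (2 / e0 * D h)).
    by rewrite ler_wpM2l// invr_ge0 mulr_ge0// (ltW b0).
  by rewrite /b; field; rewrite !lt0r_neq0.
- by apply: localM => //; apply: localB; exact: local_bar.
Qed.

End EnergyBound.

(** * Second moments of block averages *)

Section BlockAverages.
Context {R : realType}.
Variables (rho : R) (nub : probability Omega R).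
Hypothesis hnub : bernoulli_product rho nub.
Hypothesis hrho : 0 < rho < 1.
Implicit Types f g h V W G : Omega -> R.

Local Notation E := (Ex nub).
Local Notation bar := (bar rho).

Definition avg (s : seq int) (eta : Omega) : R :=
  (size s)%:R^-1 * \sum_(x <- s) bar x eta.

Lemma local_avg s : local (avg s).
Proof. by apply: localZ; apply: local_big => x; exact: local_bar. Qed.

Lemma indep_avg z s : z \notin s -> indep z (avg s).
Proof.
move=> zs b eta; congr (_ * _); apply: (indep_big _ _ (F := bar)) => x xs.
by apply: indep_bar; apply: contraNneq zs => ->.
Qed.

Lemma chi_ge0 : 0 <= chi rho.
Proof. by rewrite mulr_ge0 ?subr_ge0 ?ltW//; case/andP: hrho. Qed.

Lemma chi_le1 : chi rho <= 1.
Proof. by rewrite /chi; case/andP: hrho => *; nra. Qed.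

Lemma Ex_sum_bar2 s g : uniq s -> local g -> {in s, forall x, indep x g} ->
  E (fun eta => (\sum_(x <- s) bar x eta) ^+ 2 * g eta) =
  (size s)%:R * chi rho * E g.
Proof.
elim: s => [|x s IH] /= us lg sg.
  rewrite !mul0r (eq_Ex _ (Y := fun=> 0)) ?Ex_cst// => eta.
  by rewrite big_nil expr0n mul0r.
case/andP: us => xs us; pose S eta := \sum_(x <- s) bar x eta.
have lS : local S by apply: local_big => y; exact: local_bar.
have xS : indep x S.
  by apply: indep_big => y ys; apply: indep_bar; apply: contraNneq xs => ->.
have xg : indep x g by apply: sg; rewrite inE eqxx.
have lSg : local (fun eta => S eta * g eta) by exact: localM.
have lb := local_bar rho x.
have l1 : local (fun eta => bar x eta ^+ 2 * g eta) by apply: localM => //; exact: localX.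
have l2 : local (fun eta => bar x eta * (S eta * g eta)) by exact: localM.
have l3 : local (fun eta => S eta ^+ 2 * g eta) by apply: localM => //; exact: localX.
have [b1 b2 b3] := And3 (local_bm l1) (local_bm l2) (local_bm l3).
rewrite (eq_Ex _ (Y := fun eta => bar x eta ^+ 2 * g eta +
  (2 * (bar x eta * (S eta * g eta)) + S eta ^+ 2 * g eta))); last first.
  by move=> eta; rewrite big_cons /S; ring.
rewrite ExD ?ExD ?ExZ//; [|exact: bmZ|by apply: bmD => //; exact: bmZ].
rewrite (Ex_bar2 hnub)// (Ex_bar hnub)//; last exact: indepM.
rewrite IH//; last by move=> y ys; apply: sg; rewrite inE ys orbT.
by rewrite -natr1; ring.
Qed.

Lemma Ex_avg2 s g : uniq s -> (0 < size s)%N -> local g ->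
  {in s, forall x, indep x g} ->
  E (fun eta => avg s eta ^+ 2 * g eta) = chi rho / (size s)%:R * E g.
Proof.
move=> us s0 lg sg.
have lS : local (fun eta => (\sum_(x <- s) bar x eta) ^+ 2 * g eta).
  apply: localM => //; apply: localX; apply: local_big => y; exact: local_bar.
rewrite (eq_Ex _ (Y := fun eta => (size s)%:R^-1 ^+ 2 *
  ((\sum_(x <- s) bar x eta) ^+ 2 * g eta))).
  rewrite ExZ ?Ex_sum_bar2//; last exact: local_bm.
  by field; rewrite pnatr_eq0 -lt0n.
by move=> eta; rewrite /avg; ring.
Qed.

(** Averages over disjoint blocks are independent, so the second moment is a product of factors chi
    / size; chi <= 1 is discarded. *)
Lemma Ex_prod_avg2 (J : eqType) (js : seq J) (z : J -> seq int) (m : nat) :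
  (0 < m)%N -> uniq js -> {in js, forall j, uniq (z j) /\ (m <= size (z j))%N} ->
  {in js &, forall i j, i != j -> forall x, x \in z i -> x \notin z j} ->
  E (fun eta => (\prod_(j <- js) avg (z j) eta) ^+ 2) <=
  (m%:R^-1) ^+ size js.
Proof.
move=> m0; elim: js => [|j js IH] /= ujs zm zd.
  rewrite expr0 (eq_Ex _ (Y := fun=> 1)) ?Ex_cst// => eta.
  by rewrite big_nil expr1n.
case/andP: ujs => jjs ujs.
have [uz mz] : uniq (z j) /\ (m <= size (z j))%N by apply: zm; rewrite inE eqxx.
pose P eta := (\prod_(j <- js) avg (z j) eta) ^+ 2.
have lP : local P by apply: localX; apply: local_big => i; exact: local_avg.
rewrite (eq_Ex _ (Y := fun eta => avg (z j) eta ^+ 2 * P eta)); last first.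
  by move=> eta; rewrite big_cons exprMn.
rewrite Ex_avg2//; last 2 first.
- exact: leq_trans mz.
- move=> x xz b eta; rewrite /P; congr (_ ^+ 2).
  apply: (indep_big _ _ (F := fun i => avg (z i))) => i ijs.
  apply: indep_avg; apply: (zd j i) => //; rewrite ?inE ?eqxx ?ijs ?orbT//.
  by apply: contraNneq jjs => ->.
rewrite exprS; apply: ler_pM.
- by rewrite divr_ge0// chi_ge0.
- by apply: Ex_ge0 => eta; exact: sqr_ge0.
- rewrite -[leRHS]mul1r; apply: ler_pM; rewrite ?chi_ge0 ?chi_le1 ?invr_ge0//.
  rewrite lef_pV2 ?ler_nat// posrE ltr0n//; exact: leq_trans mz.
- apply: IH => // [i ijs|i i' ijs i'js]; first by apply: zm; rewrite inE ijs orbT.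
  by apply: zd; rewrite inE ?ijs ?i'js orbT.
Qed.

End BlockAverages.

(** * Energy cost of moving block averages *)

Section BlockMoves.
Context {R : realType}.
Variables (r : Omega -> R) (hr : interaction_rate r).
Variables (e0 : R) (e0_gt0 : 0 < e0) (re0 : forall eta, e0 <= r eta).
Variables (rho : R) (nub : probability Omega R).
Hypothesis hnub : bernoulli_product rho nub.
Hypothesis hrho : 0 < rho < 1.
Implicit Types f g h V W G : Omega -> R.

Local Notation E := (Ex nub).
Local Notation bar := (bar rho).
Local Notation avg := (avg rho).
Local Notation EB := (energy_bound r nub).

Lemma energy_bound_swap G (u v : int) n (g K : R) : local G ->
  (forall z, Num.min u v <= z <= Num.max u v -> indep z G) ->
  (absz (u - v) <= n)%N ->
  E (fun eta => G eta ^+ 2) <= g -> 0 < K -> n%:R * g <= e0 * K ^+ 2 ->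
  EB (fun eta => G eta * (bar u eta - bar v eta)) K.
Proof.
move=> lG Gz uvn Gg K0 ng.
have ng' : (absz (u - v))%:R * g <= e0 * K ^+ 2.
  apply: le_trans ng; rewrite ler_wpM2r ?ler_nat//.
  by apply: le_trans Gg; apply: Ex_ge0 => eta; exact: sqr_ge0.
wlog uv : u v Gz uvn ng' / u <= v => [wl|].
  have [uv|vu] := leP u v; first exact: wl.
  apply: (@energy_bound_ext _ _ _
     (fun eta => - (G eta * (bar v eta - bar u eta)))) => [eta|].
    by ring.
  apply: energy_boundN; apply: wl => //; last exact: ltW.
  - by move=> z; rewrite minC maxC; exact: Gz.
  - by rewrite distnC.
  - by rewrite distnC.
have -> : v = u + (absz (u - v))%:Z by lia.
apply: (energy_bound_move hr e0_gt0 re0 hnub lG _ Gg K0 ng') => z hz.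
by apply: Gz; rewrite min_l// max_r//; lia.
Qed.

(** A difference of two averages is the average of bar u - bar v over all pairs (u, v). The weights
    add up to 1, so the constant of a single swap is kept. *)
Lemma energy_bound_avg G (s s' : seq int) n (g K : R) : local G ->
  s != [::] -> s' != [::] ->
  (forall u v, u \in s -> v \in s' -> (absz (u - v) <= n)%N /\
    forall z, Num.min u v <= z <= Num.max u v -> indep z G) ->
  E (fun eta => G eta ^+ 2) <= g -> 0 < K -> n%:R * g <= e0 * K ^+ 2 ->
  EB (fun eta => G eta * (avg s eta - avg s' eta)) K.
Proof.
move=> lG s0 s'0 Gz Gg K0 ng.
have n0 (t : seq int) : t != [::] -> (size t)%:R != 0 :> R.
  by rewrite pnatr_eq0 size_eq0.
pose c : R := (size s)%:R^-1 * (size s')%:R^-1.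
have c0 : 0 <= c by rewrite mulr_ge0// invr_ge0.
have sumE (t : seq int) (x : R) : \sum_(u <- t) x = (size t)%:R * x.
  by rewrite big_const_seq count_predT iter_addr_0 mulr_natl.
have EBsum : EB (fun eta => \sum_(u <- s) \sum_(v <- s')
    c * (G eta * (bar u eta - bar v eta))) (\sum_(u <- s) \sum_(v <- s') c * K).
  apply: energy_bound_sum => u us; apply: energy_bound_sum => v vs.
  rewrite -{2}(ger0_norm c0); apply: energy_boundZ.
  by have [uvn Gz'] := Gz _ _ us vs; exact: energy_bound_swap ng.
rewrite !sumE in EBsum; apply: energy_bound_ext (le_energy_bound hr e0_gt0 re0 hnub EBsum _).
  move=> eta; rewrite /avg.
  under eq_bigr do rewrite -mulr_sumr -mulr_sumr sumrB sumE.
  rewrite -mulr_sumr -mulr_sumr sumrB sumE -mulr_sumr /c.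
  by field; rewrite !n0.
by rewrite /c le_eqVlt; apply/orP; left; apply/eqP; field; rewrite !n0.
Qed.

(** Supplies the constant that pays for a fixed path length times second moment; 1 + |c| / e0 avoids
    a square root and stays positive when c <= 0. *)
Lemma energy_constant (c : R) : exists2 K : R, 0 < K & c <= e0 * K ^+ 2.
Proof.
exists (1 + `|c| / e0); first by rewrite ltr_pwDl// divr_ge0 ?(ltW e0_gt0).
have : e0 * (1 + `|c| / e0) = e0 + `|c| by field; rewrite lt0r_neq0.
have := ler_norm c; have : 0 <= `|c| / e0 by rewrite divr_ge0 ?(ltW e0_gt0).
move=> y0 cc ee; rewrite expr2 mulrA ee mulrDr mulr1.
have : 0 <= (e0 + `|c|) * (`|c| / e0) by rewrite mulr_ge0// addr_ge0 ?(ltW e0_gt0).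
by have := ltW e0_gt0; lra.
Qed.

(* The factors are moved one at a time, the rightmost first, so that a moving
   particle never meets another block. *)
Lemma energy_bound_prod_avg k (p q : nat -> seq int) m n (K : R) :
  (0 < m)%N ->
  (forall i, (i < k)%N -> [/\ uniq (p i), uniq (q i), (m <= size (p i))%N &
                              (m <= size (q i))%N]) ->
  (forall i j, (i < j < k)%N -> forall x y, x \in p i -> y \in p j -> x < y) ->
  (forall i j, (i < j < k)%N -> forall x y, x \in p i -> y \in q j -> x < y) ->
  (forall i j, (i < j < k)%N -> forall x y, x \in q i -> y \in q j -> x < y) ->
  (forall i, (i < k)%N -> forall x y, x \in p i -> y \in q i ->
     (absz (x - y) <= n)%N) ->
  0 < K -> n%:R * (m%:R^-1) ^+ k.-1 <= e0 * K ^+ 2 ->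
  EB (fun eta => \prod_(i <- iota 0 k) avg (p i) eta
               - \prod_(i <- iota 0 k) avg (q i) eta) (k%:R * K).
Proof.
move=> m0 pqm ppk pqk qqk pqn K0 nK.
(* Interpolation between the two products: at stage i the factors below i still sit on [p], the
   others on [q]. Thus [H k] is the product over [p], [H 0] the one over [q], and [G i] is the
   spectator while the factor i moves. *)
pose z i j := if (j < i)%N then p j else q j.
pose H i eta := \prod_(j <- iota 0 k) avg (z i j) eta.
pose G i eta := \prod_(j <- rem i (iota 0 k)) avg (z i j) eta.
have zP i j : (j < k)%N -> uniq (z i j) /\ (m <= size (z i j))%N.
  by move=> /pqm[]; rewrite /z; case: ifP.
have memrem i j : j \in rem i (iota 0 k) = (j != i) && (j < k)%N.
  by rewrite mem_rem_uniq ?iota_uniq// inE mem_iota add0n.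
have zlt i j j' : (j < j' < k)%N ->
    forall x y, x \in z i j -> y \in z i j' -> x < y.
  move=> jj' x y; rewrite /z.
  case: ifP => ji; case: ifP => j'i; [exact: ppk|exact: pqk| |exact: qqk].
  by move: ji j'i jj' => /negbT; rewrite -leqNgt => ? ? /andP[? _]; lia.
have EBi i : (i < k)%N -> EB (fun eta => G i eta * (avg (p i) eta - avg (q i) eta)) K.
  move=> ik; have [up uq mp mq] := pqm _ ik.
  have nil (t : seq int) : (m <= size t)%N -> t != [::].
    by move=> mt; rewrite -size_eq0 -lt0n (leq_trans m0).
  apply: (energy_bound_avg (n := n) (g := (m%:R^-1) ^+ k.-1)) => //; try exact: nil.
  - by apply: local_big => j; exact: local_avg.
  - move=> u v up' vq'; split; first exact: pqn vq'.
    move=> w huv; apply: indep_big => j; rewrite memrem => /andP[ji jk].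
    apply: indep_avg; apply/negP => wz.
    have [lt_ji|] := ltnP j i.
      have wp : w \in p j by move: wz; rewrite /z lt_ji.
      have jik : (j < i < k)%N by rewrite lt_ji.
      have wu := ppk j i jik w u wp up'; have wv := pqk j i jik w v wp vq'.
      by case/andP: huv; rewrite ge_min !leNgt wu wv.
    rewrite leq_eqVlt eq_sym (negPf ji)/= => lt_ij.
    have wp : w \in q j by move: wz; rewrite /z ltnNge (ltnW lt_ij).
    have ijk : (i < j < k)%N by rewrite lt_ij.
    have uw := pqk i j ijk u w up' wp; have vw := qqk i j ijk v w vq' wp.
    by case/andP: huv => _; rewrite le_max !leNgt uw vw.
  - have -> : k.-1 = size (rem i (iota 0 k)).
      by rewrite size_rem ?size_iota// mem_iota.
    apply: Ex_prod_avg2 => //; first by rewrite rem_uniq ?iota_uniq.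
      by move=> j; rewrite memrem => /andP[_ jk]; exact: zP.
    move=> j j'; rewrite !memrem => /andP[_ jk] /andP[_ j'k] jj' x xj.
    apply/negP => xj'; have [jlt|jlt] := ltnP j j'.
      by have := zlt i j j' _ x x xj xj'; rewrite jlt j'k ltxx => /(_ isT).
    by have := zlt i j' j _ x x xj' xj; rewrite ltn_neqAle eq_sym jj' jlt jk ltxx => /(_ isT).
have HG i eta : (i < k)%N ->
    H i.+1 eta - H i eta = G i eta * (avg (p i) eta - avg (q i) eta).
  move=> ik; have ii : i \in iota 0 k by rewrite mem_iota.
  rewrite /H !(big_rem _ ii)/= /z ltnSn ltnn mulrBr ![G _ _ * _]mulrC.
  congr (_ * _ - _); apply: eq_big_seq => j; rewrite memrem => /andP[ji _].
  by rewrite ltnS leq_eqVlt (negPf ji).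
have EBsum : EB (fun eta => \sum_(i <- iota 0 k) (G i eta * (avg (p i) eta - avg (q i) eta)))
    (\sum_(i <- iota 0 k) K).
  by apply: energy_bound_sum => i; rewrite mem_iota => /= ik; exact: EBi.
rewrite big_const_seq count_predT size_iota iter_addr_0 -mulr_natl in EBsum.
apply: energy_bound_ext EBsum => eta.
transitivity (H k eta - H 0 eta).
  rewrite -(telescope_sumr (fun i => H i eta))// /index_iota subn0.
  by apply: eq_big_seq => i; rewrite mem_iota => /= ik; rewrite HG.
congr (_ - _); apply: eq_big_seq => i.
by rewrite mem_iota /z => /= ->.
Qed.

End BlockMoves.

(** * Products of block averages *)

(** Zone 0 is the block of [block_average]. Block products use the zones from 1 on, which leaves
    room on their left for the sites of a monomial. *)
Definition zone (i m : nat) : seq int := [seq (i * m + c)%N%:Z | c <- iota 1 m].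

Lemma size_zone i m : size (zone i m) = m.
Proof. by rewrite size_map size_iota. Qed.

Lemma uniq_zone i m : uniq (zone i m).
Proof. by rewrite map_inj_uniq ?iota_uniq// => c c' [] /addnI. Qed.

Lemma mem_zone i m x : (x \in zone i m) = ((i * m)%N%:Z < x <= (i.+1 * m)%N%:Z).
Proof.
apply/mapP/idP => [[c]|].
  by rewrite mem_iota => hc ->; rewrite mulSn; lia.
by rewrite mulSn => hx; exists (absz x - i * m)%N; rewrite ?mem_iota; lia.
Qed.

Lemma zone_lt i j m m' x y : (i < j)%N -> (m <= m')%N ->
  x \in zone i m -> y \in zone j m' -> x < y.
Proof.
rewrite !mem_zone => ij mm' /andP[_ hx] /andP[hy _].
apply: le_lt_trans hx (le_lt_trans _ hy).
by rewrite lez_nat leq_mul.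
Qed.

Section Blocks.
Context {R : realType} (rho : R).

Local Notation bar := (bar rho).
Local Notation avg := (avg rho).

Definition block_product k m (eta : Omega) : R :=
  \prod_(i <- iota 0 k) avg (zone i.+1 m) eta.

Lemma local_block_product k m : local (block_product k m).
Proof. by apply: local_big => i; exact: local_avg. Qed.

Definition pair_sum (m : nat) (eta : Omega) : R :=
  \sum_(1 <= y < m.+1) \sum_(1 <= x < y) bar x%:Z eta * bar y%:Z eta.

Lemma avg_zone0 m eta :
  avg (zone 0 m) eta = m%:R^-1 * \sum_(1 <= x < m.+1) bar x%:Z eta.
Proof. by rewrite /avg size_zone big_map /index_iota subn1. Qed.

Lemma block_averageE m eta : (0 < m)%N ->
  block_average m eta - rho = avg (zone 0 m) eta.
Proof.
move=> m0; rewrite avg_zone0 /block_average sumrB mulrBr; congr (_ - _).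
by rewrite sumr_const_nat subn1 -[rho *+ _]mulr_natl mulKf// pnatr_eq0 -lt0n.
Qed.

(** Off the diagonal the square counts each pair twice; on it, bar x ^ 2 = chi + (1 - 2 rho) bar x
    produces both the centering chi / m and the linear remainder. *)
Lemma avg_zone0_sqr m eta : (0 < m)%N ->
  avg (zone 0 m) eta ^+ 2 - chi rho / m%:R =
  m%:R^-1 * (1 - 2 * rho) * avg (zone 0 m) eta + 2 / m%:R ^+ 2 * pair_sum m eta.
Proof.
move=> m0; have mN0 : m%:R != 0 :> R by rewrite pnatr_eq0; lia.
have key : (\sum_(1 <= x < m.+1) bar x%:Z eta) ^+ 2 =
    m%:R * chi rho + (1 - 2 * rho) * \sum_(1 <= x < m.+1) bar x%:Z eta
    + 2 * pair_sum m eta.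
  rewrite /pair_sum; elim: m {m0 mN0} => [|m IH].
    by rewrite !big_geq//; ring.
  rewrite !(big_nat_recr m.+1)//= sqrrD IH -mulr_suml -natr1.
  have -> : bar m.+1%:Z eta ^+ 2 = chi rho + (1 - 2 * rho) * bar m.+1%:Z eta.
    by rewrite /bar /chi; case: (eta _) => /=; ring.
  by ring.
by rewrite avg_zone0 exprMn key; field.
Qed.

Variable nub : probability Omega R.
Hypothesis hnub : bernoulli_product rho nub.
Hypothesis hrho : 0 < rho < 1.

Lemma Ex_block_product2 k m : (0 < m)%N ->
  Ex nub (fun eta => block_product k m eta ^+ 2) <= (m%:R^-1) ^+ k.
Proof.
move=> m0; rewrite -[X in _ <= _ ^+ X](size_iota 0 k).
apply: (Ex_prod_avg2 hnub hrho (z := fun i => zone i.+1 m)) => //.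
- exact: iota_uniq.
- by move=> i _; rewrite uniq_zone size_zone.
move=> i j _ _ ij x xi; apply/negP => xj.
have [lt_ij|] := ltnP i j.
  by have := zone_lt (lt_ij : (i.+1 < j.+1)%N) (leqnn m) xi xj; rewrite ltxx.
rewrite leq_eqVlt eq_sym (negPf ij)/= => lt_ji.
by have := zone_lt (lt_ji : (j.+1 < i.+1)%N) (leqnn m) xj xi; rewrite ltxx.
Qed.

End Blocks.

(** * Energy cost of replacing monomials by block averages *)

Section BlockEnergy.
Context {R : realType}.
Variables (r : Omega -> R) (hr : interaction_rate r).
Variables (e0 : R) (e0_gt0 : 0 < e0) (re0 : forall eta, e0 <= r eta).
Variables (rho : R) (nub : probability Omega R).
Hypothesis hnub : bernoulli_product rho nub.
Hypothesis hrho : 0 < rho < 1.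
Implicit Types f g h V W G : Omega -> R.

Local Notation E := (Ex nub).
Local Notation bar := (bar rho).
Local Notation avg := (avg rho).
Local Notation block_product := (block_product rho).
Local Notation pair_sum := (pair_sum rho).
Local Notation EB := (energy_bound r nub).

(** A factor travels at most (k + 1) m' <= 3 (k + 1) m past k - 1 others of second moment at most
    m^(1 - k), and the product of the two stays bounded because k >= 2. The ratio 3 admits m = m'./2
    for odd m', the worst case being 1 and 3. *)
Lemma energy_bound_block_product_step k : (2 <= k)%N ->
  exists2 K : R, 0 < K & forall m m', (0 < m <= m')%N -> (m' <= 3 * m)%N ->
  EB (fun eta => block_product k m eta - block_product k m' eta) K.
Proof.
move=> k2; have [K K0 hK] := energy_constant e0_gt0 (3 * k.+1)%:R.
exists (k%:R * K); first by rewrite mulr_gt0// ltr0n; lia.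
move=> m m' /andP[m0 mm'] m'3.
apply: (@energy_bound_prod_avg _ _ hr _ e0_gt0 re0 _ _ hnub hrho k
  (fun i => zone i.+1 m) (fun i => zone i.+1 m') m (k.+1 * m')%N) => //.
- by move=> i _; rewrite !uniq_zone !size_zone.
- by move=> i j /andP[ij _] x y; exact: zone_lt.
- by move=> i j /andP[ij _] x y; exact: zone_lt.
- by move=> i j /andP[ij _] x y; exact: zone_lt.
- move=> i ik x y; rewrite !mem_zone => hx hy.
  have h1 : (i.+2 * m <= k.+1 * m')%N by rewrite leq_mul// ltnS.
  have h2 : (i.+2 * m' <= k.+1 * m')%N by rewrite leq_mul// ltnS.
  by lia.
apply: le_trans hK; case: k k2 {K0} => [//|[//|k]] _ /=.
rewrite exprS mulrA -[leRHS]mulr1 ler_pM//.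
- by rewrite ler_pdivrMr ?ltr0n// -natrM ler_nat; nia.
- by rewrite exprn_ile1// ?invr_ge0// invf_le1 ?ltr0n// ler1n.
Qed.

(** Halving m down to 1 takes [trunc_log 2 m] steps of bounded cost; dividing by ln 2 converts this
    count into a natural logarithm. *)
Lemma energy_bound_block_product_log k : (2 <= k)%N ->
  exists2 K : R, 0 < K & forall m, (0 < m)%N ->
  EB (fun eta => block_product k m eta - block_product k 1 eta) (K * ln m%:R).
Proof.
move=> k2; have [K K0 hK] := energy_bound_block_product_step k2.
have dyadic n : forall m, (2 ^ n <= m < 2 ^ n.+1)%N ->
    EB (fun eta => block_product k m eta - block_product k 1 eta) (n%:R * K).
  elim: n => [|n IH] m hm.
    have -> : m = 1%N by lia.
    rewrite mul0r; apply: energy_bound_ext (energy_bound0 _ _) => eta.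
    by rewrite subrr.
  have hm' : (2 ^ n <= m./2 < 2 ^ n.+1)%N.
    by move: hm; rewrite !expnS; have := odd_double_half m; lia.
  have m'0 : (0 < m./2)%N by move: hm'; have := expn_gt0 2 n; lia.
  have := energy_boundD (energy_boundN (hK m./2 m _ _)) (IH _ hm').
  move=> /(_ ltac:(lia) ltac:(lia)); rewrite -natr1 mulrDl mul1r addrC.
  by apply: energy_bound_ext => eta; ring.
have ln2 : 0 < ln 2 :> R by rewrite ln_gt0// ltr1n.
exists (K / ln 2); first exact: divr_gt0.
move=> m m0; have := trunc_log_bounds (isT : (1 < 2)%N) m0.
set n := trunc_log 2 m => hn.
apply: (le_energy_bound hr e0_gt0 re0 hnub (dyadic n m hn)).
rewrite mulrC -mulrA ler_wpM2l ?(ltW K0)// mulrC ler_pdivlMr//.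
rewrite mulr_natl -lnXn// ler_ln ?posrE ?exprn_gt0 ?ltr0n//.
by rewrite -natrX ler_nat; case/andP: hn.
Qed.

(** The factors go to blocks of a fixed length N + 1, where N bounds |x| on [s]. These blocks lie to
    the right of every site of [s], so the order of the factors is respected, and the cost does not
    depend on m. The change of block length costs the logarithm. *)
Lemma energy_bound_monomial (s : seq int) : sorted <%R s -> (2 <= size s)%N ->
  exists2 K : R, 0 < K & forall m, (0 < m)%N ->
  EB (fun eta => \prod_(x <- s) bar x eta - block_product (size s) m eta)
     (K * (1 + ln m%:R)).
Proof.
move=> ss s2; set k := size s in s2 *.
have [L L0 hL] := energy_bound_block_product_log s2.
have [N hN] : exists N : nat, forall x, x \in s -> (absz x <= N)%N.
  elim: s {ss k s2 L0 hL} => [|x s [N hN]]; first by exists 0.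
  exists (absz x + N)%N => y; rewrite inE => /orP[/eqP->|/hN]; lia.
have [K0 K00 hK0] := energy_constant e0_gt0 ((N + k.+1 * N.+1)%:R : R).
have [ln_ge0 ln_le] : (forall m, (0 < m)%N -> 0 <= ln m%:R :> R) /\ 0 <= ln N.+1%:R :> R.
  by split=> [m m0|]; rewrite ln_ge0// ler1n.
exists (k%:R * K0 + L * ln N.+1%:R + L).
  by rewrite ltr_wpDl// addr_ge0 ?mulr_ge0 ?(ltW K00) ?(ltW L0).
move=> m m0.
have EB0 : EB (fun eta => \prod_(x <- s) bar x eta - block_product k N.+1 eta) (k%:R * K0).
  have sP i : (i < k)%N -> nth 0 s i \in s by move=> ik; exact: mem_nth.
  have zP i x : x \in zone i.+1 N.+1 -> (N < absz x <= i.+2 * N.+1)%N /\ 0 < x.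
    by rewrite mem_zone mulSn; lia.
  apply: (@energy_bound_ext _ _ _ (fun eta =>
      \prod_(i <- iota 0 k) avg [:: nth 0 s i] eta - block_product k N.+1 eta)).
    move=> eta; congr (_ - _).
    rewrite -[in RHS](mkseq_nth 0 s) big_map; apply: eq_bigr => i _.
    by rewrite /avg big_seq1 invr1 mul1r.
  apply: (@energy_bound_prod_avg _ _ hr _ e0_gt0 re0 _ _ hnub hrho k
    (fun i => [:: nth 0 s i]) (fun i => zone i.+1 N.+1) 1 (N + k.+1 * N.+1)%N) => //.
  - by move=> i ik; rewrite uniq_zone size_zone.
  - move=> i j /andP[ij jk] x y; rewrite !inE => /eqP-> /eqP->.
    by apply: (sorted_ltn_nth lt_trans) => //; rewrite inE//; exact: ltn_trans jk.
  - move=> i j /andP[ij jk] x y; rewrite inE => /eqP-> /zP[].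
    by have := hN _ (sP i (ltn_trans ij jk)); lia.
  - by move=> i j /andP[ij _] x y; exact: zone_lt.
  - move=> i ik x y; rewrite inE => /eqP-> /zP[].
    have := hN _ (sP i ik).
    have : (i.+2 * N.+1 <= k.+1 * N.+1)%N by rewrite leq_mul// ltnS.
    by lia.
  by rewrite invr1 expr1n mulr1.
(* The logarithmic bound compares with blocks of length 1, so the route from length N + 1 to length
   m passes through 1. *)
have := energy_boundB (energy_boundD EB0 (hL N.+1 isT)) (hL m m0).
move=> EBm; apply: energy_bound_ext (le_energy_bound hr e0_gt0 re0 hnub EBm _).
  by move=> eta; ring.
have lm := ln_ge0 _ m0.
rewrite -subr_ge0 [X in 0 <= X](_ : _ = L + (k%:R * K0 + L * ln N.+1%:R) * ln m%:R); last by ring.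
by rewrite addr_ge0 ?(ltW L0)// mulr_ge0// addr_ge0 ?mulr_ge0 ?(ltW K00) ?(ltW L0).
Qed.

(** A single factor has the constant 1 as spectator, so nothing compensates the distance of order
    m. *)
Lemma energy_bound_site (x : int) : exists2 K : R, 0 < K & forall m, (0 < m)%N ->
  EB (fun eta => bar x eta - avg (zone 0 m) eta) (K * Num.sqrt m%:R).
Proof.
have [K K0 hK] := energy_constant e0_gt0 ((absz x).+1%:R : R).
exists K => // m m0.
have m0' : 0 < m%:R :> R by rewrite ltr0n.
apply: (@energy_bound_ext _ _ _ (fun eta => 1 * (avg [:: x] eta - avg (zone 0 m) eta))).
  by move=> eta; rewrite mul1r {1}/avg big_seq1 invr1 mul1r.
apply: (energy_bound_avg hr e0_gt0 re0 hnub hrho (n := (absz x).+1 * m) (g := 1)).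
- exact: local_cst.
- by [].
- by rewrite -size_eq0 size_zone -lt0n.
- move=> u v; rewrite inE mem_zone => /eqP-> hv; split; last by [].
  by nia.
- by rewrite (eq_Ex _ (Y := fun=> 1)) ?Ex_cst// => eta; rewrite expr1n.
- by rewrite mulr_gt0// sqrtr_gt0.
by rewrite mulr1 exprMn sqr_sqrtr ?(ltW m0')// mulrA natrM ler_wpM2r// (ltW m0').
Qed.

Lemma energy_bound_gradient (x y : int) :
  exists2 K : R, 0 < K & EB (fun eta => bar x eta - bar y eta) K.
Proof.
have [K K0 hK] := energy_constant e0_gt0 ((absz (x - y))%:R : R).
exists K => //.
apply: (@energy_bound_ext _ _ _ (fun eta => 1 * (bar x eta - bar y eta))).
  by move=> eta; rewrite mul1r.
apply: (energy_bound_swap hr e0_gt0 re0 hnub hrho (n := absz (x - y)) (g := 1)) => //.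
- exact: local_cst.
- by rewrite (eq_Ex _ (Y := fun=> 1)) ?Ex_cst// => eta; rewrite expr1n.
by rewrite mulr1.
Qed.

(** For each y, bar y moves into zone 2 with the whole sum [G y] of bar x over x < y as spectator:
    second moment at most m, distance at most 3 m, cost of order m. Moving it separately for each
    pair would cost sqrt m for each of about m^2 pairs, which is too much. Then each bar x moves
    into zone 1 past the average over zone 2, of second moment at most 1 / m, at bounded cost. Both
    stages total order m^2, which the prefactor cancels; the m (m - 1) / 2 pairs account for 1 - 1 /
    m. *)
Lemma energy_bound_pair_sum : exists2 K : R, 0 < K & forall m, (0 < m)%N ->
  EB (fun eta => 2 / m%:R ^+ 2 * pair_sum m eta
               - (1 - m%:R^-1) * block_product 2 m eta) K.
Proof.
have [K K0 hK] := energy_constant e0_gt0 (3%:R : R).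
exists (4 * K); first exact: mulr_gt0.
move=> m m0; have m0' : 0 < m%:R :> R by rewrite ltr0n.
pose J1 := avg (zone 1 m); pose J2 := avg (zone 2 m).
have J_nil i : zone i m != [::] by rewrite -size_eq0 size_zone -lt0n.
pose G (y : nat) eta := \sum_(x <- [seq x%:Z | x <- index_iota 1 y]) bar x eta.
have lG y : local (G y) by apply: local_big => x; exact: local_bar.
have mG y z : z \in [seq x%:Z | x <- index_iota 1 y] -> z < y%:Z.
  by move=> /mapP[x]; rewrite mem_index_iota => hx ->; lia.
have EB1 y : (y < m.+1)%N -> EB (fun eta => G y eta * (bar y%:Z eta - J2 eta)) (m%:R * K).
  move=> ym; apply: (@energy_bound_ext _ _ _
      (fun eta => G y eta * (avg [:: y%:Z] eta - avg (zone 2 m) eta))).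
    by move=> eta; rewrite {1}/avg big_seq1 invr1 mul1r.
  apply: (energy_bound_avg hr e0_gt0 re0 hnub hrho (n := 3 * m) (g := m%:R)) => //.
  - move=> u v; rewrite inE mem_zone => /eqP -> hv; split; first by lia.
    move=> z hz; apply: indep_big => x /mG xy; apply: indep_bar.
    by apply: contraTneq xy => <-; rewrite -leNgt; lia.
  - rewrite (eq_Ex _ (Y := fun eta => G y eta ^+ 2 * 1)); last first.
      by move=> eta; rewrite mulr1.
    rewrite (Ex_sum_bar2 hnub)//; last 2 first.
    + by rewrite map_inj_uniq ?iota_uniq// => i j [].
    + exact: local_cst.
    rewrite Ex_cst mulr1 size_map size_iota -[leRHS]mulr1.
    apply: ler_pM; rewrite ?(chi_ge0 hrho) ?(chi_le1 hrho)// ler_nat; lia.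
  - exact: mulr_gt0.
  rewrite natrM exprMn [leRHS]mulrCA -mulrA -expr2 mulrC.
  by rewrite ler_wpM2l// exprn_ge0.
have EB2 x : (1 <= x < m.+1)%N -> EB (fun eta => J2 eta * (bar x%:Z eta - J1 eta)) K.
  move=> hx; apply: (@energy_bound_ext _ _ _
      (fun eta => J2 eta * (avg [:: x%:Z] eta - avg (zone 1 m) eta))).
    by move=> eta; rewrite {1}/avg big_seq1 invr1 mul1r.
  apply: (energy_bound_avg hr e0_gt0 re0 hnub hrho (n := 2 * m) (g := m%:R^-1)) => //.
  - exact: local_avg.
  - move=> u v; rewrite inE mem_zone => /eqP -> hv; split; first by lia.
    move=> z hz; apply: indep_avg; rewrite mem_zone; lia.
  - rewrite (eq_Ex _ (Y := fun eta => J2 eta ^+ 2 * 1)); last first.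
      by move=> eta; rewrite mulr1.
    rewrite (Ex_avg2 hnub) ?size_zone ?uniq_zone//; last exact: local_cst.
    rewrite Ex_cst mulr1 -[leRHS]mul1r ler_wpM2r ?invr_ge0 ?(ltW m0')//.
    exact: chi_le1 hrho.
  - rewrite natrM -mulrA divff ?lt0r_neq0// mulr1.
    by apply: le_trans hK; rewrite ler_nat.
have EBs : EB (fun eta => \sum_(y <- index_iota 1 m.+1)
     (G y eta * (bar y%:Z eta - J2 eta)
      + \sum_(x <- index_iota 1 y) J2 eta * (bar x%:Z eta - J1 eta)))
   (\sum_(y <- index_iota 1 m.+1) (m%:R * K + \sum_(x <- index_iota 1 y) K)).
  apply: energy_bound_sum => y; rewrite mem_index_iota => hy.
  apply: energy_boundD; first by apply: EB1; case/andP: hy.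
  apply: energy_bound_sum => x; rewrite mem_index_iota => hx.
  by apply: EB2; lia.
have := energy_boundZ (2 / m%:R ^+ 2) EBs => EBs2.
apply: energy_bound_ext (le_energy_bound hr e0_gt0 re0 hnub EBs2 _).
  move=> eta.
  have -> : block_product 2 m eta = J1 eta * J2 eta.
    by rewrite /block_product !big_cons big_nil mulr1.
  have -> : \sum_(y <- index_iota 1 m.+1)
     (G y eta * (bar y%:Z eta - J2 eta)
      + \sum_(x <- index_iota 1 y) J2 eta * (bar x%:Z eta - J1 eta)) =
     pair_sum m eta - \sum_(y <- index_iota 1 m.+1) (y%:R - 1) * (J1 eta * J2 eta).
    rewrite /pair_sum -sumrB; apply: eq_big_seq => y; rewrite mem_index_iota => hy.
    rewrite -mulr_suml -mulr_sumr sumrB /G big_map sumr_const_nat -[J1 eta *+ _]mulr_natl.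
    by rewrite natrB; [ring|lia].
  rewrite -mulr_suml.
  have -> : \sum_(y <- index_iota 1 m.+1) (y%:R - 1) = m%:R * (m%:R - 1) / 2 :> R.
    rewrite -/(bigop _ _ _); elim: m {m0 m0' J1 J2 J_nil EB1 EB2 EBs EBs2} => [|m IH].
      by rewrite big_nil; field.
    by rewrite (big_nat_recr m.+1)//= IH -natr1; field.
  by field; rewrite lt0r_neq0.
rewrite ger0_norm ?divr_ge0 ?exprn_ge0 ?(ltW m0')//.
apply: (@le_trans _ _ (2 / m%:R ^+ 2 *
    \sum_(y <- index_iota 1 m.+1) (m%:R * K + m%:R * K))).
  rewrite ler_wpM2l ?divr_ge0 ?exprn_ge0 ?(ltW m0')//.
  rewrite big_seq [leRHS]big_seq; apply: ler_sum => y; rewrite mem_index_iota => hy.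
  rewrite lerD2l sumr_const_nat -[K *+ _]mulr_natl ler_wpM2r ?(ltW K0)// ler_nat; lia.
rewrite sumr_const_nat subn1 -[_ *+ _]mulr_natl le_eqVlt; apply/orP; left.
by apply/eqP; field; rewrite lt0r_neq0.
Qed.

End BlockEnergy.

(** * Expansion of local functions *)

Section Expansion.
Context {R : realType} (rho : R).
Hypothesis hrho : 0 < rho < 1.
Implicit Types (f : Omega -> R) (L : seq (R * seq int)).

Local Notation bar := (bar rho).

Definition monomial_sum L (eta : Omega) : R :=
  \sum_(cs <- L) cs.1 * \prod_(x <- cs.2) bar x eta.

Lemma local_monomial (s : seq int) : local (fun eta => \prod_(x <- s) bar x eta).
Proof. by apply: local_big => x; exact: local_bar. Qed.

(** With f_b the function f with the value b put at x, f = f_0 + rho (f_1 - f_0) + bar x (f_1 -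
    f_0), and both coefficients depend on the remaining sites only. Sorted lists are kept because
    the moves of several factors require them in increasing order. *)
Lemma local_expansion f : local f -> exists2 L : seq (R * seq int),
  (forall cs, cs \in L -> sorted <%R cs.2) & f =1 monomial_sum L.
Proof.
move=> [A0 fA0]; pose A := sort <=%R (undup A0).
have sA : sorted <%R A.
  by rewrite lt_sorted_uniq_le sort_uniq undup_uniq sort_sorted//; exact: le_total.
have fA (eta xi : Omega) : {in A, eta =1 xi} -> f eta = f xi.
  by move=> h; apply: fA0 => x xA0; apply: h; rewrite mem_sort mem_undup.
suff [L LA fL] : exists2 L : seq (R * seq int),
    (forall cs, cs \in L -> subseq cs.2 A) & f =1 monomial_sum L.
  by exists L => // cs /LA; move/subseq_sorted; apply => //; exact: lt_trans.
move: A sA fA => A sA fA; elim: A f {fA0} sA fA => [|x A IH] f sA fA.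
  exists [:: (f point, [::])] => [cs|eta]; first by rewrite inE => /eqP->.
  by rewrite /monomial_sum big_seq1 big_nil mulr1; exact: fA.
have {}sA : sorted <%R A by exact: path_sorted sA.
have fu b (eta xi : Omega) : {in A, eta =1 xi} ->
    f (update x b eta) = f (update x b xi).
  move=> h; apply: fA => z; rewrite inE /update.
  by case: eqP => //= _; exact: h.
have [|L1 LA1 fL1] := IH (fun eta => f (update x true eta) - f (update x false eta)) sA.
  by move=> eta xi h; rewrite !(fu _ _ _ h).
have [|L0 LA0 fL0] := IH (fun eta => f (update x false eta) +
  rho * (f (update x true eta) - f (update x false eta))) sA.
  by move=> eta xi h; rewrite !(fu _ _ _ h).
exists (L0 ++ [seq (cs.1, x :: cs.2) | cs <- L1]).
  move=> cs; rewrite mem_cat => /orP[/LA0 h|/mapP[cs' /LA1 h ->]/=].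
    exact: subseq_trans h (subseq_cons _ _).
  by rewrite eqxx.
move=> eta; rewrite /monomial_sum big_cat big_map/=.
under [X in _ = _ + X]eq_bigr do rewrite big_cons mulrCA.
rewrite -mulr_sumr -!/(monomial_sum _ _) -fL0 -fL1 /bar -{1}(update_id x eta).
by case: (eta x) => /=; ring.
Qed.

Section Moments.
Variables (b : R) (nub : probability Omega R).
Hypothesis hnub : bernoulli_product b nub.

(** The bars are centered at rho while the measure has density b; keeping the two apart makes phi a
    polynomial in b - rho. *)
Lemma Ex_monomial (s : seq int) : uniq s ->
  Ex nub (fun eta => \prod_(x <- s) bar x eta) = (b - rho) ^+ size s.
Proof.
elim: s => [_|x s IH /= /andP[xs us]].
  by rewrite (eq_Ex _ (Y := fun=> 1)) ?Ex_cst// => eta; rewrite big_nil.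
have lm := local_monomial s.
have xm : indep x (fun eta => \prod_(x <- s) bar x eta).
  by apply: indep_big => y ys; apply: indep_bar; apply: contraNneq xs => ->.
have lxm : local (fun eta : Omega => (eta x)%:R * \prod_(x <- s) bar x eta).
  by apply: localM => //; exact: (local_site (fun c => c%:R)).
rewrite (eq_Ex _ (Y := fun eta : Omega => (eta x)%:R * \prod_(x <- s) bar x eta
   - rho * \prod_(x <- s) bar x eta)); last first.
  by move=> eta; rewrite big_cons /bar; ring.
have [bm1 bm2] := (local_bm lm, local_bm lxm).
rewrite ExB ?ExZ ?(Ex_site hnub)//; last exact: bmZ.
by rewrite -mulrBl IH// exprS.
Qed.

Lemma Ex_monomial_sum L : (forall cs, cs \in L -> uniq cs.2) ->
  Ex nub (monomial_sum L) = \sum_(cs <- L) cs.1 * (b - rho) ^+ size cs.2.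
Proof.
move=> uL; rewrite /monomial_sum Ex_sum; last first.
  by move=> cs; apply: local_bm; apply: localZ; exact: local_monomial.
apply: eq_big_seq => cs /uL us; rewrite -Ex_monomial// -ExZ//.
by apply: local_bm; exact: local_monomial.
Qed.

End Moments.

Variable (nu : R -> probability Omega R).
Hypothesis hnu : forall b : R, 0 <= b <= 1 -> bernoulli_product b (nu b).
Variables (f : Omega -> R) (L : seq (R * seq int)).
Hypothesis fL : f =1 monomial_sum L.
Hypothesis sL : forall cs, cs \in L -> sorted <%R cs.2.

Definition degree_sum (n : nat) : R := \sum_(cs <- L | size cs.2 == n) cs.1.

Let p : {poly R} := \sum_(cs <- L) cs.1 *: ('X - rho%:P) ^+ size cs.2.

(** Outside [0, 1] nothing is known about [nu], so phi is identified with [p] on the open interval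
    only; derivatives at interior points do not see the difference. *)
Let phiE b : 0 < b < 1 -> phi nu f b = p.[b].
Proof.
move=> /andP[b0 b1]; have h := hnu (_ : 0 <= b <= 1).
rewrite /phi -/(Ex _ f) (eq_Ex _ fL) (@Ex_monomial_sum b _ (h _)) ?ltW//.
  rewrite /p horner_sum; apply: eq_bigr => cs _.
  by rewrite hornerZ horner_exp hornerXsubC.
by move=> cs /sL; rewrite lt_sorted_uniq_le => /andP[].
Qed.

(** Wanted on the whole interval, not just at rho, since this derivative is differentiated again. *)
Let derive1_phi b : 0 < b < 1 -> derive1 (phi nu f) b = p^`().[b].
Proof.
move=> hb; rewrite derive1E.
rewrite (@near_eq_derive _ _ _ (phi nu f) (horner p)) //.
  by rewrite derive_val.
have /andP[b0 b1] := hb; near=> c; apply: phiE; apply/andP; split.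
  by near: c; exact: lt_nbhsr.
by near: c; exact: lt_nbhsl.
Unshelve. all: by end_near. Qed.

Lemma phi_degree0 : phi nu f rho = degree_sum 0.
Proof.
rewrite phiE// /p horner_sum /degree_sum [RHS]big_mkcond; apply: eq_bigr => cs _.
rewrite hornerZ horner_exp hornerXsubC subrr expr0n.
by case: ifP => _; rewrite ?mulr1 ?mulr0.
Qed.

Lemma phi_degree1 : derive1 (phi nu f) rho = degree_sum 1.
Proof.
rewrite derive1_phi// /p linear_sum horner_sum /degree_sum [RHS]big_mkcond.
apply: eq_bigr => cs _.
rewrite /= derivZ deriv_exp derivXsubC mul1r hornerZ hornerMn horner_exp hornerXsubC.
rewrite subrr expr0n; case: (size cs.2) => [|[|n]] /=; rewrite ?mulr0n ?mulr0 ?mulr1//.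
by rewrite mul0rn mulr0.
Qed.

Lemma phi_degree2 : derive1 (derive1 (phi nu f)) rho = 2 * degree_sum 2.
Proof.
rewrite derive1E (@near_eq_derive _ _ _ _ (horner p^`())) //; last first.
  have /andP[b0 b1] := hrho; near=> c; apply: derive1_phi; apply/andP; split.
    by near: c; exact: lt_nbhsr.
  by near: c; exact: lt_nbhsl.
rewrite derive_val /p !linear_sum horner_sum /degree_sum [in RHS]big_mkcond mulr_sumr.
apply: eq_bigr => cs _.
rewrite /= !derivZ deriv_exp derivXsubC mul1r hornerZ derivMn hornerMn deriv_exp.
rewrite derivXsubC mul1r hornerMn horner_exp hornerXsubC subrr expr0n.
case: (size cs.2) => [|[|[|n]]] /=; rewrite ?mulr0n ?mulr0 ?mulr1 ?mul0rn ?mulr0//.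
by rewrite mulr1n mulrC.
Unshelve. all: by end_near. Qed.

End Expansion.

(** * The semigroup *)

Section Semigroup.
Context {R : realType}.
Implicit Types f g : Omega -> R.

Lemma nbhs_uniformP f (B : set {uniform Omega -> R}) :
  nbhs (f : {uniform Omega -> R}) B <->
  exists2 e : R, 0 < e & forall g, (forall eta, `|f eta - g eta| < e) -> B g.
Proof.
rewrite uniform_nbhs; split => [[U [entU UB]]|[e e0 eB]].
  move: entU; rewrite -entourage_ballE => -[e /= e0 eU]; exists e => // g gf.
  by apply: UB => eta _; apply: eU => /=; exact: gf.
exists [set xy : R * R | ball xy.1 e xy.2]; split.
  by rewrite -entourage_ballE; exists e.
by move=> g /= gf; apply: eB => eta; exact: gf.
Qed.

Lemma uniform_cvg_rightP (F : R -> Omega -> R) f :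
  {uniform, F h @[h --> 0^'+] --> f} <->
  forall e : R, 0 < e -> exists2 d : R, 0 < d & forall h : R, 0 < h < d ->
    forall eta, `|f eta - F h eta| < e.
Proof.
split=> [Ff e e0|H B].
  have /Ff : nbhs (f : {uniform Omega -> R}) [set g | forall eta, `|f eta - g eta| < e].
    by apply/nbhs_uniformP; exists e.
  case=> d /= d0 dF; exists d => // h /andP[h0 hd] eta.
  by apply: dF => //=; rewrite distrC subr0 gtr0_norm.
move=> /nbhs_uniformP[e e0 eB]; have [d d0 dF] := H e e0.
exists d => // h; rewrite /= => hd h0; apply: eB => eta.
by apply: dF; rewrite h0 -[h]gtr0_norm// -normrN -sub0r.
Qed.


(** The generator graph in epsilon-delta form; the difference quotient is multiplied by h so that
    errors can be summed over time steps. *)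
Definition generator_pair (S : R -> (Omega -> R) -> Omega -> R) f g :=
  [/\ continuous f, continuous g & forall e : R, 0 < e ->
    exists2 d : R, 0 < d & forall h : R, 0 < h < d ->
      forall eta, `|S h f eta - f eta - h * g eta| < h * e].

Lemma generator_graphP S f g : generator_graph S (f, g) <-> generator_pair S f g.
Proof.
have eqv h (eta : Omega) e : 0 < h ->
    (`|S h f eta - f eta - h * g eta| < h * e) =
    (`|g eta - (S h f eta - f eta) / h| < e).
  move=> h0; rewrite -[RHS](ltr_pM2l h0) -[X in _ = (X * _ < _)](gtr0_norm h0) -normrM -normrN.
  by congr (`|_| < _); field; rewrite lt0r_neq0.
split=> -[cf cg].
  move=> /uniform_cvg_rightP fg; split=> // e e0.
  have [d d0 dF] := fg e e0; exists d => // h hd eta; rewrite eqv; last by case/andP: hd.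
  exact: dF.
move=> fg; split=> //=; apply/uniform_cvg_rightP => e e0.
have [d d0 dF] := fg e e0; exists d => // h hd eta; rewrite -eqv; last by case/andP: hd.
exact: dF.
Qed.

Variables (r : Omega -> R) (hr : interaction_rate r).
Variable S : R -> (Omega -> R) -> Omega -> R.
Hypothesis hS : gas_semigroup r S.

Let MS : markov_semigroup S := hS.1.
Local Notation gen := (generator_pair S).

Lemma local_generator f : local f -> gen f (gasL r f).
Proof.
move=> lf; apply/generator_graphP; rewrite hS.2.
by apply: subset_closure.
Qed.

(** The core property: one local function approximates [f] while its image approximates [g], so
    relations that involve both pass to the limit. *)
Lemma generator_core f g (e : R) : gen f g -> 0 < e -> exists2 f' : Omega -> R, local f' &
  (forall eta, `|f eta - f' eta| < e) /\
  (forall eta, `|g eta - gasL r f' eta| < e).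
Proof.
move=> /generator_graphP; rewrite hS.2 => clfg e0.
have := clfg [set fg | (forall eta, `|f eta - fg.1 eta| < e) /\
   (forall eta, `|g eta - fg.2 eta| < e)].
case.
  exists ([set f' | forall eta, `|f eta - f' eta| < e],
          [set g' | forall eta, `|g eta - g' eta| < e]) => //=; split.
    by apply/nbhs_uniformP; exists e.
  by apply/nbhs_uniformP; exists e.
move=> [f' g'] [[/= lf' eg'] [/= ff' gg']].
by exists f' => //; split=> // eta; rewrite -eg'.
Qed.

Lemma continuousDf f g : continuous f -> continuous g ->
  continuous (fun eta => f eta + g eta).
Proof. by move=> cf cg x; apply: cvgD; [exact: cf|exact: cg]. Qed.

Lemma continuousBf f g : continuous f -> continuous g ->
  continuous (fun eta => f eta - g eta).
Proof. by move=> cf cg x; apply: cvgB; [exact: cf|exact: cg]. Qed.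

Lemma continuousZf c f : continuous f -> continuous (fun eta => c * f eta).
Proof. by move=> cf x; apply: cvgM; [exact: cvg_cst|exact: cf]. Qed.

Lemma continuousMf f g : continuous f -> continuous g ->
  continuous (fun eta => f eta * g eta).
Proof. by move=> cf cg x; apply: cvgM; [exact: cf|exact: cg]. Qed.

Let cont_cst (c : R) : continuous (fun _ : Omega => c).
Proof. by move=> x; exact: cvg_cst. Qed.

Lemma semigroupDl (t : R) f g : 0 <= t -> continuous f -> continuous g ->
  S t (fun eta => f eta + g eta) = (fun eta => S t f eta + S t g eta).
Proof.
move=> t0 cf cg; have := semigroup_linear MS 1 t0 cf cg.
by under eq_fun do rewrite mul1r; move=> ->; apply/funext => eta; rewrite mul1r.
Qed.

Lemma semigroup_cst0 (t : R) : 0 <= t -> S t (fun=> 0) = (fun=> 0).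
Proof.
move=> t0; have := semigroup_linear MS (-1) t0 (@cont_cst 0) (@cont_cst 0).
by under eq_fun do rewrite mulr0 addr0; move=> /funeqP e; apply/funext => eta;
  move: (e eta); lra.
Qed.

Lemma semigroupZ (t c : R) f : 0 <= t -> continuous f ->
  S t (fun eta => c * f eta) = (fun eta => c * S t f eta).
Proof.
move=> t0 cf; have := semigroup_linear MS c t0 cf (@cont_cst 0).
under eq_fun do rewrite addr0; move=> ->; apply/funext => eta.
by rewrite semigroup_cst0// addr0.
Qed.

Lemma semigroupB (t : R) f g : 0 <= t -> continuous f -> continuous g ->
  S t (fun eta => f eta - g eta) = (fun eta => S t f eta - S t g eta).
Proof.
move=> t0 cf cg; have := semigroup_linear MS (-1) t0 cg cf.
under eq_fun do rewrite mulN1r addrC.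
by move=> ->; apply/funext => eta; rewrite mulN1r addrC.
Qed.

(** Positivity applied to M + f and to M - f. *)
Lemma semigroup_contract (t : R) f (M : R) : 0 <= t -> continuous f ->
  (forall eta, `|f eta| <= M) -> forall eta, `|S t f eta| <= M.
Proof.
move=> t0 cf fM eta.
have SM : S t (fun=> M) = (fun=> M).
  have := semigroupZ M t0 (@cont_cst 1); under eq_fun do rewrite mulr1.
  by move=> ->; rewrite (semigroup1 MS)//; apply/funext => ?; rewrite mulr1.
have cM := @cont_cst M.
have cN : continuous (fun eta => M - f eta).
  by move=> x; apply: cvgB; [exact: cM|exact: cf].
have fMl xi : - M <= f xi <= M by rewrite -ler_norml.
have SD := semigroup_ge0 MS t0 (continuousDf cM cf).
have SB := semigroup_ge0 MS t0 cN.
rewrite semigroupDl// SM in SD; rewrite semigroupB// SM in SB.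
have lb : 0 <= M + S t f eta by apply: SD => xi; have /andP[+ _] := fMl xi; lra.
have ub : 0 <= M - S t f eta by apply: SB => xi; have /andP[_] := fMl xi; lra.
by rewrite ler_norml; apply/andP; split; lra.
Qed.

(** By contraction, a step size that works at time 0 works at every time t; errors summed over steps
    are then proportional to the elapsed time. *)
Lemma generator_step f g (e : R) : gen f g -> 0 < e ->
  exists2 d : R, 0 < d & forall h t : R, 0 < h < d -> 0 <= t -> forall eta,
    `|S (t + h) f eta - S t f eta - h * S t g eta| <= h * e.
Proof.
move=> [cf cg fg] e0; have [d d0 dF] := fg e e0; exists d => // h t hd t0 eta.
have h0 : 0 <= h by case/andP: hd => /ltW.
have cSh := semigroup_cont MS h0 cf.
have cgh := @continuousZf h _ cg.
rewrite (semigroupD MS t0 h0 cf).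
have -> : S t (S h f) eta - S t f eta - h * S t g eta =
    S t (fun eta => S h f eta - f eta - h * g eta) eta.
  by rewrite !semigroupB ?semigroupZ//; exact: continuousBf.
apply: semigroup_contract => //; first by apply: continuousBf => //; exact: continuousBf.
by move=> xi; apply: ltW; exact: dF.
Qed.

Lemma generator_semigroup f g (t : R) : gen f g -> 0 <= t -> gen (S t f) (S t g).
Proof.
move=> fg t0; have [cf cg _] := fg.
split=> [||e e0]; [exact: semigroup_cont|exact: semigroup_cont|].
have e20 : 0 < e / 2 by rewrite divr_gt0.
have [d d0 dF] := generator_step fg e20; exists d => // h hd eta.
have h0 : 0 < h by case/andP: hd.
rewrite -(semigroupD MS)//; last exact: ltW.
rewrite [h + t]addrC; apply: le_lt_trans (dF h t hd t0 eta) _.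
by rewrite ltr_pM2l//; lra.
Qed.

Lemma generatorD f g f' g' : gen f g -> gen f' g' ->
  gen (fun eta => f eta + f' eta) (fun eta => g eta + g' eta).
Proof.
move=> [cf cg fg] [cf' cg' fg']; split; [exact: continuousDf|exact: continuousDf|].
move=> e e0; have e20 : 0 < e / 2 by rewrite divr_gt0.
have [d d0 dF] := fg _ e20; have [d' d'0 dF'] := fg' _ e20.
exists (Num.min d d'); first by rewrite lt_min d0.
move=> h; rewrite lt_min => /and3P[h0 hd hd'] eta.
rewrite semigroupDl ?ltW//.
have := dF h _ eta; have := dF' h _ eta; rewrite h0 hd hd' => /(_ isT) H' /(_ isT) H.
rewrite [X in `|X|](_ : _ = (S h f eta - f eta - h * g eta) +
  (S h f' eta - f' eta - h * g' eta)); last by ring.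
by apply: le_lt_trans (ler_normD _ _) _; rewrite [e]splitr mulrDr ltrD.
Qed.

Lemma generatorZ (c : R) f g : gen f g ->
  gen (fun eta => c * f eta) (fun eta => c * g eta).
Proof.
move=> [cf cg fg]; split; [exact: continuousZf|exact: continuousZf|].
move=> e e0; have c0 : 0 < `|c| + 1 by rewrite ltr_wpDl.
have [d d0 dF] := fg _ (divr_gt0 e0 c0); exists d => // h hd eta.
have h0 : 0 < h by case/andP: hd.
rewrite semigroupZ ?ltW// [X in `|X|](_ : _ = c * (S h f eta - f eta - h * g eta));
  last by ring.
rewrite normrM; have := dF h hd eta; set x := `|S h f eta - _ - _|.
rewrite mulrA ltr_pdivlMr// => xlt; apply: le_lt_trans xlt.
by rewrite mulrC ler_wpM2l ?lerDl// /x normr_ge0.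
Qed.

Lemma generator0 : gen (fun=> 0) (fun=> 0).
Proof.
split; [exact: cont_cst|exact: cont_cst|] => e e0; exists 1 => // h /andP[h0 _] eta.
by rewrite semigroup_cst0 ?ltW// mulr0 !subr0 normr0 mulr_gt0.
Qed.

Lemma generator_sum (s : seq nat) (f_ g_ : nat -> Omega -> R) :
  (forall i, gen (f_ i) (g_ i)) ->
  gen (fun eta => \sum_(i <- s) f_ i eta) (fun eta => \sum_(i <- s) g_ i eta).
Proof.
move=> fg; elim: s => [|i s IH].
  under eq_fun do rewrite big_nil; rewrite [X in gen _ X](_ : _ = fun=> 0).
    exact: generator0.
  by apply/funext => eta; rewrite big_nil.
under eq_fun do rewrite big_cons; rewrite [X in gen _ X](_ : _ =
  fun eta => g_ i eta + \sum_(j <- s) g_ j eta).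
  exact: generatorD.
by apply/funext => eta; rewrite big_cons.
Qed.

End Semigroup.

(** Restricting to e < 1 allows a product of two errors to be bounded by one of them. *)
Lemma le_of_le_eps (R : realType) (x y C : R) :
  (forall e : R, 0 < e < 1 -> x <= y + C * e) -> x <= y.
Proof.
move=> H; apply/ler_addgt0Pr => e e0.
have C0 : 0 < `|C| + 1 by rewrite ltr_wpDl.
pose e' := Num.min (e / (`|C| + 1)) 2^-1.
have e'0 : 0 < e' by rewrite lt_min divr_gt0//= invr_gt0.
have e'1 : e' < 1 by rewrite gt_min invf_lt1// ltr1n orbT.
apply: le_trans (H e' _) _; first by rewrite e'0.
rewrite lerD2l; apply: (@le_trans _ _ ((`|C| + 1) * e')).
  by rewrite ler_wpM2r ?(ltW e'0)//; have := ler_norm C; lra.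
by rewrite mulrC -ler_pdivlMr// ge_min lexx.
Qed.

(** * Reversibility of the semigroup *)

Section Reversibility.
Context {R : realType}.
Variables (r : Omega -> R) (hr : interaction_rate r).
Variables (rho : R) (nub : probability Omega R).
Hypothesis hnub : bernoulli_product rho nub.
Variable S : R -> (Omega -> R) -> Omega -> R.
Hypothesis hS : gas_semigroup r S.
Implicit Types f g u w V : Omega -> R.

Let MS : markov_semigroup S := hS.1.
Local Notation gen := (generator_pair S).
Local Notation E := (Ex nub).

Let Ex_close (X Y : Omega -> R) (e : R) : bm X -> bm Y ->
  (forall eta, `|X eta - Y eta| <= e) -> `|E X - E Y| <= e.
Proof. by move=> bX bY H; rewrite -ExB//; apply: Ex_norm_le => //; exact: bmB. Qed.

Lemma prod_close (a b a' b' M e : R) : `|a| <= M -> `|b| <= M -> 0 <= e <= 1 ->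
  `|a - a'| <= e -> `|b - b'| <= e -> `|a * b - a' * b'| <= (2 * M + 1) * e.
Proof.
move=> aM bM /andP[e0 e1] aa bb.
have -> : a * b - a' * b' = (a - a') * b + (a * (b - b') - (a - a') * (b - b')) by ring.
have M0 : 0 <= M := le_trans (normr_ge0 _) aM.
apply: le_trans (ler_normD _ _) _; apply: (@le_trans _ _ (e * M + (M * e + e * 1))).
  apply: lerD; first by rewrite normrM ler_pM.
  apply: le_trans (ler_normB _ _) _; rewrite !normrM; apply: lerD; first exact: ler_pM.
  by apply: ler_pM => //; exact: le_trans bb e1.
by rewrite le_eqVlt; apply/orP; left; apply/eqP; ring.
Qed.

Let bound2 f g : continuous f -> continuous g -> exists2 M : R, 0 <= M &
  forall eta, `|f eta| <= M /\ `|g eta| <= M.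
Proof.
move=> /continuous_bm[_ [M fM]] /continuous_bm[_ [N gN]].
exists (Num.max M N); first by rewrite le_max (le_trans (normr_ge0 _) (fM point)).
by move=> eta; rewrite !le_max fM gN orbT.
Qed.

Lemma generator_sym f g f' g' : gen f g -> gen f' g' ->
  E (fun eta => f eta * g' eta) = E (fun eta => g eta * f' eta).
Proof.
move=> fg fg'; have [cf cg _] := fg; have [cf' cg' _] := fg'.
have [M M0 fM] := bound2 cf cg'; have [N N0 gN] := bound2 cg cf'.
have [bf bg bf' bg'] := And4 (continuous_bm cf) (continuous_bm cg)
  (continuous_bm cf') (continuous_bm cg').
apply/eqP; rewrite -subr_eq0 -normr_le0.
apply: (@le_of_le_eps _ _ _ ((2 * M + 1) + (2 * N + 1))) => e /andP[e0 e1].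
have [f1 lf1 [ff1 gg1]] := generator_core hS fg e0.
have [f2 lf2 [ff2 gg2]] := generator_core hS fg' e0.
have lg1 := local_gasL hr lf1; have lg2 := local_gasL hr lf2.
have e01 : 0 <= e <= 1 by rewrite !ltW.
have h1 : `|E (fun eta => f eta * g' eta) - E (fun eta => f1 eta * gasL r f2 eta)|
    <= (2 * M + 1) * e.
  apply: Ex_close => [||eta]; [exact: bmM|by apply: local_bm; exact: localM|].
  by have [? ?] := fM eta; apply: prod_close => //; exact: ltW.
have h2 : `|E (fun eta => g eta * f' eta) - E (fun eta => gasL r f1 eta * f2 eta)|
    <= (2 * N + 1) * e.
  apply: Ex_close => [||eta]; [exact: bmM|by apply: local_bm; exact: localM|].
  by have [? ?] := gN eta; apply: prod_close => //; exact: ltW.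
rewrite distrC -(gasL_sym hr hnub lf2 lf1) in h2.
by rewrite add0r mulrDl; apply: le_trans (lerD h1 h2); exact: ler_distD.
Qed.

(** Extends the energy inequality from local functions to the domain of the generator, where -E (u
    w) stands for the Dirichlet form of [u]. It is meant for time sums of S_s V, which need not be
    local. *)
Lemma energy_bound_generator V (K : R) u w (a : R) : energy_bound r nub V K -> gen u w ->
  0 < a -> E (fun eta => V eta * u eta) <=
    K * (a - a^-1 * E (fun eta => u eta * w eta)).
Proof.
move=> [lV K0 VK] uw a0; have [cu cw _] := uw.
have [M M0 uM] := bound2 cu cw.
have [_ [MV VM]] := local_bm lV.
have [bu bw bV] := And3 (continuous_bm cu) (continuous_bm cw) (local_bm lV).
apply: (@le_of_le_eps _ _ _ (MV + K * a^-1 * (2 * M + 1))) => e /andP[e0 e1].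
have [f lf [uf wf]] := generator_core hS uw e0.
have lg := local_gasL hr lf.
have := VK f lf a a0; rewrite /dirichlet => H.
have h1 : `|E (fun eta => V eta * u eta) - E (fun eta => V eta * f eta)| <= MV * e.
  apply: Ex_close => [||eta]; [exact: bmM|by apply: local_bm; exact: localM|].
  by rewrite -mulrBr normrM; apply: ler_pM => //; exact: ltW.
have h2 : `|E (fun eta => u eta * w eta) - E (fun eta => f eta * gasL r f eta)|
    <= (2 * M + 1) * e.
  apply: Ex_close => [||eta]; [exact: bmM|by apply: local_bm; exact: localM|].
  by have [? ?] := uM eta; apply: prod_close => //; rewrite ?(ltW e0) ?(ltW e1)//; exact: ltW.
move: h1 h2; rewrite !ler_norml => /andP[_ h1] /andP[_ h2].
have key (x y z z' : R) : x - y <= MV * e -> z - z' <= (2 * M + 1) * e ->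
    y <= K * (a + a^-1 * - z') ->
    x <= K * (a - a^-1 * z) + (MV + K * a^-1 * (2 * M + 1)) * e.
  set c := K * a^-1 => k1 k2 k3.
  have c0 : 0 <= c by rewrite mulr_ge0// invr_ge0 ltW.
  have k4 := ler_wpM2l c0 k2.
  have e3 : K * (a + a^-1 * - z') = K * a - c * z' by rewrite /c; ring.
  have -> : K * (a - a^-1 * z) = K * a - c * z by rewrite /c; ring.
  have -> : (MV + c * (2 * M + 1)) * e = MV * e + c * ((2 * M + 1) * e) by ring.
  rewrite e3 in k3; rewrite mulrBr in k4.
  lra.
exact: key h1 h2 H.
Qed.

(** The products <S_(ih) f, S_((n-i)h) f'> interpolate between the two sides. Neighbouring ones
    differ by o(h), since the first-order parts cancel by symmetry of the generator, and the n
    differences add up to o(1). *)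
Lemma semigroup_sym (t : R) f g f' g' : 0 <= t -> gen f g -> gen f' g' ->
  E (fun eta => S t f eta * f' eta) = E (fun eta => f eta * S t f' eta).
Proof.
move=> t0 fg fg'; have [cf cg _] := fg; have [cf' cg' _] := fg'.
have [M M0 fM] := bound2 cf cf'.
apply/eqP; rewrite -subr_eq0 -normr_le0.
apply: (@le_of_le_eps _ _ _ (2 * t * M)) => e /andP[e0 _]; rewrite add0r.
have [d1 d10 dF1] := generator_step hS fg e0.
have [d2 d20 dF2] := generator_step hS fg' e0.
have [n n0 hd] : exists2 n : nat, 0 < n%:R :> R & t / n%:R < Num.min d1 d2.
  exists (Num.truncn (t / Num.min d1 d2)).+1; first by rewrite ltr0n.
  by rewrite ltr_pdivrMr// mulrC -ltr_pdivrMr ?lt_min ?d10// truncnS_gt.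
pose h := t / n%:R.
have [t00|t00] := eqVneq t 0.
  rewrite t00 !(semigroup0 MS)// subrr normr0 mulr0 mul0r mul0r //.
have h0 : 0 < h by rewrite divr_gt0// lt0r t00.
have [hd1 hd2] : 0 < h < d1 /\ 0 < h < d2 by move: hd; rewrite -/h lt_min h0 => /andP[].
have nh : n%:R * h = t by rewrite mulrC divfK ?lt0r_neq0.
pose T i := E (fun eta => S (i%:R * h) f eta * S ((n - i)%:R * h) f' eta).
have T0 : E (fun eta => f eta * S t f' eta) = T 0%N.
  by apply: eq_Ex => eta; rewrite mul0r subn0 nh (semigroup0 MS).
have Tn : E (fun eta => S t f eta * f' eta) = T n.
  by apply: eq_Ex => eta; rewrite subnn mul0r nh (semigroup0 MS).
rewrite T0 Tn -(telescope_sumr T)//.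
apply: le_trans (ler_norm_sum _ _ _) _.
have -> : 2 * t * M * e = \sum_(0 <= i < n) (h * e * M + M * (h * e)).
  by rewrite sumr_const_nat subn0 -mulr_natl -nh; ring.
rewrite big_seq [leRHS]big_seq; apply: ler_sum => i.
rewrite mem_index_iota => /andP[_ lt_in].
pose s := i%:R * h; pose s' := (n - i.+1)%:R * h.
have s0 : 0 <= s by rewrite mulr_ge0// ltW.
have s'0 : 0 <= s' by rewrite mulr_ge0// ltW.
pose a := S s f; pose b := S s' f'.
pose a1 := S s g; pose b1 := S s' g'.
have ga : gen a a1 := generator_semigroup hS fg s0.
have gb : gen b b1 := generator_semigroup hS fg' s'0.
have [ca ca1 _] := ga; have [cb cb1 _] := gb.
have csh : continuous (S (s + h) f).
  by apply: (semigroup_cont MS) => //; rewrite addr_ge0// ltW.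
have csh' : continuous (S (s' + h) f').
  by apply: (semigroup_cont MS) => //; rewrite addr_ge0// ltW.
have [ba ba1 bsh] := And3 (continuous_bm ca) (continuous_bm ca1) (continuous_bm csh).
have [bb bb1 bsh'] := And3 (continuous_bm cb) (continuous_bm cb1) (continuous_bm csh').
have [bab ba1b bab1] := And3 (bmM ba bb) (bmM ba1 bb) (bmM ba bb1).
have [bshb bash'] := (bmM bsh bb, bmM ba bsh').
have -> : T i.+1 = E (fun eta => S (s + h) f eta * b eta).
  by apply: eq_Ex => eta; rewrite -natr1 mulrDl mul1r.
have -> : T i = E (fun eta => a eta * S (s' + h) f' eta).
  apply: eq_Ex => eta; rewrite -(subnSK lt_in).
  by rewrite -natr1 mulrDl mul1r.
have -> : E (fun eta => S (s + h) f eta * b eta) - E (fun eta => a eta * S (s' + h) f' eta) =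
   E (fun eta => (S (s + h) f eta - a eta - h * a1 eta) * b eta) -
   E (fun eta => a eta * (S (s' + h) f' eta - b eta - h * b1 eta)).
  have eq1 : E (fun eta => (S (s + h) f eta - a eta - h * a1 eta) * b eta) =
      E (fun eta => S (s + h) f eta * b eta) - E (fun eta => a eta * b eta)
      - h * E (fun eta => a1 eta * b eta).
    rewrite -ExZ// -ExB// -ExB//; [|exact: bmB|exact: bmZ].
    by apply: eq_Ex => eta; ring.
  have eq2 : E (fun eta => a eta * (S (s' + h) f' eta - b eta - h * b1 eta)) =
      E (fun eta => a eta * S (s' + h) f' eta) - E (fun eta => a eta * b eta)
      - h * E (fun eta => a eta * b1 eta).
    rewrite -ExZ// -ExB// -ExB//; [|exact: bmB|exact: bmZ].
    by apply: eq_Ex => eta; ring.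
  by rewrite eq1 eq2 (generator_sym ga gb); ring.
apply: le_trans (ler_normB _ _) _; apply: lerD; apply: Ex_norm_le.
- by apply: bmM => //; apply: bmB; [exact: bmB|exact: bmZ].
- move=> eta; rewrite normrM ler_pM//; first exact: dF1.
  by apply: (semigroup_contract hS) => // xi; case: (fM xi).
- by apply: bmM => //; apply: bmB; [exact: bmB|exact: bmZ].
- move=> eta; rewrite normrM ler_pM//; last exact: dF2.
  by apply: (semigroup_contract hS) => // xi; case: (fM xi).
Qed.

(** Symmetry against the constant 1, which S t fixes. *)
Lemma semigroup_invariant (t : R) f g : 0 <= t -> gen f g -> E (S t f) = E f.
Proof.
move=> t0 fg; have gen1 := local_generator hS (local_cst 1).
have := semigroup_sym t0 fg gen1; rewrite (semigroup1 MS)//.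
by under eq_Ex do rewrite mulr1; move=> ->; apply: eq_Ex => eta; rewrite mulr1.
Qed.

(** * Time correlations *)

Section Correlation.
Variables (V : Omega -> R) (lV : local V).

Definition correlation (t : R) := E (fun eta => V eta * S t V eta).

Let genV := local_generator hS lV.
Let cV := local_continuous lV.

Lemma correlationD (s t : R) : 0 <= s -> 0 <= t ->
  E (fun eta => S s V eta * S t V eta) = correlation (s + t).
Proof.
move=> s0 t0; have := semigroup_sym s0 genV (generator_semigroup hS genV t0).
by rewrite -(semigroupD MS).
Qed.

(** By symmetry it is the squared norm of S_(t/2) V. *)
Lemma correlation_ge0 (t : R) : 0 <= t -> 0 <= correlation t.
Proof.
move=> t0; have t20 : 0 <= t / 2 by rewrite divr_ge0.
rewrite (splitr t) -correlationD//; apply: Ex_ge0 => eta.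
by rewrite -expr2 sqr_ge0.
Qed.

(* With u = h sum_{j < m} S_{jh} V one has L u = S_{mh} V - V up to a small
   error, so the Dirichlet form of u is at most <V, u> since the correlations
   are nonnegative; the energy bound then controls <V, u> by itself. *)
Lemma correlation_sum_le (M K : R) : (forall eta, `|V eta| <= M) ->
  energy_bound r nub V K -> forall e : R, 0 < e ->
  exists2 d : R, 0 < d & forall (h : R) m, 0 < h < d ->
    h * \sum_(j <- iota 0 m) correlation (j%:R * h) <=
    4 * K ^+ 2 + (m%:R * h) ^+ 2 * M * e.
Proof.
move=> VM EB e e0; have [d d0 dF] := generator_step hS genV e0.
exists d => // h m hd; have h0 : 0 < h by case/andP: hd.
have jh j : 0 <= j%:R * h by rewrite mulr_ge0// ltW.
have M0 : 0 <= M := le_trans (normr_ge0 _) (VM point).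
pose s := iota 0 m.
pose u eta := h * \sum_(j <- s) S (j%:R * h) V eta.
pose w eta := h * \sum_(j <- s) S (j%:R * h) (gasL r V) eta.
have uw : gen u w.
  by apply: (generatorZ hS); apply: (generator_sum hS) => j; exact: (generator_semigroup hS).
have [cu cw _] := uw.
have bS j : bm (S (j%:R * h) V) by apply: continuous_bm; exact: (semigroup_cont MS).
have bSm : bm (S (m%:R * h) V) := bS m.
have [bu bw bV] := And3 (continuous_bm cu) (continuous_bm cw) (local_bm lV).
pose A := h * \sum_(j <- s) correlation (j%:R * h).
have AE : E (fun eta => V eta * u eta) = A.
  rewrite /A -Ex_sum; last by move=> j; apply: bmM.
  rewrite -ExZ; last by apply: bm_sum => j; exact: bmM.
  by apply: eq_Ex => eta; rewrite /u mulrCA; congr (_ * _); rewrite mulr_sumr.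
have A0 : 0 <= A.
  by rewrite mulr_ge0 ?(ltW h0)// sumr_ge0// => j _; exact: correlation_ge0.
have uSm : 0 <= E (fun eta => u eta * S (m%:R * h) V eta).
  have -> : E (fun eta => u eta * S (m%:R * h) V eta) =
     h * \sum_(j <- s) correlation (j%:R * h + m%:R * h).
    rewrite (eq_bigr (fun j => E (fun eta => S (j%:R * h) V eta * S (m%:R * h) V eta))).
      rewrite -Ex_sum; last by move=> j; exact: bmM.
      rewrite -ExZ; last by apply: bm_sum => j; exact: bmM.
      by apply: eq_Ex => eta; rewrite /u -mulrA mulr_suml.
    by move=> j _; rewrite correlationD.
  by rewrite mulr_ge0 ?(ltW h0)// sumr_ge0// => j _; rewrite correlation_ge0// addr_ge0.
have sumc (c : R) : \sum_(j <- s) c = m%:R * c.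
  by rewrite big_const_seq count_predT size_iota iter_addr_0 mulr_natl.
have uM eta : `|u eta| <= m%:R * h * M.
  rewrite normrM (gtr0_norm h0) [m%:R * h]mulrC -mulrA ler_wpM2l ?(ltW h0)// -sumc.
  apply: le_trans (ler_norm_sum _ _ _) _; apply: ler_sum => j _.
  exact: (semigroup_contract hS).
(* Discretization error in S_(mh) V - V = h sum_(j < m) S_(jh) L V; it is a sum of m one-step
   errors, each at most h e. *)
pose err eta := S (m%:R * h) V eta - V eta - w eta.
have berr : bm err by do 2 apply: bmB => //.
have errM eta : `|err eta| <= m%:R * h * e.
  have -> : err eta = \sum_(j <- s)
     (S (j%:R * h + h) V eta - S (j%:R * h) V eta - h * S (j%:R * h) (gasL r V) eta).
    rewrite sumrB -mulr_sumr; congr (_ - _).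
    rewrite /s -[m in iota 0 m]subn0 -/(index_iota 0 m).
    rewrite (eq_bigr (fun j : nat => S (j.+1%:R * h) V eta - S (j%:R * h) V eta)).
      rewrite (telescope_sumr (fun j : nat => S (j%:R * h) V eta))//.
      by rewrite mul0r (semigroup0 MS).
    by move=> j _; rewrite -natr1 mulrDl mul1r.
  rewrite -mulrA -sumc; apply: le_trans (ler_norm_sum _ _ _) _.
  by apply: ler_sum => j _; exact: dF.
have duw : - E (fun eta => u eta * w eta) <= A + (m%:R * h) ^+ 2 * M * e.
  have -> : E (fun eta => u eta * w eta) =
      E (fun eta => u eta * S (m%:R * h) V eta) - A - E (fun eta => u eta * err eta).
    have [b1 b2 b3] := And3 (bmM bu bSm) (bmM bV bu) (bmM bu berr).
    rewrite -AE -ExB// -ExB//; last exact: bmB.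
    by apply: eq_Ex => eta; rewrite /err; ring.
  have : `|E (fun eta => u eta * err eta)| <= m%:R * h * M * (m%:R * h * e).
    by apply: Ex_norm_le => [|eta]; [exact: bmM|rewrite normrM ler_pM].
  have -> : m%:R * h * M * (m%:R * h * e) = (m%:R * h) ^+ 2 * M * e by ring.
  rewrite ler_norml => /andP[_ errB].
  have key (x y z b : R) : 0 <= x -> z <= b -> - (x - y - z) <= y + b by lra.
  exact: key.
have [_ K0 _] := EB.
rewrite -/A; set B := (_ * _) ^+ 2 * M * e in duw *.
have B0 : 0 <= B by rewrite /B mulr_ge0 ?(ltW e0)// mulr_ge0// sqr_ge0.
have H a : 0 < a -> A <= K * (a + a^-1 * (A + B)).
  move=> a0; rewrite -[leLHS]AE; apply: le_trans (energy_bound_generator EB uw a0) _.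
  have a'0 : 0 <= a^-1 by rewrite invr_ge0 ltW.
  by rewrite ler_wpM2l// lerD2l -mulrN ler_wpM2l.
(* The choice a = 2 K made below requires K > 0; if K = 0, the value a = 1 already gives A <= 0. *)
have [K00|K00] := eqVneq K 0.
  have := H 1 ltr01; rewrite K00 !mul0r expr0n mulr0 add0r => A00.
  exact: le_trans A00 B0.
have Kp : 0 < K by rewrite lt0r K00.
have K2 : 0 < 2 * K by rewrite mulr_gt0.
(* At a = 2 K the right-hand side contains A / 2, which is absorbed on the left and leaves A <= 4
   K^2 + B. *)
have := H _ K2.
have -> : K * (2 * K + (2 * K)^-1 * (A + B)) = 2 * K ^+ 2 + (A + B) / 2 by field.
by clearbody A B; lra.
Qed.

End Correlation.
End Reversibility.

(** * Time integrals along the process *)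

Section RiemannSums.
Context {R : realType}.

(* Right endpoints, because the paths are right-continuous. *)
Definition riemann_sum (F : R -> R) (t : R) (n : nat) : R :=
  t / n.+1%:R * \sum_(i <- iota 0 n.+1) F (i.+1%:R * (t / n.+1%:R)).

Lemma riemann_sum_le (F : R -> R) (t M : R) n : 0 <= t ->
  (forall s : R, 0 <= s -> `|F s| <= M) -> `|riemann_sum F t n| <= t * M.
Proof.
move=> t0 FM; have h0 : 0 <= t / n.+1%:R by rewrite divr_ge0.
rewrite normrM (ger0_norm h0).
apply: (@le_trans _ _ (t / n.+1%:R * \sum_(i <- iota 0 n.+1) M)).
  rewrite ler_wpM2l//; apply: le_trans (ler_norm_sum _ _ _) _.
  by apply: ler_sum => i _; apply: FM; rewrite mulr_ge0.
rewrite big_const_seq count_predT size_iota iter_addr_0 -[M *+ _]mulr_natl mulrA divfK.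
  by [].
by rewrite pnatr_eq0.
Qed.

(** The sum is the integral of the step function [F_ n] with the value at the right endpoint on each
    cell. For fixed s these endpoints approach s from the right, so right-continuity gives pointwise
    convergence, and the bound M convergence of the integrals. *)
Lemma riemann_sum_cvg (F : R -> R) (t M : R) : 0 < t ->
  (forall s : R, 0 <= s -> `|F s| <= M) ->
  (forall s : R, 0 <= s -> F u @[u --> s^'+] --> F s) ->
  riemann_sum F t n @[n --> \oo] --> \int[lebesgue_measure]_(s in `[0, t]) F s.
Proof.
move=> t0 FM Frc; pose D : set R := `]0, t]%classic.
have mD : measurable D by exact: measurable_itv.
have muD : (lebesgue_measure D < +oo)%E.
  by rewrite lebesgue_measure_itv/= lte_fin t0 ltry.
pose h n : R := t / n.+1%:R.
have h0 n : 0 < h n by rewrite divr_gt0.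
have hn n : n.+1%:R * h n = t by rewrite mulrC divfK// pnatr_eq0.
pose A n i : set R := `]i%:R * h n, i.+1%:R * h n]%classic.
pose F_ n (s : R) := \sum_(i <- iota 0 n.+1) F (i.+1%:R * h n) * \1_(A n i) s.
have cellP n (s : R) : 0 < s <= t -> exists2 i, (i < n.+1)%N &
    i%:R * h n < s <= i.+1%:R * h n.
  move=> /andP[s0 st]; have ex : exists j : nat, s <= j%:R * h n.
    by exists n.+1; rewrite hn.
  case: (ex_minnP ex) => -[|i] hi imin; first by move: hi; rewrite mul0r leNgt s0.
  exists i; first by have := imin n.+1; rewrite hn => /(_ st).
  by rewrite hi andbT ltNge; apply/negP => /imin; rewrite ltnn.
have F_E n s i : (i < n.+1)%N -> i%:R * h n < s <= i.+1%:R * h n ->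
    F_ n s = F (i.+1%:R * h n).
  move=> lt_in si; rewrite /F_ (bigD1_seq i) ?mem_iota ?iota_uniq//=.
  rewrite big1 ?addr0 => [|j ji].
    by rewrite indicE mem_set ?mulr1// /A /= in_itv.
  rewrite indicE memNset ?mulr0// /A /= in_itv/= => /andP[sj1 sj2].
  case/andP: si => si1 si2.
  have := lt_le_trans si1 sj2; have := lt_le_trans sj1 si2.
  rewrite !ltr_pM2r// !ltr_nat !ltnS => h1 h2.
  by case/negP: ji; rewrite eqn_leq h1 h2.
have F_M n s : D s -> `|F_ n s| <= M.
  rewrite /D/= in_itv/= => st; have [i lt_in si] := cellP n s st.
  by rewrite (F_E _ _ _ lt_in si) FM// mulr_ge0// ltW.
have mF_ n : measurable_fun D (F_ n).
  apply: measurable_funTS; apply: measurable_sum => i.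
  by apply: measurable_funM => //; apply: measurable_indic; exact: measurable_itv.
have F_cvg s : D s -> F_ n s @[n --> \oo] --> F s.
  rewrite /D/= in_itv/= => st; have /andP[s0 _] := st.
  apply/cvgrPdist_lt => e e0.
  have /cvgrPdist_lt/(_ e e0)[d /= d0 dF] := Frc s (ltW s0).
  have : h n @[n --> \oo] --> 0.
    rewrite -[X in _ --> X](mulr0 t); apply: cvgMr; exact: cvg_harmonic.
  move=> /cvgrPdist_lt/(_ d d0)[N _ hN]; exists N => // n /= Nn.
  have [i lt_in si] := cellP n s st; rewrite (F_E _ _ _ lt_in si).
  (* If s is itself an endpoint the value is exact; the case is treated apart because the one-sided
     limit excludes s. *)
  have /andP[si1 si2] := si; move: si2; rewrite le_eqVlt => /orP[/eqP <-|si2].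
    by rewrite subrr normr0.
  apply: dF => //=; rewrite ltr0_norm ?subr_lt0// opprB.
  have := hN n Nn; rewrite /= sub0r normrN gtr0_norm// => hd.
  by rewrite -natr1 mulrDl mul1r in si2 *; lra.
have [mF FMl cvF] := @bounded_Rintegral_cvg _ _ _ lebesgue_measure D F_ F M
  mD muD mF_ F_M F_cvg.
have intF : lebesgue_measure.-integrable D (EFin \o F).
  apply: measurable_bounded_integrable => //.
  by exists M; split; rewrite ?num_real// => x Mx w Dw; exact: le_trans (FMl w Dw) (ltW Mx).
rewrite -Rintegral_itv_obnd_cbnd//.
suff F_int n : \int[lebesgue_measure]_(s in D) F_ n s = riemann_sum F t n.
  by under eq_fun do rewrite -F_int.
have intA i (c : R) :
    lebesgue_measure.-integrable D (EFin \o (fun s => c * \1_(A n i) s)).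
  apply: measurable_bounded_integrable => //.
    apply: measurable_funTS; apply: measurable_funM => //.
    by apply: measurable_indic; exact: measurable_itv.
  exists `|c|; split; rewrite ?num_real// => x Mx w _; apply: le_trans (ltW Mx).
  by rewrite normrM indicE -[leRHS]mulr1 ler_wpM2l//; case: (_ \in _); rewrite ?normr1 ?normr0.
have int1 i : lebesgue_measure.-integrable D (EFin \o \1_(A n i)).
  have := intA i 1; rewrite (_ : (fun s => 1 * \1_(A n i) s) = \1_(A n i))//.
  by apply/funext => s; rewrite mul1r.
have intS (q : seq nat) : lebesgue_measure.-integrable D
    (EFin \o (fun s => \sum_(i <- q) F (i.+1%:R * h n) * \1_(A n i) s)).
  elim: q => [|i q IH].
    rewrite (_ : _ \o _ = fun=> 0%E); first exact: integrable0.
    by apply/funext => s /=; rewrite big_nil.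
  pose a (s : R) := F (i.+1%:R * h n) * \1_(A n i) s.
  pose b (s : R) := \sum_(j <- q) F (j.+1%:R * h n) * \1_(A n j) s.
  rewrite (_ : _ \o _ = ((EFin \o a) \+ (EFin \o b))%E).
    by apply: integrableD => //; exact: intA.
  by apply/funext => s /=; rewrite big_cons EFinD.
have int_sum (q : seq nat) : {subset q <= iota 0 n.+1} ->
    \int[lebesgue_measure]_(s in D) (\sum_(i <- q) F (i.+1%:R * h n) * \1_(A n i) s) =
    \sum_(i <- q) F (i.+1%:R * h n) * h n.
  elim: q => [|i q IH] qn.
    by rewrite big_nil; under eq_Rintegral do rewrite big_nil; rewrite Rintegral_cst// mul0r.
  under eq_Rintegral do rewrite big_cons.
  rewrite big_cons RintegralD// IH; last by move=> j jq; apply: qn; rewrite inE jq orbT.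
  congr (_ + _); rewrite RintegralZl//.
  congr (_ * _); rewrite /Rintegral integral_indic//; last exact: measurable_itv.
  have -> : A n i `&` D = A n i.
    have : i \in iota 0 n.+1 by apply: qn; rewrite inE eqxx.
    rewrite mem_iota add0n => /= lt_in.
    apply: setIidl => s; rewrite /A /D /= !in_itv/= => /andP[s1 s2]; apply/andP; split.
      by apply: le_lt_trans s1; rewrite mulr_ge0// ltW.
    by apply: le_trans s2 _; rewrite -(hn n) ler_pM2r// ler_nat.
  have leb : (lebesgue_measure (A n i) = (h n)%:E)%E.
    rewrite lebesgue_measure_itv/= lte_fin ltr_pM2r// ltr_nat ltnSn/= -EFinB.
    by congr EFin; rewrite -natr1; ring.
  exact: (congr1 fine leb).
rewrite int_sum// /riemann_sum -/(h n) mulr_sumr; apply: eq_bigr => i _.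
by rewrite mulrC.
Qed.

End RiemannSums.

(** * Stationarity and two-time expectations of the process *)

Section Process.
Context {R : realType}.
Variables (r : Omega -> R) (hr : interaction_rate r).
Variables (rho : R) (nub : probability Omega R).
Hypothesis hnub : bernoulli_product rho nub.
Context d (T : measurableType d) (P : probability T R).
Variable eta : R -> {RV P >-> Omega}.
Hypothesis Heta : lattice_gas r nub eta.
Variable S : R -> (Omega -> R) -> Omega -> R.
Hypothesis hS : gas_semigroup r S.
Hypothesis hmarkov : forall (s t : R) f (A : set T), 0 <= s -> 0 <= t ->
  continuous f -> history eta s A ->
  (\int[P]_(w in A) (f (eta (s + t) w))%:E = \int[P]_(w in A) (S t f (eta s w))%:E)%E.

Local Notation E := (Ex nub).

Lemma bm_process (g : Omega -> R) s : bm g -> bm (fun w => g (eta s w)).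
Proof.
move=> [mg [M gM]]; split; last by exists M.
by apply: measurableT_comp => //; exact: measurable_funPT.
Qed.

Lemma Ex_process0 g : bm g -> Ex P (fun w => g (eta 0 w)) = E g.
Proof.
move=> bg; apply: EFin_inj; rewrite -!ExE//; last exact: bm_process.
rewrite -(integral_distribution (X := eta 0) (f := EFin \o g)).
- by apply: eq_measure_integral => A mA _; exact: (gas_init Heta).
- by apply/measurable_EFinP; case: bg.
- by apply: bm_integrable => //; exact: (bm_process 0 bg).
Qed.

(** The Markov property at time 0 on the whole sample space, followed by invariance of the Bernoulli
    measure under the semigroup. *)
Lemma Ex_process_local g s : 0 <= s -> local g -> Ex P (fun w => g (eta s w)) = E g.
Proof.
move=> s0 lg; have cg := local_continuous lg.
have cSg := semigroup_cont hS.1 s0 cg.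
rewrite -(semigroup_invariant hr hnub hS s0 (local_generator hS lg)).
rewrite -Ex_process0; last exact: continuous_bm.
apply: EFin_inj; rewrite -!ExE; try by apply: bm_process; exact: continuous_bm.
have := @hmarkov 0 s g setT (lexx _) s0 cg; rewrite add0r; apply.
by rewrite -setC0 -setTD; apply: sigma_algebraCD; exact: sigma_algebra0.
Qed.

(** The extension to continuous functions serves the product of V and S_t V, which need not be
    local. *)
Lemma Ex_process g s : 0 <= s -> continuous g -> Ex P (fun w => g (eta s w)) = E g.
Proof.
move=> s0 cg; have [mg [M gM]] := continuous_bm cg.
pose g_ n xi := g (truncate n xi).
have lg n : local (g_ n) by exact: local_truncate.
have g_cvg xi : g_ n xi @[n --> \oo] --> g xi.
  by apply: continuous_cvg; [exact: cg | exact: truncate_cvg].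
have [_ cv1] := @Ex_dct _ _ _ nub g_ g M (fun n => local_bm (lg n))
  (fun n xi => gM _) g_cvg.
have [_ cv2] := @Ex_dct _ _ _ P (fun n w => g_ n (eta s w)) (fun w => g (eta s w)) M
  (fun n => bm_process s (local_bm (lg n))) (fun n w => gM _) (fun w => g_cvg _).
have eqE : (fun n => Ex P (fun w => g_ n (eta s w))) = fun n => E (g_ n).
  by apply/funext => n; exact: Ex_process_local.
have {}cv2 : Ex P (fun w => g_ n (eta s w)) @[n --> \oo] -->
  Ex P (fun w => g (eta s w)) := cv2.
by rewrite eqE in cv2; exact: cvg_unique cv2 cv1.
Qed.

Lemma Ex_markov_local V g s t : 0 <= s -> 0 <= t -> local V -> continuous g ->
  Ex P (fun w => V (eta s w) * g (eta (s + t) w)) =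
  Ex P (fun w => V (eta s w) * S t g (eta s w)).
Proof.
(* At density 0 the monomials are indicators of cylinders, to which the Markov
   property applies directly. *)
move=> s0 t0 lV cg; have [L _ VL] := local_expansion 0 lV.
have cSg := semigroup_cont hS.1 t0 cg.
have bg := bm_process (s + t) (continuous_bm cg).
have bSg := bm_process s (continuous_bm cSg).
pose m (q : seq int) (xi : Omega) : R := \prod_(x <- q) bar 0 x xi.
have lm q : local (m q) by exact: local_monomial.
have bmm q := bm_process s (local_bm (lm q)).
pose B (q : seq int) : set Omega := m q @^-1` [set 1].
have mB q : measurable (B q).
  by rewrite /B -[X in measurable X]setTI; have [+ _] := local_bm (lm q); apply.
have mE q xi : m q xi = \1_(B q) xi.
  rewrite indicE; case: (boolP (xi \in B q)); first by rewrite inE.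
  rewrite notin_setE /B /m /=; elim: q => [|x q IH]; first by rewrite big_nil.
  have bE : bar (0 : R) x xi = (xi x)%:R by rewrite /bar subr0.
  rewrite big_cons bE; case: (xi x); last by rewrite mul0r.
  by rewrite mul1r => /IH.
have key q (X : T -> R) : bm X -> Ex P (fun w => m q (eta s w) * X w) =
    fine (\int[P]_(w in eta s @^-1` B q) (X w)%:E)%E.
  move=> bX; rewrite /Ex -/(Rintegral P _ X) [RHS]Rintegral_mkcond.
  congr Rintegral; apply/funext => w; rewrite mE patchE indicE.
  have -> : (eta s w \in B q) = (w \in eta s @^-1` B q) by apply/idP/idP; rewrite !inE.
  by case: ifP => _; rewrite ?mul1r ?mul0r.
have expandE (X : T -> R) : bm X -> Ex P (fun w => V (eta s w) * X w) =
    \sum_(cs <- L) cs.1 * Ex P (fun w => m cs.2 (eta s w) * X w).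
  move=> bX.
  rewrite (eq_Ex _ (Y := fun w => \sum_(cs <- L) cs.1 * (m cs.2 (eta s w) * X w))).
    rewrite Ex_sum; last by move=> cs; apply: bmZ; exact: bmM.
    by apply: eq_bigr => cs _; rewrite ExZ//; exact: bmM.
  move=> w; rewrite VL /monomial_sum mulr_suml; apply: eq_bigr => cs _.
  by rewrite mulrA.
rewrite !expandE//; apply: eq_bigr => cs _; congr (_ * _).
rewrite !key//; congr fine; apply: hmarkov => //.
apply: sub_gen_smallest; exists s; first by rewrite /= in_itv/= s0 lexx.
by exists (B cs.2) => //; rewrite setTI.
Qed.

Lemma Ex_two_times V s t : 0 <= s -> 0 <= t -> local V ->
  Ex P (fun w => V (eta s w) * V (eta (s + t) w)) = correlation nub S V t.
Proof.
move=> s0 t0 lV; rewrite Ex_markov_local//; last exact: local_continuous.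
apply: (Ex_process (g := fun xi => V xi * S t V xi)) => //.
apply: continuousMf; first exact: local_continuous.
by apply: (semigroup_cont hS.1) => //; exact: local_continuous.
Qed.

End Process.

Lemma sqr_sum_le (R : realType) (n : nat) (x : nat -> R) :
  (\sum_(i <- iota 0 n) x i) ^+ 2 <= n%:R * \sum_(i <- iota 0 n) x i ^+ 2.
Proof.
elim: n => [|n IH]; first by rewrite !big_nil expr0n mul0r.
rewrite -[in iota _ _]addn1 iotaD !big_cat !big_seq1 /= add0n -natr1.
set T := \sum_(i <- _) x i in IH *; set Q := \sum_(i <- _) x i ^+ 2 in IH *.
have [n0|n0] := posnP n.
  move: IH; rewrite n0 !mul0r add0r mul1r => T0.
  have -> : T = 0 by apply/eqP; rewrite -sqrf_eq0 eq_le T0 sqr_ge0.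
  rewrite add0r lerDr; apply: sumr_ge0 => i _; exact: sqr_ge0.
rewrite -subr_ge0 -(pmulr_rge0 _ (_ : 0 < n%:R)) ?ltr0n//.
have -> : n%:R * ((n%:R + 1) * (Q + x n ^+ 2) - (T + x n) ^+ 2) =
  (n%:R + 1) * (n%:R * Q - T ^+ 2) + (T - n%:R * x n) ^+ 2 by ring.
by rewrite addr_ge0 ?sqr_ge0// mulr_ge0// ?subr_ge0// addr_ge0.
Qed.

(** * Second moments of time integrals *)

Section AdditiveFunctionals.
Context {R : realType}.
Variables (r : Omega -> R) (hr : interaction_rate r).
Variables (rho : R) (nub : probability Omega R).
Hypothesis hnub : bernoulli_product rho nub.
Context d (T : measurableType d) (P : probability T R).
Variable eta : R -> {RV P >-> Omega}.
Hypothesis Heta : lattice_gas r nub eta.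

Local Notation E := (Ex nub).

(** With c_j the correlation at lag j h, the last time adds c_0 + 2 sum_(1 <= j <= n) c_j. As c_0 >=
    0, this is at most twice the sum over 0 <= j <= n, so h^2 times it is at most 2 h B. *)
Lemma Ex_sum_sqr_le S (V : Omega -> R) (h B : R) n : gas_semigroup r S ->
  (forall (s t : R) f (A : set T), 0 <= s -> 0 <= t -> continuous f ->
     history eta s A ->
     (\int[P]_(w in A) (f (eta (s + t) w))%:E = \int[P]_(w in A) (S t f (eta s w))%:E)%E) ->
  local V -> 0 <= h ->
  (forall m, (m <= n)%N -> h * \sum_(j <- iota 0 m) correlation nub S V (j%:R * h) <= B) ->
  h ^+ 2 * Ex P (fun w => (\sum_(i <- iota 0 n) V (eta (i.+1%:R * h) w)) ^+ 2) <=
  2 * (n%:R * h) * B.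
Proof.
move=> hS hm lV h0; elim: n => [|n IH] hB.
  rewrite (eq_Ex _ (Y := fun=> 0)) ?Ex_cst ?mulr0 ?mul0r ?mulr0 ?mul0r// => w.
  by rewrite big_nil expr0n.
have {}IH := IH (fun m mn => hB m (leqW mn)).
have bX i : bm (fun w => V (eta (i%:R * h) w)) by exact: (bm_process eta _ (local_bm _)).
pose Tn w := \sum_(i <- iota 0 n) V (eta (i.+1%:R * h) w).
have bT : bm Tn by apply: bm_sum => i.
have bT2 : bm (fun w => Tn w ^+ 2) by exact: bmX.
have bXT : bm (fun w => V (eta (n.+1%:R * h) w) * Tn w) by exact: bmM.
(* The square of the last term is written with times s and s + 0, so that it becomes a correlation
   at lag 0. *)
have bX2 : bm (fun w => V (eta (n.+1%:R * h) w) * V (eta (n.+1%:R * h + 0) w)).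
  by rewrite addr0; exact: bmM.
rewrite (eq_Ex _ (Y := fun w => Tn w ^+ 2 + (2 * (V (eta (n.+1%:R * h) w) * Tn w)
   + V (eta (n.+1%:R * h) w) * V (eta (n.+1%:R * h + 0) w)))); last first.
  move=> w; rewrite -[in iota _ _]addn1 iotaD big_cat big_seq1 /= add0n -/(Tn w) addr0.
  by ring.
rewrite ExD//; last by apply: bmD => //; exact: bmZ.
rewrite ExD//; last exact: bmZ.
rewrite ExZ//.
have nh k : 0 <= k%:R * h by rewrite mulr_ge0.
rewrite (Ex_two_times hr hnub Heta hS hm)//.
pose c j := correlation nub S V (j%:R * h).
have -> : Ex P (fun w => V (eta (n.+1%:R * h) w) * Tn w) = \sum_(j <- iota 1 n) c j.
  rewrite (eq_Ex _ (Y := fun w => \sum_(i <- iota 0 n)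
     (V (eta (i.+1%:R * h) w) * V (eta (n.+1%:R * h) w)))); last first.
    by move=> w; rewrite /Tn mulr_sumr; apply: eq_bigr => i _; rewrite mulrC.
  rewrite Ex_sum; last by move=> i; exact: bmM.
  rewrite (_ : iota 0 n = index_iota 0 n); last by rewrite /index_iota subn0.
  rewrite big_nat_rev (_ : iota 1 n = [seq i.+1 | i <- index_iota 0 n]); last first.
    by rewrite /index_iota subn0 (iotaDl 1 0 n).
  rewrite big_map big_nat [RHS]big_nat; apply: eq_bigr => i /andP[_ lt_in].
  rewrite (_ : n.+1%:R * h = (0 + n - i.+1).+1%:R * h + i.+1%:R * h).
    by rewrite (Ex_two_times hr hnub Heta hS hm).
  by rewrite -mulrDl -natrD; congr (_%:R * _); lia.
have c0 : correlation nub S V 0 = c 0%N by rewrite /c mul0r.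
have c_ge0 j : 0 <= c j by exact: (correlation_ge0 hr hnub hS lV).
have := hB n.+1 (leqnn _); rewrite big_cons -/(c 0%N) -/c c0 => hBn.
have := IH; rewrite -/Tn => {}IH.
rewrite mulrDr -[n.+1%:R]natr1.
have -> : 2 * ((n%:R + 1) * h) * B = 2 * (n%:R * h) * B + 2 * h * B by ring.
apply: lerD => //.
apply: (@le_trans _ _ (2 * h * (h * (c 0%N + \sum_(j <- iota 1 n) c j)))); last first.
  by rewrite ler_wpM2l// mulr_ge0.
rewrite -subr_ge0 [X in 0 <= X](_ : _ = h ^+ 2 * c 0%N); last by ring.
by rewrite mulr_ge0 ?sqr_ge0.
Qed.

(** The constant 16 is 2 * 2 * 4: the splitting of the square of V1 + V2, the two orders of a pair
    of times, and the 4 K^2 of the correlation sum. For V2, Cauchy-Schwarz in time and stationarity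
    give t^2 v, doubled by the splitting. The estimate is made on Riemann sums and passes to the
    integral by bounded convergence. *)
Lemma additive_functional_bound (V V1 V2 : Omega -> R) (K v t : R) :
  V =1 (fun xi => V1 xi + V2 xi) -> energy_bound r nub V1 K -> local V2 ->
  E (fun xi => V2 xi ^+ 2) <= v -> 0 <= t ->
  ('E_P[(fun w : T => (\int[lebesgue_measure]_(s in `[0%R, t]) V (eta s w)) ^+ 2)%R]
   <= (16 * t * K ^+ 2 + 2 * t ^+ 2 * v)%:E)%E.
Proof.
move=> VE EB lV2 Ev t_ge0; have [lV1 K0 _] := EB.
have [S hS hm] := gas_markov Heta.
have lV : local V by move: (localD lV1 lV2); congr local; apply/funext => xi; rewrite VE.
have [_ [M VM]] := local_bm lV; have [_ [M1 V1M]] := local_bm lV1.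
have v0 : 0 <= v by apply: le_trans Ev; apply: Ex_ge0 => xi; exact: sqr_ge0.
rewrite unlock; have [->|t_neq0] := eqVneq t 0.
  under eq_integral do rewrite set_itv1 Rintegral_set1 expr0n/=.
  by rewrite integral0 lee_fin mulr0 mul0r add0r mulr_ge0// mulr_ge0// sqr_ge0.
have t0 : 0 < t by rewrite lt0r t_neq0.
pose X w := \int[lebesgue_measure]_(s in `[0, t]) V (eta s w).
pose X_ n w := riemann_sum (fun s => V (eta s w)) t n.
have X_cvg w : X_ n w @[n --> \oo] --> X w.
  apply: (riemann_sum_cvg (M := M)) => // s s0.
  apply: continuous_cvg; last exact: (gas_cadlag_right Heta).
  exact: (local_continuous lV).
have bV s : bm (fun w => V (eta s w)) by exact: (bm_process eta _ (local_bm _)).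
have bX n : bm (X_ n) by apply: bmZ; apply: bm_sum => i.
have X2_cvg w : X_ n w ^+ 2 @[n --> \oo] --> X w ^+ 2.
  by rewrite expr2; under eq_fun do rewrite expr2; exact: cvgM.
have X2M n w : `|X_ n w ^+ 2| <= (t * M) ^+ 2.
  rewrite normrX lerXn2r ?nnegrE//.
    by rewrite mulr_ge0// (le_trans (normr_ge0 _) (VM point)).
  exact: riemann_sum_le.
have [bX2 cvX2] := @Ex_dct _ _ _ P (fun n w => X_ n w ^+ 2) (fun w => X w ^+ 2) _
  (fun n => bmX 2 (bX n)) X2M X2_cvg.
rewrite ExE// lee_fin.
(* The error e is fixed before the mesh is refined below the threshold [dl] that depends on it; n
   tends to infinity first, then e to 0. *)
apply: (@le_of_le_eps _ _ _ (4 * t ^+ 3 * M1)) => e /andP[e0 _].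
have [dl dl0 hdl] := correlation_sum_le hr hnub hS lV1 V1M EB e0.
have M10 : 0 <= M1 := le_trans (normr_ge0 _) (V1M point).
apply: (closed_cvg _ (@closed_le R _) _ _ cvX2) => //.
have hN : t / n.+1%:R @[n --> \oo] --> 0.
  by rewrite -[X in _ --> X](mulr0 t); apply: cvgMr; exact: cvg_harmonic.
move: hN => /cvgrPdist_lt/(_ dl dl0)[N _ hN]; exists N => // n Nn /=.
pose h : R := t / n.+1%:R.
have h0 : 0 < h by rewrite divr_gt0.
have hd : 0 < h < dl.
  by rewrite h0/=; have := hN n Nn; rewrite /= sub0r normrN gtr0_norm.
have nh : n.+1%:R * h = t by rewrite mulrC divfK// pnatr_eq0.
pose Y (U : Omega -> R) w := \sum_(i <- iota 0 n.+1) U (eta (i.+1%:R * h) w).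
have bY U : local U -> bm (Y U).
  by move=> lU; apply: bm_sum => i; exact: (bm_process eta _ (local_bm _)).
have Y1 : h ^+ 2 * Ex P (fun w => Y V1 w ^+ 2) <= 2 * t * (4 * K ^+ 2 + t ^+ 2 * M1 * e).
  rewrite -{1}nh; apply: (Ex_sum_sqr_le hS hm lV1 (ltW h0)) => m mn.
  apply: le_trans (hdl h m hd) _; rewrite lerD2l ler_wpM2r ?(ltW e0)// ler_wpM2r//.
  rewrite lerXn2r ?nnegrE ?mulr_ge0 ?(ltW h0)// -nh ler_wpM2r ?(ltW h0)//.
  by rewrite ler_nat.
have Y2 : h ^+ 2 * Ex P (fun w => Y V2 w ^+ 2) <= t ^+ 2 * v.
  have bV2 i : bm (fun w => V2 (eta (i.+1%:R * h) w) ^+ 2).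
    by apply: bmX; exact: (bm_process eta _ (local_bm lV2)).
  have bS : bm (fun w => \sum_(i <- iota 0 n.+1) V2 (eta (i.+1%:R * h) w) ^+ 2).
    exact: bm_sum.
  apply: (@le_trans _ _ (h ^+ 2 * (n.+1%:R * \sum_(i <- iota 0 n.+1) v))).
    rewrite ler_wpM2l ?sqr_ge0//.
    apply: (@le_trans _ _ (Ex P (fun w => n.+1%:R *
        \sum_(i <- iota 0 n.+1) V2 (eta (i.+1%:R * h) w) ^+ 2))).
      apply: le_Ex; [exact/bmX/bY|exact: bmZ|] => w.
      exact: (sqr_sum_le _ (fun i => V2 (eta (i.+1%:R * h) w))).
    rewrite ExZ// ler_wpM2l// Ex_sum//; apply: ler_sum => i _.
    rewrite (Ex_process hr hnub Heta hS hm (g := fun xi => V2 xi ^+ 2))//.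
      by rewrite mulr_ge0 ?(ltW h0).
    by apply: local_continuous; exact: localX.
  rewrite big_const_seq count_predT size_iota iter_addr_0 -[v *+ _]mulr_natl -nh.
  by rewrite le_eqVlt; apply/orP; left; apply/eqP; ring.
apply: (@le_trans _ _ (Ex P (fun w =>
    2 * h ^+ 2 * Y V1 w ^+ 2 + 2 * h ^+ 2 * Y V2 w ^+ 2))).
  apply: le_Ex; [exact: bmX|by apply: bmD; apply: bmZ; exact/bmX/bY|] => w.
  rewrite /X_ /riemann_sum -/h.
  have -> : \sum_(i <- iota 0 n.+1) V (eta (i.+1%:R * h) w) = Y V1 w + Y V2 w.
    by rewrite /Y -big_split; apply: eq_bigr => i _; rewrite VE.
  rewrite -subr_ge0 [X in 0 <= X](_ : _ = h ^+ 2 * (Y V1 w - Y V2 w) ^+ 2); last by ring.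
  by rewrite mulr_ge0// sqr_ge0.
rewrite ExD ?ExZ; try (by apply: bmZ; exact/bmX/bY); try exact/bmX/bY.
have : 2 * (h ^+ 2 * Ex P (fun w => Y V1 w ^+ 2)) <=
  2 * (2 * t * (4 * K ^+ 2 + t ^+ 2 * M1 * e)) by rewrite ler_wpM2l.
have : 2 * (h ^+ 2 * Ex P (fun w => Y V2 w ^+ 2)) <= 2 * (t ^+ 2 * v).
  by rewrite ler_wpM2l.
rewrite !mulrA => H2 H1; apply: le_trans (lerD H1 H2) _.
by rewrite le_eqVlt; apply/orP; left; apply/eqP; ring.
Qed.

End AdditiveFunctionals.

(** * Decomposition of local functions *)

Section Families.
Context {R : realType}.
Variables (r : Omega -> R) (hr : interaction_rate r).
Variables (e0 : R) (e0_gt0 : 0 < e0) (re0 : forall eta, e0 <= r eta).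
Variables (rho : R) (nub : probability Omega R).
Hypothesis hnub : bernoulli_product rho nub.
Hypothesis hrho : 0 < rho < 1.
Implicit Types (U V : nat -> Omega -> R) (g : nat -> R) (L : seq (R * seq int)).

Local Notation E := (Ex nub).
Local Notation bar := (bar rho).
Local Notation avg := (avg rho).
Local Notation EB := (energy_bound r nub).
Local Notation block_product := (block_product rho).

(** The constant is uniform in the block length m; such orders are stable under the finite linear
    combinations of a monomial expansion. *)
Definition energy_order U g := exists2 K : R, 0 <= K &
  forall m, (0 < m)%N -> EB (U m) (K * g m).

Definition variance_order U g := exists2 C : R, 0 <= C &
  forall m, (0 < m)%N -> local (U m) /\ E (fun eta => U m eta ^+ 2) <= C * g m.

Lemma energy_orderD U V g : energy_order U g -> energy_order V g ->
  energy_order (fun m eta => U m eta + V m eta) g.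
Proof.
move=> [K K0 UK] [K' K'0 VK]; exists (K + K'); first exact: addr_ge0.
by move=> m m0; rewrite mulrDl; apply: energy_boundD; [exact: UK|exact: VK].
Qed.

Lemma energy_orderZ c U g : energy_order U g ->
  energy_order (fun m eta => c * U m eta) g.
Proof.
move=> [K K0 UK]; exists (`|c| * K); first exact: mulr_ge0.
by move=> m m0; rewrite -mulrA; apply: energy_boundZ; exact: UK.
Qed.

Lemma energy_order0 g : energy_order (fun _ _ => 0) g.
Proof. by exists 0 => // m _; rewrite mul0r; exact: energy_bound0. Qed.

Lemma energy_order_sum L (U : seq int -> nat -> Omega -> R) g :
  (forall cs, cs \in L -> energy_order (U cs.2) g) ->
  energy_order (fun m eta => \sum_(cs <- L) cs.1 * U cs.2 m eta) g.
Proof.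
elim: L => [|cs L IH] UL.
  rewrite (_ : (fun _ _ => _) = fun (_ : nat) (_ : Omega) => 0 : R).
    exact: energy_order0.
  by apply/funext => m; apply/funext => eta; rewrite big_nil.
rewrite (_ : (fun _ _ => _) = fun m eta => cs.1 * U cs.2 m eta
    + \sum_(cs <- L) cs.1 * U cs.2 m eta).
  apply: energy_orderD; first by apply: energy_orderZ; apply: UL; rewrite inE eqxx.
  by apply: IH => cs' cs'L; apply: UL; rewrite inE cs'L orbT.
by apply/funext => m; apply/funext => eta; rewrite big_cons.
Qed.

Lemma le_energy_order U g g' (k : R) : 0 <= k ->
  (forall m, (0 < m)%N -> g m <= k * g' m) ->
  energy_order U g -> energy_order U g'.
Proof.
move=> k0 gg' [K K0 UK]; exists (K * k); first exact: mulr_ge0.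
move=> m m0; apply: (le_energy_bound hr e0_gt0 re0 hnub (UK m m0)).
by rewrite -mulrA ler_wpM2l// gg'.
Qed.

Lemma variance_orderD U V g : variance_order U g -> variance_order V g ->
  variance_order (fun m eta => U m eta + V m eta) g.
Proof.
move=> [C C0 UC] [C' C'0 VC]; exists (2 * C + 2 * C').
  by rewrite addr_ge0// mulr_ge0.
move=> m m0; have [lU EU] := UC m m0; have [lV EV] := VC m m0.
split; first exact: localD.
have [bU bV] := (bmX 2 (local_bm lU), bmX 2 (local_bm lV)).
apply: (@le_trans _ _ (E (fun eta => 2 * U m eta ^+ 2 + 2 * V m eta ^+ 2))).
  apply: le_Ex; [by apply: bmX; apply: local_bm; exact: localD| |].
    by apply: bmD; exact: bmZ.
  move=> eta; rewrite -subr_ge0 [X in 0 <= X](_ : _ = (U m eta - V m eta) ^+ 2).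
    exact: sqr_ge0.
  by ring.
rewrite ExD; [|exact: bmZ|exact: bmZ].
rewrite !ExZ// [leRHS](_ : _ = 2 * (C * g m) + 2 * (C' * g m)); last by ring.
by apply: lerD; rewrite ler_wpM2l.
Qed.

Lemma variance_orderZ c U g : variance_order U g ->
  variance_order (fun m eta => c * U m eta) g.
Proof.
move=> [C C0 UC]; exists (c ^+ 2 * C); first by rewrite mulr_ge0// sqr_ge0.
move=> m m0; have [lU EU] := UC m m0; split; first exact: localZ.
rewrite (eq_Ex _ (Y := fun eta => c ^+ 2 * U m eta ^+ 2)); last first.
  by move=> eta; rewrite exprMn.
rewrite ExZ; last exact: (bmX 2 (local_bm lU)).
by rewrite -mulrA ler_wpM2l// sqr_ge0.
Qed.

Lemma variance_order0 g : (forall m, 0 <= g m) -> variance_order (fun _ _ => 0) g.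
Proof.
move=> g0; exists 0 => // m _; split; first exact: local_cst.
rewrite mul0r (eq_Ex _ (Y := fun=> 0)) ?Ex_cst// => eta.
by rewrite expr0n.
Qed.

Lemma variance_order_sum L (U : seq int -> nat -> Omega -> R) g :
  (forall m, 0 <= g m) ->
  (forall cs, cs \in L -> variance_order (U cs.2) g) ->
  variance_order (fun m eta => \sum_(cs <- L) cs.1 * U cs.2 m eta) g.
Proof.
move=> g0; elim: L => [|cs L IH] UL.
  rewrite (_ : (fun _ _ => _) = fun (_ : nat) (_ : Omega) => 0 : R).
    exact: variance_order0.
  by apply/funext => m; apply/funext => eta; rewrite big_nil.
rewrite (_ : (fun _ _ => _) = fun m eta => cs.1 * U cs.2 m eta
    + \sum_(cs <- L) cs.1 * U cs.2 m eta).
  apply: variance_orderD; first by apply: variance_orderZ; apply: UL; rewrite inE eqxx.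
  by apply: IH => cs' cs'L; apply: UL; rewrite inE cs'L orbT.
by apply/funext => m; apply/funext => eta; rewrite big_cons.
Qed.

Lemma variance_order_block_product k j : (j <= k)%N ->
  variance_order (block_product k) (fun m => (m%:R^-1) ^+ j).
Proof.
move=> jk; exists 1 => // m m0; split; first exact: local_block_product.
have Hk := Ex_block_product2 hnub hrho k m0; apply: le_trans Hk _; rewrite mul1r.
have mV : 0 <= (m%:R^-1 : R) <= 1 by rewrite invr_ge0 ler0n/= invf_le1 ?ler1n ?ltr0n.
by rewrite ler_wiXn2l//; case/andP: mV.
Qed.

(** Absorbs, in the first-order bound, the logarithm due to monomials of degree at least two; it is
    ln x <= x - 1 at x = sqrt m. *)
Lemma ln_sqrt_bound m : (0 < m)%N -> 1 + ln m%:R <= 2 * Num.sqrt m%:R :> R.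
Proof.
move=> m0; have m0' : 0 < m%:R :> R by rewrite ltr0n.
have s0 : 0 < Num.sqrt m%:R :> R by rewrite sqrtr_gt0.
rewrite -{1}(sqr_sqrtr (ltW m0')) lnXn// mulr2n.
have := @le_ln1Dx R (Num.sqrt m%:R - 1).
have -> : 1 + (Num.sqrt m%:R - 1) = Num.sqrt m%:R :> R by ring.
have -> : - 1 < Num.sqrt m%:R - 1 :> R by rewrite ltrBrDr addNr.
by move=> /(_ isT); lra.
Qed.

Lemma energy_order_monomial s : sorted <%R s -> (2 <= size s)%N ->
  energy_order (fun m eta => \prod_(x <- s) bar x eta - block_product (size s) m eta)
    (fun m => 1 + ln m%:R).
Proof.
move=> ss s2; have [K K0 hK] :=
  energy_bound_monomial hr e0_gt0 re0 hnub hrho ss s2.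
by exists K => //; exact: ltW.
Qed.

Lemma energy_order_pair_sum :
  energy_order (fun m eta => (1 - m%:R^-1) * block_product 2 m eta
     - 2 / m%:R ^+ 2 * pair_sum rho m eta) (fun m => 1 + ln m%:R).
Proof.
have [K K0 hK] := energy_bound_pair_sum hr e0_gt0 re0 hnub hrho.
exists K; first exact: ltW.
move=> m m0; have := energy_boundN (hK m m0) => EBm.
apply: energy_bound_ext (le_energy_bound hr e0_gt0 re0 hnub EBm _).
  by move=> eta; rewrite opprB.
by rewrite -[leLHS]mulr1 ler_wpM2l ?(ltW K0)// lerDl ln_ge0// ler1n.
Qed.

(** The linear remainder left by the diagonal of the squared block average. *)
Lemma variance_order_linear :
  variance_order (fun m eta => m%:R^-1 * (1 - 2 * rho) * avg (zone 0 m) eta)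
     (fun m => (m%:R^-1) ^+ 3).
Proof.
exists ((1 - 2 * rho) ^+ 2 * chi rho); first by rewrite mulr_ge0 ?sqr_ge0// chi_ge0.
move=> m m0; have la := local_avg rho (zone 0 m).
split; first exact: localZ.
pose c := m%:R^-1 * (1 - 2 * rho).
rewrite (eq_Ex _ (Y := fun eta => c ^+ 2 * (avg (zone 0 m) eta ^+ 2 * 1))); last first.
  by move=> eta; rewrite -/c exprMn mulr1.
have la2 : local (fun eta => avg (zone 0 m) eta ^+ 2 * 1).
  by apply: localM; [exact: localX|exact: local_cst].
rewrite ExZ; last exact: local_bm.
rewrite (Ex_avg2 hnub) ?uniq_zone ?size_zone//; last exact: local_cst.
by rewrite Ex_cst /c le_eqVlt; apply/orP; left; apply/eqP; ring.
Qed.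

(** The part of the two-block product that the factor 1 - 1 / m of the pair sum misses; its second
    moment is even of order m^(-4). *)
Lemma variance_order_pair :
  variance_order (fun m eta => m%:R^-1 * block_product 2 m eta)
     (fun m => (m%:R^-1) ^+ 3).
Proof.
have [C C0 hC] := variance_order_block_product (leqnn 2); exists C => // m m0.
have [lW EW] := hC m m0; split; first exact: localZ.
rewrite (eq_Ex _ (Y := fun eta => m%:R^-1 ^+ 2 * block_product 2 m eta ^+ 2)); last first.
  by move=> eta; rewrite exprMn.
rewrite ExZ; last by apply: bmX; exact: local_bm.
have mV : 0 <= (m%:R^-1 : R) <= 1 by rewrite invr_ge0 ler0n/= invf_le1 ?ler1n ?ltr0n.
case/andP: mV => mV0 mV1.
apply: (@le_trans _ _ (m%:R^-1 ^+ 2 * (C * m%:R^-1 ^+ 2))).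
  by rewrite ler_wpM2l// exprn_ge0.
rewrite mulrCA ler_wpM2l// -exprD; exact: ler_wiXn2l.
Qed.

Variables (f : Omega -> R) (L : seq (R * seq int)).
Hypothesis fL : f =1 monomial_sum rho L.
Hypothesis sL : forall cs, cs \in L -> sorted <%R cs.2.
Hypothesis L0 : degree_sum L 0 = 0.

Let size1P (s : seq int) : size s = 1%N -> s = [:: head 0 s].
Proof. by case: s => [|x []]. Qed.

(** Degree 0 cancels by [L0], degree 1 is compared with the block average, and from degree 2 on the
    block products left over have second moment at most m^(-2). *)
Lemma first_order_decomposition : exists V1 V2 : nat -> Omega -> R,
  [/\ energy_order V1 (fun m => Num.sqrt m%:R),
      variance_order V2 (fun m => (m%:R^-1) ^+ 2) &
      forall m eta, (0 < m)%N ->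
        f eta - degree_sum L 1 * (block_average m eta - rho) = V1 m eta + V2 m eta].
Proof.
pose U1 (s : seq int) (m : nat) (eta : Omega) : R :=
  if size s == 0%N then 0 else
  if size s == 1%N then \prod_(x <- s) bar x eta - avg (zone 0 m) eta
  else \prod_(x <- s) bar x eta - block_product (size s) m eta.
pose U2 (s : seq int) (m : nat) (eta : Omega) : R :=
  if (size s <= 1)%N then 0 else block_product (size s) m eta.
exists (fun m eta => \sum_(cs <- L) cs.1 * U1 cs.2 m eta).
exists (fun m eta => \sum_(cs <- L) cs.1 * U2 cs.2 m eta).
split.
- apply: energy_order_sum => cs /sL ss; rewrite /U1.
  have [s0|s0] := eqVneq (size cs.2) 0%N; first exact: energy_order0.
  have [s1|s1] := eqVneq (size cs.2) 1%N.
    have [K K0 hK] := energy_bound_site hr e0_gt0 re0 hnub hrho (head 0 cs.2).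
    exists K; first exact: ltW.
    move=> m m0; apply: energy_bound_ext (hK m m0) => eta.
    by rewrite [in RHS](size1P s1) big_seq1.
  apply: (le_energy_order (k := 2) _ ln_sqrt_bound) => //.
  by apply: energy_order_monomial => //; case: (size cs.2) s0 s1 => [|[|]].
- apply: variance_order_sum => [m|cs _]; first by rewrite exprn_ge0// invr_ge0.
  rewrite /U2; case: leqP => s1.
    by apply: variance_order0 => m; rewrite exprn_ge0// invr_ge0.
  exact: variance_order_block_product.
move=> m eta m0; rewrite (block_averageE rho eta m0) fL /monomial_sum.
rewrite -big_split/= -[LHS]subr0 -[X in _ - X = _]L0 /degree_sum.
rewrite !(big_mkcond (fun cs => size cs.2 == _)) mulr_suml -!sumrB.
apply: eq_bigr => cs _; rewrite /U1 /U2.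
case: (size cs.2) (@size0nil _ cs.2) => [/(_ erefl) ->|[_|k _]] /=.
- by rewrite big_nil; ring.
- by ring.
- by ring.
Qed.

(** Monomials of degree one are gathered at the site 0, where their coefficients cancel. In degree 2
    the two-block product is exchanged for the pair sum of the square, up to m^(-1) times itself and
    the diagonal remainder. From degree 3 on the block products go into V2. *)
Lemma second_order_decomposition : degree_sum L 1 = 0 ->
  exists V1 V2 : nat -> Omega -> R,
  [/\ energy_order V1 (fun m => 1 + ln m%:R),
      variance_order V2 (fun m => (m%:R^-1) ^+ 3) &
      forall m eta, (0 < m)%N ->
        f eta - degree_sum L 2 *
          ((block_average m eta - rho) ^+ 2 - chi rho / m%:R) = V1 m eta + V2 m eta].
Proof.
move=> L1.
pose U1 (s : seq int) (m : nat) (eta : Omega) : R :=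
  if size s == 0%N then 0 else
  if size s == 1%N then \prod_(x <- s) bar x eta - bar 0 eta
  else \prod_(x <- s) bar x eta - block_product (size s) m eta.
pose U2 (s : seq int) (m : nat) (eta : Omega) : R :=
  if (size s <= 2)%N then 0 else block_product (size s) m eta.
exists (fun m eta => \sum_(cs <- L) cs.1 * U1 cs.2 m eta + degree_sum L 2 *
  ((1 - m%:R^-1) * block_product 2 m eta - 2 / m%:R ^+ 2 * pair_sum rho m eta)).
exists (fun m eta => \sum_(cs <- L) cs.1 * U2 cs.2 m eta +
  (degree_sum L 2 * (m%:R^-1 * block_product 2 m eta) +
   - degree_sum L 2 * (m%:R^-1 * (1 - 2 * rho) * avg (zone 0 m) eta))).
have g0 m : 0 <= (m%:R^-1) ^+ 3 :> R by rewrite exprn_ge0// invr_ge0.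
split.
- apply: energy_orderD; last by apply: energy_orderZ; exact: energy_order_pair_sum.
  apply: energy_order_sum => cs /sL ss; rewrite /U1.
  have [s0|s0] := eqVneq (size cs.2) 0%N; first exact: energy_order0.
  have [s1|s1] := eqVneq (size cs.2) 1%N.
    have [K K0 hK] := energy_bound_gradient hr e0_gt0 re0 hnub hrho (head 0 cs.2) 0.
    exists K; first exact: ltW.
    move=> m m0; apply: energy_bound_ext (le_energy_bound hr e0_gt0 re0 hnub hK _).
      by move=> eta; rewrite [in RHS](size1P s1) big_seq1.
    by rewrite -[leLHS]mulr1 ler_wpM2l ?(ltW K0)// lerDl ln_ge0// ler1n.
  by apply: energy_order_monomial => //; case: (size cs.2) s0 s1 => [|[|]].
- apply: variance_orderD.
    apply: variance_order_sum => // cs _.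
    rewrite /U2; case: leqP => s1; first exact: variance_order0.
    exact: variance_order_block_product.
  apply: variance_orderD; apply: variance_orderZ.
    exact: variance_order_pair.
  exact: variance_order_linear.
move=> m eta m0; rewrite (block_averageE rho eta m0) (avg_zone0_sqr rho eta m0).
have -> : f eta = \sum_(cs <- L) cs.1 * U1 cs.2 m eta +
    \sum_(cs <- L) cs.1 * U2 cs.2 m eta + degree_sum L 2 * block_product 2 m eta.
  (* Subtracting the vanishing degree sums of orders 1 and 0 makes the identity hold term by term in
     [L]. *)
  rewrite fL; transitivity (monomial_sum rho L eta - degree_sum L 1 * bar 0 eta
      - degree_sum L 0); first by rewrite L1 L0 mul0r !subr0.
  rewrite /monomial_sum /degree_sum !(big_mkcond (fun cs => size cs.2 == _)).
  rewrite !mulr_suml -!sumrB -!big_split/=.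
  apply: eq_bigr => cs _; rewrite /U1 /U2.
  case: (size cs.2) (@size0nil _ cs.2) => [/(_ erefl) ->|[_|[_|k _]]] /=.
  - by rewrite big_nil; ring.
  - by ring.
  - by ring.
  - by ring.
by ring.
Qed.

End Families.

Theorem theorem4p3 (R : realType)
  (r : Omega -> R) (hr : interaction_rate r)
  (nu : R -> probability Omega R)
  (hnu : forall b : R, 0 <= b <= 1 -> bernoulli_product b (nu b))
  (rho : R) (hrho : 0 < rho < 1)
  (f : Omega -> R) (hf : local f) (hphi : phi nu f rho = 0) :
  exists c : R,
    forall (d : measure_display) (T : measurableType d) (P : probability T R)
      (eta : R -> {RV P >-> Omega}),
    lattice_gas r (nu rho) eta ->
    (derive1 (phi nu f) rho <> 0 ->
      forall (t : R) (l : nat), 0 <= t -> (1 <= l)%N ->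
      ('E_P[(fun w : T =>
          (\int[lebesgue_measure]_(s in `[0%R, t])
             (f (eta s w)
              - derive1 (phi nu f) rho * (block_average l (eta s w) - rho))) ^+ 2)%R]
       <= (c * (t * l%:R + t ^+ 2 / l%:R ^+ 2))%:E)%E) /\
    (derive1 (phi nu f) rho = 0 ->
      forall (t : R) (l : nat), 0 <= t -> (1 <= l)%N ->
      ('E_P[(fun w : T =>
          (\int[lebesgue_measure]_(s in `[0%R, t])
             (f (eta s w)
              - derive1 (derive1 (phi nu f)) rho / 2 *
                  ((block_average l (eta s w) - rho) ^+ 2 - chi rho / l%:R))) ^+ 2)%R]
       <= (c * (t * (ln l%:R) ^+ 2 + t ^+ 2 / l%:R ^+ 3))%:E)%E).
Proof.
have [e0 e0_gt0 re] := rate_elliptic hr.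
have re0 xi : e0 <= r xi by case/andP: (re xi).
have rho01 : 0 <= rho <= 1 by case/andP: hrho => *; rewrite !ltW.
have hnub := hnu rho rho01.
have [L sL fL] := local_expansion rho hf.
have L0 : degree_sum L 0 = 0 by rewrite -(phi_degree0 hrho hnu fL sL).
have L1 := phi_degree1 hrho hnu fL sL.
have L2 := phi_degree2 hrho hnu fL sL.
have [V1 [V2 [[K K0 V1K] [C C0 V2C] VE]]] :=
  first_order_decomposition hr e0_gt0 re0 hnub hrho fL sL L0.
pose c1 := 16 * K ^+ 2 + 2 * C.
have c1_ge0 : 0 <= c1 by rewrite addr_ge0 ?mulr_ge0 ?sqr_ge0.
(* The second decomposition requires phi' to vanish at rho, yet the constant is chosen before the
   cases are separated; c2 = 0 is the default when it does not vanish. *)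
have [c2 c2_ge0 hc2] : exists2 c2 : R, 0 <= c2 & degree_sum L 1 = 0 ->
    forall (d : measure_display) (T : measurableType d) (P : probability T R)
      (eta : R -> {RV P >-> Omega}), lattice_gas r (nu rho) eta ->
    forall (t : R) (l : nat), 0 <= t -> (1 <= l)%N ->
    ('E_P[(fun w : T => (\int[lebesgue_measure]_(s in `[0%R, t])
             (f (eta s w) - degree_sum L 2 *
                ((block_average l (eta s w) - rho) ^+ 2 - chi rho / l%:R))) ^+ 2)%R]
     <= (c2 * (t * (ln l%:R) ^+ 2 + t ^+ 2 / l%:R ^+ 3))%:E)%E.
  have [L1_0|] := eqVneq (degree_sum L 1) 0; last by move=> /eqP ?; exists 0.
  have [W1 [W2 [[K' K'0 W1K] [C' C'0 W2C] WE]]] :=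
    second_order_decomposition hr e0_gt0 re0 hnub hrho fL sL L0 L1_0.
  (* The integrand at l = 1. There ln l = 0, so no term linear in t is allowed, and the second
     moment [v] alone gives the bound 2 t^2 v. *)
  pose U xi := f xi - degree_sum L 2 * ((block_average 1 xi - rho) ^+ 2 - chi rho / 1).
  have lU : local U.
    rewrite (_ : U = fun xi => W1 1%N xi + W2 1%N xi).
      by apply: localD; [case: (W1K 1%N isT)|case: (W2C 1%N isT)].
    by apply/funext => xi; rewrite -WE.
  pose v := Ex (nu rho) (fun xi => U xi ^+ 2).
  have v0 : 0 <= v by apply: Ex_ge0 => xi; exact: sqr_ge0.
  have ln2 : 0 < ln 2 :> R by rewrite ln_gt0// ltr1n.
  (* For l >= 2 one has 1 <= ln l / ln 2, hence 1 + ln l <= ((ln 2)^(-1) + 1) ln l. *)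
  pose k := K' * ((ln 2)^-1 + 1).
  exists (2 * v + 16 * k ^+ 2 + 2 * C').
    by do ![exact: sqr_ge0 | by [] | apply: addr_ge0 | apply: mulr_ge0].
  move=> _ d T P eta Heta t l t0 l1.
  have [l2|] := leqP 2 l; last first.
    rewrite ltnS => l1'; have -> : l = 1%N by apply/eqP; rewrite eqn_leq l1 l1'.
    apply: (@le_trans _ _ (16 * t * 0 ^+ 2 + 2 * t ^+ 2 * v)%:E).
      apply: (additive_functional_bound hr hnub Heta (V := U) (V1 := fun=> 0) (V2 := U)) => //.
      - by move=> xi; rewrite add0r.
      - exact: energy_bound0.
    rewrite lee_fin ln1 expr1n divr1 expr0n/= !mulr0 !add0r.
    rewrite [leRHS](_ : _ = 2 * t ^+ 2 * v + (16 * k ^+ 2 + 2 * C') * t ^+ 2); last by ring.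
    rewrite lerDl.
    by do ![exact: sqr_ge0 | by [] | apply: addr_ge0 | apply: mulr_ge0].
  have l0 : (0 < l)%N by exact: ltnW.
  have [lW2 EW2] := W2C l l0.
  apply: le_trans (additive_functional_bound hr hnub Heta (V1 := W1 l) (V2 := W2 l)
     (fun xi => WE l xi l0) (W1K l l0) lW2 EW2 t0) _.
  have lnl : ln 2 <= ln l%:R :> R by rewrite ler_ln ?posrE ?ltr0n ?ler_nat.
  have ln0 : 0 <= ln l%:R :> R by exact: le_trans (ltW ln2) lnl.
  have kl : K' * (1 + ln l%:R) <= k * ln l%:R.
    rewrite -mulrA ler_wpM2l// mulrDl mul1r lerD2r.
    by rewrite mulrC ler_pdivlMr// mul1r.
  have kl2 : (K' * (1 + ln l%:R)) ^+ 2 <= (k * ln l%:R) ^+ 2.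
    have z0 : 0 <= K' * (1 + ln l%:R) by apply: mulr_ge0 => //; exact: addr_ge0.
    by rewrite lerXn2r ?nnegrE// (le_trans z0 kl).
  rewrite lee_fin exprVn.
  set x := ln l%:R in kl2 *; set y := (l%:R ^+ 3)^-1.
  have y0 : 0 <= y by rewrite invr_ge0 exprn_ge0.
  have := ler_wpM2l (_ : 0 <= 16 * t) kl2; rewrite mulr_ge0// => /(_ isT) le1.
  have h1 : 0 <= t * x ^+ 2 by rewrite mulr_ge0// sqr_ge0.
  have h2 : 0 <= t ^+ 2 * y by rewrite mulr_ge0// sqr_ge0.
  have h3 : 0 <= (2 * v + 2 * C') * (t * x ^+ 2).
    by rewrite mulr_ge0// addr_ge0 ?mulr_ge0.
  have h4 : 0 <= (2 * v + 16 * k ^+ 2) * (t ^+ 2 * y).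
    by do ![exact: sqr_ge0 | by [] | apply: addr_ge0 | apply: mulr_ge0].
  have -> : (2 * v + 16 * k ^+ 2 + 2 * C') * (t * x ^+ 2 + t ^+ 2 * y) =
    16 * t * (k * x) ^+ 2 + 2 * t ^+ 2 * (C' * y)
    + ((2 * v + 2 * C') * (t * x ^+ 2) + (2 * v + 16 * k ^+ 2) * (t ^+ 2 * y)) by ring.
  by lra.
exists (c1 + c2) => d T P eta Heta; split => [_|phi1] t l t0 l0.
  have [lV2 EV2] := V2C l l0; rewrite L1.
  apply: le_trans (additive_functional_bound hr hnub Heta (V1 := V1 l) (V2 := V2 l)
     (fun xi => VE l xi l0) (V1K l l0) lV2 EV2 t0) _.
  rewrite lee_fin exprMn sqr_sqrtr ?ler0n// exprVn.
  set y := (l%:R ^+ 2)^-1; set x := l%:R.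
  have y0 : 0 <= y by rewrite invr_ge0 exprn_ge0.
  have h1 : 0 <= t * x by rewrite mulr_ge0// ler0n.
  have h2 : 0 <= t ^+ 2 * y by rewrite mulr_ge0// sqr_ge0.
  have h3 : 0 <= (2 * C + c2) * (t * x) by rewrite mulr_ge0// addr_ge0 ?mulr_ge0.
  have h4 : 0 <= (16 * K ^+ 2 + c2) * (t ^+ 2 * y).
    by do ![exact: sqr_ge0 | by [] | apply: addr_ge0 | apply: mulr_ge0].
  have -> : (c1 + c2) * (t * x + t ^+ 2 * y) =
    16 * t * (K ^+ 2 * x) + 2 * t ^+ 2 * (C * y)
    + ((2 * C + c2) * (t * x) + (16 * K ^+ 2 + c2) * (t ^+ 2 * y)) by rewrite /c1; ring.
  by lra.
rewrite L2 [2 * _]mulrC mulfK ?pnatr_eq0//.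
rewrite L1 in phi1; apply: le_trans (hc2 phi1 d T P eta Heta t l t0 l0) _.
rewrite lee_fin ler_wpM2r ?lerDr//.
by rewrite addr_ge0// mulr_ge0 ?sqr_ge0// invr_ge0.
Qed.
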